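(* Let $k\ge 0$ be an integer. With the notation of the context, write $\mathrm d$ for both differentials $\mathrm d_1$ and $\mathrm d_2$ of the complex $C^q=\mathrm{Hom}_{\mathfrak l_{\mathbb C}}(\Lambda^q\mathfrak p_{\mathbb C}, I_{\phi_\infty}\otimes V_k)$. Then the following hold. (i) $\mathrm d\chi^k=\frac{1}{\sqrt{k+2}}\,\psi^k+\psi^k_0$. (ii) $\mathrm d\psi^k_0=0=\mathrm d\psi^k$. (iii) The elements $\psi^k$ and $\psi^k_0$ do not belong to the image of $\mathrm d$. (iv) Each one of the elements $\psi^k$ and $\psi^k_0$ defines a generator of the (one-dimensional) space $H^2(\mathfrak g,\mathfrak l, I_{\phi_\infty}\otimes V_k)$. The element $\psi^k$ is supported on $\Lambda^{1,1}(\mathfrak p_{\mathbb C})$ and the element $\psi^k_0$ is supported on $\Lambda^{0,2}(\mathfrak p_{\mathbb C})$.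
   Context: **Groups.** $\mathsf i$ is a fixed square root of $-1$. $V=\mathbb C^3$ with the hermitian form $J=\mathrm{diag}(1,1,-1)$; $G=\mathrm{SU}(2,1)\subset \mathrm{SL}_3(\mathbb C)$ is the group of determinant-one automorphisms preserving $J$, $\mathfrak g=\{X\in\mathfrak{sl}_3(\mathbb C): \overline X^{\top}J+JX=0\}$ its real Lie algebra. $K_\infty=\{\mathrm{diag}(U,\det(U)^{-1}) : U\in \mathrm U(2)\}\simeq \mathrm U(2)$ is a maximal compact subgroup with Lie algebra $\mathfrak l$. Let $\gamma=\begin{pmatrix}1/\sqrt2&0&1/\sqrt2\\0&1&0\\1/\sqrt2&0&-1/\sqrt2\end{pmatrix}$; then $\gamma^{-1}G\gamma$ is the group preserving the antidiagonal form $\begin{pmatrix}0&0&1\\0&1&0\\1&0&0\end{pmatrix}$. Let $B$ be the group of upper triangular matrices in $\gamma^{-1}G\gamma$; $B=T\ltimes N$ with $T=\{\mathrm{diag}(re^{\mathsf it},e^{-2\mathsf it},r^{-1}e^{\mathsf it}): r\in\mathbb R\setminus\{0\},t\in\mathbb R\}$ and $N$ the unipotent upper triangular elements; $A\subset T$ is the subgroup of elements $\mathrm{diag}(r,1,r^{-1})$, $r>0$. For a subgroup $H$ write $H^\gamma=\gamma H\gamma^{-1}$. The Iwasawa decomposition is $G=K_\infty A^\gamma N^\gamma$. **Principal series.** $\phi_\infty$ is the character of $T$ given by $\mathrm{diag}(re^{\mathsf it},e^{-2\mathsf it},r^{-1}e^{\mathsf it})\mapsto r^3(e^{\mathsf it})^{2k+3}$,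 extended to $B$ trivially on $N$. $I_{\phi_\infty}$ is the space of smooth $f:G\to\mathbb C$ with $f(gb)=\phi_\infty(\gamma^{-1}b\gamma)^{-1}f(g)$ for all $g\in G$, $b\in B^\gamma$, with $G$ acting by left translations $(g.f)(x)=f(g^{-1}x)$; $I_{\phi_\infty}$ is identified with its subspace of $K_\infty$-finite vectors, a $(\mathfrak g,K_\infty)$-module, with $X\in\mathfrak g$ acting by $(X\cdot f)(g)=\frac{d}{dt}f(e^{-tX}g)|_{t=0}$; the action is extended $\mathbb C$-linearly to $\mathfrak g_{\mathbb C}=\mathfrak{sl}_3(\mathbb C)$. **Wigner functions.** Parametrize $\mathrm U(2)$ as the matrices $$\begin{pmatrix} e^{\frac{\mathsf i}{2}(-\zeta-\phi-\psi)}\cos\frac\theta2 & -e^{\frac{\mathsf i}{2}(-\zeta+\phi-\psi)}\sin\frac\theta2\\ e^{\frac{\mathsf i}{2}(-\zeta-\phi+\psi)}\sin\frac\theta2 & e^{\frac{\mathsf i}{2}(-\zeta+\phi+\psi)}\cos\frac\theta2\end{pmatrix},\quad \zeta\in\mathbb R,\ \phi\in(-\pi,\pi],\ \theta\in[0,\pi],\ \psi\in(-\pi,3\pi].$$ For $j\in\frac12\mathbb Z_{\ge0}$, $n\in\frac12\mathbb Z$ with $j+n\in\mathbb Z$, and $m_1,m_2\in\{-j,-j+1,\dots,j\}$, let $W^{j,n}_{m_1,m_2}$ be the smooth function on $\mathrm U(2)\simeq K_\infty$ with value $c^j_{m_1}c^j_{m_2}e^{\mathsf in\zeta}e^{\mathsf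 i(m_1\psi+m_2\phi)}d^{(j,n)}_{m_1,m_2}(\theta)$ at the matrix $\begin{pmatrix} e^{\frac{\mathsf i}{2}(-\zeta-\phi-\psi)}\cos\frac\theta2 & -e^{\frac{\mathsf i}{2}(-\zeta+\phi-\psi)}\sin\frac\theta2\\ e^{\frac{\mathsf i}{2}(-\zeta-\phi+\psi)}\sin\frac\theta2 & e^{\frac{\mathsf i}{2}(-\zeta+\phi+\psi)}\cos\frac\theta2\end{pmatrix}$ with parameters $\zeta,\phi,\theta,\psi$, where $c^j_m=\sqrt{(j+m)!(j-m)!}$ and $$d^{(j,n)}_{m_1,m_2}(\theta)=\frac{(\sin\frac\theta2)^{m_1-m_2}(\cos\frac\theta2)^{m_1+m_2}}{(j+m_2)!(j-m_2)!}P^{(m_1-m_2,m_1+m_2)}_{j-m_1}(\cos\theta)$$ (extended by continuity in $\theta$), with $P^{(\alpha,\beta)}_c(x)=\sum_{s=0}^{c}\binom{c+\alpha}{c-s}\binom{c+\beta}{s}\left(\frac{x-1}{2}\right)^s\left(\frac{x+1}{2}\right)^{c-s}$ the Jacobi polynomial (generalized binomial coefficients). If $n=3m_2-2k-3$, then $W^{j,n}_{m_1,m_2}$ extends uniquely, via $G=K_\infty A^\gamma N^\gamma$, to an element of $I_{\phi_\infty}$, denoted by the same symbol; these span the $K_\infty$-finite vectors. **The module $V_k$.** $V_k$ is the space of complex homogeneous polynomials of degree $k$ in $x,y,z$, with $(g.p)(x,y,z)=p(g^{\top}(x,y,z)^{\top})$ for $g\in G$ (so $V_k\simeq \mathrm{Sym}^kV$),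 and the differentiated action of $\mathfrak g$, extended $\mathbb C$-linearly. $I_{\phi_\infty}\otimes V_k$ has the tensor product action. **Lie algebra elements.** Let $E_{ab}$ be the elementary $3\times3$ matrices. In $\mathfrak l$: $U_0=\frac12\mathrm{diag}(\mathsf i,\mathsf i,-2\mathsf i)$, $U_1=\frac{\mathsf i}{2}(E_{12}+E_{21})$, $U_2=\frac12(E_{12}-E_{21})$, $U_3=\frac12\mathrm{diag}(\mathsf i,-\mathsf i,0)$. Identify $(\mathfrak g/\mathfrak l)_{\mathbb C}$ with $\mathfrak p_{\mathbb C}\subset\mathfrak{sl}_3(\mathbb C)$, the span of $X_1=E_{13}$, $X_2=E_{23}$, $X_3=E_{31}$, $X_4=E_{32}$, on which $\mathfrak l_{\mathbb C}$ acts by bracket. Put $\mathfrak p^+=\langle X_1,X_2\rangle$, $\mathfrak p^-=\langle X_3,X_4\rangle$, $X_{ij}=X_i\wedge X_j$, and $\Lambda^{p,q}(\mathfrak p_{\mathbb C})=\Lambda^p\mathfrak p^+\otimes\Lambda^q\mathfrak p^-$ for $p+q=2$, so $\Lambda^2\mathfrak p_{\mathbb C}=\bigoplus_{p+q=2}\Lambda^{p,q}(\mathfrak p_{\mathbb C})$. A linear map on $\Lambda^2\mathfrak p_{\mathbb C}$ is supported on $\Lambda^{p,q}$ if it vanishes on the other two summands. **Relative Lie algebra cohomology.** $H^\bullet(\mathfrak g,\mathfrak l,I_{\phi_\infty}\otimes V_k)$ is the cohomology of the complex with terms $\mathrm{Hom}_{\mathfrak l}(\Lambda^q(\mathfrak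 g/\mathfrak l),I_{\phi_\infty}\otimes V_k)=\mathrm{Hom}_{\mathfrak l_{\mathbb C}}(\Lambda^q\mathfrak p_{\mathbb C},I_{\phi_\infty}\otimes V_k)$ and differential $$\mathrm d_q(\psi)(X_0,\dots,X_q)=\sum_{i}(-1)^iX_i.\psi(X_0,\dots,\hat X_i,\dots,X_q)+\sum_{i<j}(-1)^{i+j}\psi([X_i,X_j],X_0,\dots,\hat X_i,\dots,\hat X_j,\dots,X_q),$$ with brackets taken modulo $\mathfrak l_{\mathbb C}$ (so the second sum vanishes for arguments in $\mathfrak p_{\mathbb C}$). **The elements.** Put - $W^k_l=W^{\frac k2+1,-\frac k2}_{-\frac k2+l,\frac k2+1}$ for $-1\le l\le k+1$; $W^k_{0,l}=W^{\frac k2,-\frac k2-3}_{-\frac k2+l,\frac k2}$ for $0\le l\le k$; $W^k_{\chi,l}=W^{\frac k2+\frac12,-\frac k2-\frac32}_{-\frac k2-\frac12+l,\frac k2+\frac12}$ for $0\le l\le k+1$. - For $0\le l\le k$: $\alpha_l=\frac{k-l+1}{k+1}\sqrt{l+1}\sqrt{\binom{k+1}{l}}$, $\beta_l=\sqrt{\binom kl}$, $\gamma_l=\sqrt{\frac{k+1-l}{k+1}}\sqrt{\binom kl}$. - $w^k_{13}=\sum_{l=0}^k\alpha_lW^k_l\otimes x^{k-l}y^l$, $w^k_{24}=-w^k_{13}$, $w^k_{23}=-\mathsf i\,(U_1-\mathsf iU_2)\cdot w^k_{13}$, $w^k_{14}=\mathsf i\,(U_1+\mathsf iU_2)\cdot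 w^k_{13}$. - $\psi^k:\Lambda^2\mathfrak p_{\mathbb C}\to I_{\phi_\infty}\otimes V_k$ is the linear map with $X_{12}\mapsto0$, $X_{34}\mapsto0$, and $X_{ij}\mapsto w^k_{ij}$ for $(i,j)\in\{(1,3),(1,4),(2,3),(2,4)\}$. - $\psi^k_0:\Lambda^2\mathfrak p_{\mathbb C}\to I_{\phi_\infty}\otimes V_k$ is the linear map with $X_{34}\mapsto\sum_{l=0}^k\beta_lW^k_{0,l}\otimes x^{k-l}y^l$ and $X_{ij}\mapsto0$ for all $i<j$, $(i,j)\ne(3,4)$. - $\chi^k:\mathfrak p_{\mathbb C}\to I_{\phi_\infty}\otimes V_k$ is the linear map with $X_1,X_2\mapsto0$, $X_3\mapsto\chi^k_3:=\sum_{l=0}^k\gamma_lW^k_{\chi,l}\otimes x^{k-l}y^l$, $X_4\mapsto\mathsf i\,(U_1+\mathsf iU_2)\cdot\chi^k_3$. It is $\mathfrak l_{\mathbb C}$-equivariant. *)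

(* Defs.v *)
From HB Require Import structures.
From mathcomp Require Import all_boot all_order all_algebra.
From mathcomp Require Import complex.
From mathcomp.multinomials Require Import -(notations) mpoly.
From mathcomp Require Import all_classical all_reals all_analysis.

Set Implicit Arguments.
Unset Strict Implicit.
Unset Printing Implicit Defensive.

Import Order.TTheory GRing.Theory Num.Theory numFieldNormedType.Exports.

Local Open Scope classical_set_scope.
Local Open Scope ring_scope.
Local Open Scope complex_scope.
Local Open Scope sesquilinear_scope.

Section SU21.
Variable R : realType.
Local Notation C := R[i].

Definition mx3 (s : seq (seq C)) : 'M[C]_3 :=
  \matrix_(i, j) nth 0 (nth [::] s i) j.

Definition J : 'M[C]_3 :=
  mx3 [:: [:: 1; 0; 0]; [:: 0; 1; 0]; [:: 0; 0; -1]].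

Definition in_SU21 (g : 'M[C]_3) : bool :=
  (g ^t* *m J *m g == J) && (\det g == 1).

Record SU21 := MkSU21 { SU21_mx :> 'M[C]_3; SU21P : in_SU21 SU21_mx }.
HB.instance Definition _ := [isSub for SU21_mx].
HB.instance Definition _ := [Choice of SU21 by <:].

Lemma J_sqr : J *m J = 1%:M.
Proof.
apply/matrixP => i j; rewrite !mxE !big_ord_recl big_ord0 !mxE.
by case: i => [[|[|[|i]]] Hi] //; case: j => [[|[|[|j]]] Hj] //=;
  rewrite ?mulr0 ?mul0r ?mulr1 ?mulrNN ?addr0 ?add0r //= ?mulr1.
Qed.

Lemma in_SU21_1 : in_SU21 1%:M.
Proof. by rewrite /in_SU21 trmx1 map_mx1 mul1mx mulmx1 det1 !eqxx. Qed.

Lemma in_SU21_M g h : in_SU21 g -> in_SU21 h -> in_SU21 (g *m h).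
Proof.
move=> /andP[/eqP gJ /eqP dg] /andP[/eqP hJ /eqP dh].
rewrite /in_SU21 det_mulmx dg dh mulr1 eqxx andbT trmx_mul map_mxM.
by rewrite -2!mulmxA [J *m _]mulmxA [_ *m (_ *m h)]mulmxA
  [_ *m (J *m g)]mulmxA gJ mulmxA hJ.
Qed.

Definition SU21_inv_mx (g : 'M[C]_3) : 'M[C]_3 := J *m g ^t* *m J.

Lemma SU21_mulVmx g : in_SU21 g -> SU21_inv_mx g *m g = 1%:M.
Proof.
move=> /andP[/eqP gJ _].
by rewrite /SU21_inv_mx -2!mulmxA [_ *m (J *m g)]mulmxA gJ J_sqr.
Qed.

Lemma SU21_mulmxV g : in_SU21 g -> g *m SU21_inv_mx g = 1%:M.
Proof. by move/SU21_mulVmx/mulmx1C. Qed.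

Lemma in_SU21_V g : in_SU21 g -> in_SU21 (SU21_inv_mx g).
Proof.
move=> gG; have /andP[/eqP gJ /eqP dg] := gG; have gV := SU21_mulmxV gG.
have dV : \det (SU21_inv_mx g) = 1.
  by rewrite -[LHS]mul1r -dg -det_mulmx gV det1.
rewrite /in_SU21 dV eqxx andbT -{1}gJ.
rewrite -!mulmxA gV mulmx1 mulmxA -map_mxM -trmx_mul gV.
by rewrite trmx1 map_mx1 mul1mx.
Qed.

Definition SU21_1 : SU21 := MkSU21 in_SU21_1.
Definition SU21_mul (g h : SU21) : SU21 :=
  MkSU21 (in_SU21_M (SU21P g) (SU21P h)).
Definition SU21_inv (g : SU21) : SU21 := MkSU21 (in_SU21_V (SU21P g)).

Lemma SU21_mulA : associative SU21_mul.
Proof. by move=> x y z; apply: val_inj; rewrite /= mulmxA. Qed.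
Lemma SU21_mul1 : left_id SU21_1 SU21_mul.
Proof. by move=> x; apply: val_inj; rewrite /= mul1mx. Qed.
Lemma SU21_mulr1 : right_id SU21_1 SU21_mul.
Proof. by move=> x; apply: val_inj; rewrite /= mulmx1. Qed.
Lemma SU21_mulV : left_inverse SU21_1 SU21_inv SU21_mul.
Proof. by move=> x; apply: val_inj; rewrite /= SU21_mulVmx ?SU21P. Qed.
Lemma SU21_mulrV : right_inverse SU21_1 SU21_inv SU21_mul.
Proof. by move=> x; apply: val_inj; rewrite /= SU21_mulmxV ?SU21P. Qed.

HB.instance Definition _ := isGroup.Build SU21
  SU21_mulA SU21_mul1 SU21_mulr1 SU21_mulV SU21_mulrV.

Definition su21 (X : 'M[C]_3) : Prop :=
  X ^t* *m J + J *m X = 0 /\ \tr X = 0.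

(* X = su21_re X + i su21_im X is the decomposition along
   sl_3(C) = su21 (+) i su21, from the conjugation X |-> - J X^* J of sl_3(C)
   whose fixed points are su21. *)
Definition su21_re (X : 'M[C]_3) : 'M[C]_3 :=
  2%:R^-1 *: (X - J *m X ^t* *m J).
Definition su21_im (X : 'M[C]_3) : 'M[C]_3 :=
  (2%:R * 'i)^-1 *: (X + J *m X ^t* *m J).

Lemma J_adj : J ^t* = J.
Proof.
apply/matrixP => i j; rewrite !mxE.
by case: i => [[|[|[|i]]] Hi] //; case: j => [[|[|[|j]]] Hj] //=;
  rewrite ?rmorphN ?rmorph1 ?rmorph0.
Qed.

Lemma adjM m n p (A : 'M[C]_(m, n)) (B : 'M[C]_(n, p)) :
  (A *m B) ^t* = B ^t* *m A ^t*.
Proof. by rewrite trmx_mul map_mxM. Qed.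

Lemma mxtrace_JadjJ (X : 'M[C]_3) : \tr X = 0 -> \tr (J *m X ^t* *m J) = 0.
Proof.
move=> trX; rewrite mxtrace_mulC mulmxA J_sqr mul1mx.
have -> : \tr (X ^t*) = (\tr X)^*%R.
  by rewrite /mxtrace rmorph_sum; apply: eq_bigr => i _; rewrite !mxE.
by rewrite trX rmorph0.
Qed.

Lemma su21_reP (X : 'M[C]_3) : \tr X = 0 -> su21 (su21_re X).
Proof.
move=> trX; split; last first.
  by rewrite mxtraceZ raddfB /= trX mxtrace_JadjJ // subrr mulr0.
have r2 : (2%:R^-1 : C)^*%R = 2%:R^-1 by rewrite fmorphV rmorph_nat.
rewrite /su21_re linearZ map_mxZ /= r2 linearB map_mxB /= !adjM J_adj trmxCK.
rewrite -scalemxAl -scalemxAr mulmxBl mulmxBr !mulmxA J_sqr mul1mx.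
by rewrite -[_ *m J *m J]mulmxA J_sqr mulmx1 -scalerDr addrC subrKA subrr
  scaler0.
Qed.

Lemma su21_imP (X : 'M[C]_3) : \tr X = 0 -> su21 (su21_im X).
Proof.
move=> trX; split; last first.
  by rewrite mxtraceZ raddfD /= trX mxtrace_JadjJ // addr0 mulr0.
have r2 : ((2%:R * 'i)^-1 : C)^*%R = - (2%:R * 'i)^-1.
  by rewrite fmorphV rmorphM rmorph_nat -invrN -mulrN; congr (_ * _)^-1;
    apply/eqP; rewrite eq_complex /= oppr0 !eqxx.
rewrite /su21_im linearZ map_mxZ /= r2 linearD map_mxD /= !adjM J_adj trmxCK.
rewrite -scalemxAl -scalemxAr mulmxDl mulmxDr !mulmxA J_sqr mul1mx.
by rewrite -[_ *m J *m J]mulmxA J_sqr mulmx1 scaleNr [J *m X + _]addrC addNr.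
Qed.

Lemma su21_decomp (X : 'M[C]_3) : X = su21_re X + 'i *: su21_im X.
Proof.
have i0 : ('i : C) != 0 by rewrite eq_complex /= oner_eq0 andbF.
set Y := J *m X ^t* *m J; rewrite /su21_re /su21_im -/Y.
apply/matrixP => i j; rewrite !mxE; move: (Y i j) (X i j) => y x.
have -> : (2%:R * 'i)^-1 = 'i^-1 * 2%:R^-1 :> C by rewrite invfM mulrC.
rewrite !mulrA divff // mul1r -mulrDr addrCA subrK.
by rewrite -mulr2n -[x *+ 2]mulr_natl mulrA mulVf ?mul1r ?pnatr_eq0.
Qed.
Definition limC (u : nat -> C) : C :=
  lim ((fun n => complex.Re (u n)) @ \oo) +i*
  lim ((fun n => complex.Im (u n)) @ \oo).

Definition mexp (X : 'M[C]_3) : 'M[C]_3 :=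
  \matrix_(i, j) limC (fun n => (\sum_(m < n) (m`!%:R)^-1 *: X ^+ m) i j).

(* For X in su21 the exponential lies in the group, so the default value of
   insubd plays no role. *)
Definition expG (X : 'M[C]_3) : SU21 := insubd (1%g : SU21) (mexp X).

Definition derive0 (c : R -> C) : C :=
  derive1 (fun t => complex.Re (c t)) 0 +i*
  derive1 (fun t => complex.Im (c t)) 0.

(* C^oo on an open set: all iterated directional derivatives are Frechet
   differentiable there. *)
Definition smooth_on (E : normedModType R) (U : set E) (F : E -> R) : Prop :=
  forall (vs : seq E) (x : E), U x ->
    differentiable (foldr (fun v H => 'D_v H) F vs) x.

Definition realify (g : 'M[C]_3) : 'M[R]_3 * 'M[R]_3 :=
  (map_mx (@complex.Re R) g, map_mx (@complex.Im R) g).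

(* f is smooth when it extends, around each point of the submanifold SU(2,1)
   of M_3(C) = R^18, to a smooth function on an open subset of M_3(C). *)
Definition smooth (f : SU21 -> C) : Prop :=
  forall g : SU21, exists (U : set ('M[R]_3 * 'M[R]_3)%type)
      (F1 F2 : 'M[R]_3 * 'M[R]_3 -> R),
    [/\ open U, U (realify g), smooth_on U F1, smooth_on U F2 &
        forall h : SU21, U (realify h) ->
          f h = F1 (realify h) +i* F2 (realify h)].

Definition Kmx (U : 'M[C]_2) : 'M[C]_3 := block_mx U 0 0 (\det U)^-1%:M.

Definition Kinf : set SU21 :=
  [set h | exists2 U : 'M[C]_2, U \is unitarymx & h = Kmx U :> 'M[C]_3].

Definition Kfinite (f : SU21 -> C) : Prop :=
  exists (n : nat) (e : 'I_n -> SU21 -> C), forall h, Kinf h ->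
    exists c : 'I_n -> C,
      forall g, f (h^-1 * g)%g = \sum_(i < n) c i * e i g.

Definition expi (t : R) : C := cos t +i* sin t.

Definition rsqrt2 : C := (Num.sqrt 2%:R)^-1%:C.

Definition gam : 'M[C]_3 :=
  mx3 [:: [:: rsqrt2; 0; rsqrt2]; [:: 0; 1; 0]; [:: rsqrt2; 0; - rsqrt2]].

Definition Tmx (r t : R) : 'M[C]_3 :=
  mx3 [:: [:: r%:C * expi t; 0; 0];
          [:: 0; expi (- (t *+ 2)); 0];
          [:: 0; 0; r^-1%:C * expi t]].

Definition Nmx (n : 'M[C]_3) : Prop :=
  [/\ in_SU21 (gam *m n *m invmx gam), forall i, n i i = 1 &
      forall i j : 'I_3, (j < i)%N -> n i j = 0].

Definition phi_inf (k : nat) (r t : R) : C :=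
  (r ^+ 3)%:C * expi t ^+ (2 * k + 3).

(* b ranges over gamma B gamma^-1 through B = T N, and the character is trivial
   on N. *)
Definition I_phi (k : nat) (f : SU21 -> C) : Prop :=
  [/\ smooth f,
      forall (g b : SU21) (r t : R) (n : 'M[C]_3), r != 0 -> Nmx n ->
        b = gam *m (Tmx r t *m n) *m invmx gam :> 'M[C]_3 ->
        f (g * b)%g = (phi_inf k r t)^-1 * f g
    & Kfinite f].

Definition actI (X : 'M[C]_3) (f : SU21 -> C) : SU21 -> C :=
  fun g => derive0 (fun t : R => f (expG (- t%:C *: X) * g)%g).

Definition actIC (X : 'M[C]_3) (f : SU21 -> C) : SU21 -> C :=
  fun g => actI (su21_re X) f g + 'i * actI (su21_im X) f g.

Definition binomR (x : R) (s : nat) : R :=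
  (\prod_(i < s) (x - i%:R)) / s`!%:R.

Definition jacobi (a b : R) (c : nat) (x : R) : R :=
  \sum_(s < c.+1) binomR (c%:R + a) (c - s) * binomR (c%:R + b) s *
    ((x - 1) / 2%:R) ^+ s * ((x + 1) / 2%:R) ^+ (c - s).

Definition eulermx (zeta phi theta psi : R) : 'M[C]_2 :=
  let e a : C := expi (a / 2%:R) in
  let c : C := (cos (theta / 2%:R))%:C in
  let s : C := (sin (theta / 2%:R))%:C in
  \matrix_(i, j)
    if (i == 0) && (j == 0) then e (- zeta - phi - psi) * c
    else if i == 0 then - (e (- zeta + phi - psi) * s)
    else if j == 0 then e (- zeta - phi + psi) * s
    else e (- zeta + phi + psi) * c.

(* The half-integers j, n, m1, m2 are real numbers; sums and differences that
   are integers are converted by truncn and floor. *)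
Definition wigner_c (j m : R) : R :=
  Num.sqrt ((Num.truncn (j + m))`! * (Num.truncn (j - m))`!)%:R.

Definition wigner_d (j m1 m2 theta : R) : R :=
  sin (theta / 2%:R) ^ Num.floor (m1 - m2) *
  cos (theta / 2%:R) ^ Num.floor (m1 + m2) /
  ((Num.truncn (j + m2))`! * (Num.truncn (j - m2))`!)%:R *
  jacobi (m1 - m2) (m1 + m2) (Num.truncn (j - m1)) (cos theta).

Definition wigner_val (j n m1 m2 zeta phi theta psi : R) : C :=
  (wigner_c j m1 * wigner_c j m2)%:C * expi (n * zeta) *
  expi (m1 * psi + m2 * phi) * (wigner_d j m1 m2 theta)%:C.

(* The formula is imposed for 0 < theta < pi, where the powers of sin and cos
   make sense; the values at theta = 0, pi are those given by continuity,
   since elements of I_phi are smooth. *)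
Definition is_wigner (k : nat) (j n m1 m2 : R) (f : SU21 -> C) : Prop :=
  I_phi k f /\
  forall (zeta phi theta psi : R) (h : SU21),
    - pi < phi <= pi -> 0 < theta < pi -> - pi < psi <= 3%:R * pi ->
    h = Kmx (eulermx zeta phi theta psi) :> 'M[C]_3 ->
    f h = wigner_val j n m1 m2 zeta phi theta psi.

(* The unique f such that is_wigner k j n m1 m2 f, when n = 3 m2 - 2k - 3. *)
Definition wigner (k : nat) (j n m1 m2 : R) : SU21 -> C :=
  xget (fun=> 0) [set f | is_wigner k j n m1 m2 f].

Definition homog (k : nat) (p : mpoly 3 C) : Prop := p \is ishomog1 k mdeg.

(* (g.p)(x,y,z) = p(g^T (x,y,z)^T) *)
Definition actVG (g : 'M[C]_3) (p : mpoly 3 C) : mpoly 3 C :=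
  comp_mpoly [tuple \sum_(j < 3) g j i *: mpolyX C (mnm1 j) | i < 3] p.

(* Polynomials of degree at most k are differentiated coefficientwise. *)
Definition derive0V (k : nat) (c : R -> mpoly 3 C) : mpoly 3 C :=
  \sum_(m : bmultinom 3 k.+1) derive0 (fun t => mcoeff m (c t)) *: mpolyX C m.

Definition actV (k : nat) (X : 'M[C]_3) (p : mpoly 3 C) : mpoly 3 C :=
  derive0V k (fun t : R => actVG (mexp (t%:C *: X)) p).

Definition actVC (k : nat) (X : 'M[C]_3) (p : mpoly 3 C) : mpoly 3 C :=
  actV k (su21_re X) p + 'i *: actV k (su21_im X) p.

(* As V_k is finite dimensional, I_phi (x) V_k is the space of V_k-valued
   functions on the group whose coefficients on monomials are in I_phi; an
   element F is the sum over monomials m of degree k of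
   (fun g => mcoeff m (F g)) (x) m. *)
Local Notation M := (SU21 -> mpoly 3 C).

Definition tens (f : SU21 -> C) (p : mpoly 3 C) : M := fun g => f g *: p.

Definition IV (k : nat) (F : M) : Prop :=
  (forall g, homog k (F g)) /\
  (forall m, I_phi k (fun g => mcoeff m (F g))).

Definition actT (k : nat) (X : 'M[C]_3) (F : M) : M :=
  \sum_(m : bmultinom 3 k.+1)
    (tens (actIC X (fun g => mcoeff m (F g))) (mpolyX C m) +
     tens (fun g => mcoeff m (F g)) (actVC k X (mpolyX C m))).

Definition Emx (a b : 'I_3) : 'M[C]_3 := delta_mx a b.

Definition U0 : 'M[C]_3 :=
  2%:R^-1 *: mx3 [:: [:: 'i; 0; 0]; [:: 0; 'i; 0]; [:: 0; 0; - (2%:R * 'i)]].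
Definition U1 : 'M[C]_3 := ('i / 2%:R) *: (Emx 0 1 + Emx 1 0).
Definition U2 : 'M[C]_3 := 2%:R^-1 *: (Emx 0 1 - Emx 1 0).
Definition U3 : 'M[C]_3 :=
  2%:R^-1 *: mx3 [:: [:: 'i; 0; 0]; [:: 0; - 'i; 0]; [:: 0; 0; 0]].

Definition lC : {vspace 'M[C]_3} := <<[:: U0; U1; U2; U3]>>%VS.

Definition X1 : 'M[C]_3 := Emx 0 2.
Definition X2 : 'M[C]_3 := Emx 1 2.
Definition X3 : 'M[C]_3 := Emx 2 0.
Definition X4 : 'M[C]_3 := Emx 2 1.
Definition Xs : 4.-tuple 'M[C]_3 := [tuple X1; X2; X3; X4].

Definition pC : {vspace 'M[C]_3} := <<Xs>>%VS.
Definition pplus : {vspace 'M[C]_3} := <<[:: X1; X2]>>%VS.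
Definition pminus : {vspace 'M[C]_3} := <<[:: X3; X4]>>%VS.
Local Notation P := (subvs_of pC).

Definition bracket (A B : 'M[C]_3) : 'M[C]_3 := A *m B - B *m A.

(* The projection of sl_3(C) on pC with kernel lC. *)
Definition mod_l (A : 'M[C]_3) : P :=
  vsproj pC (A 0 2 *: X1 + A 1 2 *: X2 + A 2 0 *: X3 + A 2 1 *: X4).

(* A linear map on the q-th exterior power of pC is an alternating q-linear
   map on pC. *)
Local Notation altmap q := (('I_q -> P) -> M).

Definition upd (q : nat) (Y : 'I_q -> P) (i : 'I_q) (y : P) : 'I_q -> P :=
  fun j => if j == i then y else Y j.

Definition alternating (q : nat) (w : altmap q) : Prop :=
  (forall (Y : 'I_q -> P) (i : 'I_q) (a : C) (y z : P),
      w (upd Y i (a *: y + z)) = a *: w (upd Y i y) + w (upd Y i z)) /\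
  (forall (Y : 'I_q -> P) (i j : 'I_q), i != j -> Y i = Y j -> w Y = 0).

Definition l_equivariant (k q : nat) (w : altmap q) : Prop :=
  forall U, U \in lC -> forall Y : 'I_q -> P,
    actT k U (w Y) =
    \sum_(i < q) w (upd Y i (mod_l (bracket U (vsval (Y i))))).

Definition cochain (k q : nat) (w : altmap q) : Prop :=
  [/\ forall Y, IV k (w Y), alternating w & l_equivariant k w].

(* In the second sum, the arguments are the bracket followed by the Y s for s
   different from i < j, in increasing order. *)
Definition dCE (k q : nat) (w : altmap q) : altmap q.+1 := fun Y =>
  \sum_(i < q.+1)
     (-1) ^+ i *: actT k (vsval (Y i)) (w (fun s => Y (lift i s))) +
  \sum_(i < q.+1) \sum_(j < q.+1 | (i < j)%N)
     (-1) ^+ (i + j) *: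
     w (fun s : 'I_q =>
          if val s is s'.+1 then Y (inord (bump j (bump i s')))
          else mod_l (bracket (vsval (Y i)) (vsval (Y j)))).

Definition cocycle (k q : nat) (w : altmap q) : Prop :=
  cochain k w /\ dCE k w = 0.

Definition coboundary (k q : nat) : altmap q -> Prop :=
  if q is q'.+1 then
    fun w => exists2 b : altmap q', cochain k b & w = dCE k b
  else fun w => w = 0.

Definition coh_class (k q : nat) (w : altmap q) : set (altmap q) :=
  [set z | cocycle k z /\ coboundary k (z - w)].

Definition cohomology (k q : nat) : set (set (altmap q)) :=
  [set coh_class k w | w in [set w | cocycle k w]].
Arguments cohomology : clear implicits.

Definition coh_generator (k q : nat) (w : altmap q) : Prop :=
  cocycle k w /\
  cohomology k q = [set coh_class k (a *: w) | a in [set: C]].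

(* There is a class w such that a |-> [a w] is a bijection, hence a linear
   isomorphism, from C onto the cohomology. *)
Definition coh_dim_one (k q : nat) : Prop :=
  exists2 w : altmap q, cocycle k w &
    set_bij [set: C] (cohomology k q) (fun a => coh_class k (a *: w)).

(* Vanishing on the (a, q - a) part of the exterior power. *)
Definition vanishes_on (q a : nat) (w : altmap q) : Prop :=
  forall Y : 'I_q -> P,
    (forall i : 'I_q,
       vsval (Y i) \in (if (i < a)%N then pplus else pminus)) ->
    w Y = 0.

Definition supported_on (q a : nat) (w : altmap q) : Prop :=
  forall a', (a' <= q)%N -> a' != a -> vanishes_on a' w.

Definition hf (x : R) : R := x / 2%:R.

Definition mon (k l : nat) : mpoly 3 C :=
  mpolyX C (mnm1 0) ^+ (k - l) * mpolyX C (mnm1 1) ^+ l.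

Definition W (k l : nat) : SU21 -> C :=
  wigner k (hf k%:R + 1) (- hf k%:R) (- hf k%:R + l%:R) (hf k%:R + 1).

Definition W0 (k l : nat) : SU21 -> C :=
  wigner k (hf k%:R) (- hf k%:R - 3%:R) (- hf k%:R + l%:R) (hf k%:R).

Definition Wchi (k l : nat) : SU21 -> C :=
  wigner k (hf k%:R + hf 1) (- hf k%:R - hf 3%:R)
    (- hf k%:R - hf 1 + l%:R) (hf k%:R + hf 1).

Definition alpha (k l : nat) : R :=
  (k - l + 1)%:R / k.+1%:R * Num.sqrt l.+1%:R * Num.sqrt 'C(k.+1, l)%:R.
Definition beta (k l : nat) : R := Num.sqrt 'C(k, l)%:R.
Definition gamma (k l : nat) : R :=
  Num.sqrt ((k.+1 - l)%:R / k.+1%:R) * Num.sqrt 'C(k, l)%:R.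

Definition w13 (k : nat) : M :=
  \sum_(l < k.+1) (alpha k l)%:C *: tens (W k l) (mon k l).
Definition w24 (k : nat) : M := - w13 k.
Definition w23 (k : nat) : M := - 'i *: actT k (U1 - 'i *: U2) (w13 k).
Definition w14 (k : nat) : M := 'i *: actT k (U1 + 'i *: U2) (w13 k).

Definition pcoord (y : P) (i : 'I_4) : C := coord Xs i (vsval y).

(* The map on the exterior square with X_i /\ X_j |-> w i j for i < j. *)
Definition alt2 (w : 'I_4 -> 'I_4 -> M) : altmap 2 := fun Y =>
  \sum_(i < 4) \sum_(j < 4 | (i < j)%N)
    (pcoord (Y 0) i * pcoord (Y 1) j - pcoord (Y 0) j * pcoord (Y 1) i) *:
    w i j.

(* Indices are shifted: (0, 2) stands for X_13, and so on. *)
Definition psi (k : nat) : altmap 2 :=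
  alt2 (fun i j => match val i, val j with
                   | 0%N, 2%N => w13 k
                   | 0%N, 3%N => w14 k
                   | 1%N, 2%N => w23 k
                   | 1%N, 3%N => w24 k
                   | _, _ => 0
                   end).

Definition psi0 (k : nat) : altmap 2 :=
  alt2 (fun i j => match val i, val j with
                   | 2%N, 3%N =>
                       \sum_(l < k.+1) (beta k l)%:C *: tens (W0 k l) (mon k l)
                   | _, _ => 0
                   end).

Definition chi3 (k : nat) : M :=
  \sum_(l < k.+1) (gamma k l)%:C *: tens (Wchi k l) (mon k l).

Definition chi (k : nat) : altmap 1 := fun Y =>
  pcoord (Y 0) 2 *: chi3 k +
  pcoord (Y 0) 3 *: ('i *: actT k (U1 + 'i *: U2) (chi3 k)).

End SU21.

(* Main.v *)
Require Import Defs.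
From mathcomp Require Import all_boot all_order all_algebra.
From mathcomp Require Import complex.
From mathcomp.multinomials Require Import -(notations) mpoly.
From mathcomp Require Import all_classical all_reals all_analysis.
From mathcomp Require Import ring lra zify.
Import Order.TTheory GRing.Theory Num.Theory numFieldNormedType.Exports.
Import Defs.
Set Implicit Arguments.
Unset Strict Implicit.
Unset Printing Implicit Defensive.
Local Open Scope classical_set_scope.
Local Open Scope ring_scope.
Local Open Scope complex_scope.
Local Open Scope sesquilinear_scope.

(** Write [v = g (1, 0, 1)] for [g] in the group [G]. The vector (1, 0, 1) is
isotropic for [J], and the conjugated Borel subgroup is the stabiliser of the
line that it spans. Hence an element of the induced representation is the same
thing as a smooth, K-finite function [f] of the isotropic vector
[v = (v0, v1, v2)] with [f (l v) = l^-(k+3) conj(l)^k f v], and [v2] never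
vanishes ([vc2_neq0], [nice_I_phi], [I_phi_homogeneous]).

In these coordinates the Wigner functions with [m2 = j] are monomials in
[conj v0] and [- conj v1], divided by powers of [v2] and [conj v2]
([wigner_wfun]), and the three sums over [l] are binomial expansions ([wsum]) of
multiples of
  [S_j v = v2^-(k+3) conj(v2)^-j (conj(v0) y - conj(v1) x)^k].
With the linear forms [n Y = Y21 conj(v0) - Y20 conj(v1)] and
[m Y = Y02 conj(v0) + Y12 conj(v1)] on the complement [p] of [l], this gives
  [chi Y = n Y S_1],
  [psi (Y, Z) = sqrt (k+2) (m Y n Z - m Z n Y) S_2],
  [psi0 (Y, Z) = (Y20 Z21 - Y21 Z20) S_0]
([chiE], [psiE], [psi0E]). The action of a matrix on such functions is computed
by the product rule ([has_act], [actT_act]); the equivariance under [l], the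
formula for the differential of [chi] and the closedness of [psi] and [psi0] are
then polynomial identities in the coordinates, modulo the isotropy of [v]
([dchiX], [dpsiX], [dpsi0X]).

The statements about the cohomology follow once all cochains of degrees one and
two are known. Along a curve [c' = - U c] in the maximal compact subgroup, the
equivariance under [U] says that the coefficients of a cochain solve a linear
differential system with constant coefficients. So a cochain is determined by
its values at the identity ([cochain_flow], [cochain_eq]). There the matrix
[diag (i, -2i, i)] lies both in [l] and in the Lie algebra of the Borel
subgroup, so it acts on the coefficient functions by a scalar; comparing
weights, the only possible nonzero values are multiples of [y^k] at [X4] in
degree one, and at [X1, X4] and [X3, X4] in degree two ([weight_vanish]).
Therefore the cochains are the multiples of [chi] in degree one
([cochain1_chi]) and the combinations of [psi] and [psi0] in degree two
([cochain2_psi_span]). All the latter are closed, and the coboundaries form the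
line through [psi / sqrt (k+2) + psi0], which contains neither [psi] nor
[psi0]. *)

(** * Differentiable curves in the complex numbers *)

Section ComplexCurves.
Variable R : realType.
Local Notation C := R[i].
Local Notation Re := (@complex.Re R).
Local Notation Im := (@complex.Im R).
Implicit Types (f g : R -> C) (t : R) (l : C).

(** Taken on real and imaginary parts, as [derive0] is, so that it applies to
non-holomorphic functions such as conjugation. *)
Definition cderiv f t l : Prop :=
  is_derive t (1 : R) (fun s => Re (f s)) (Re l) /\
  is_derive t (1 : R) (fun s => Im (f s)) (Im l).

Lemma complexP (z w : C) : Re z = Re w -> Im z = Im w -> z = w.
Proof. by case: z w => [a b] [c d] /= -> ->. Qed.

Lemma ReM (z w : C) : Re (z * w) = Re z * Re w - Im z * Im w.
Proof. by case: z w => [a b] [c d]. Qed.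
Lemma ImM (z w : C) : Im (z * w) = Re z * Im w + Im z * Re w.
Proof. by case: z w => [a b] [c d]. Qed.
Lemma ReD (z w : C) : Re (z + w) = Re z + Re w.
Proof. by case: z w => [a b] [c d]. Qed.
Lemma ImD (z w : C) : Im (z + w) = Im z + Im w.
Proof. by case: z w => [a b] [c d]. Qed.
Lemma ReN (z : C) : Re (- z) = - Re z.
Proof. by case: z. Qed.
Lemma ImN (z : C) : Im (- z) = - Im z.
Proof. by case: z. Qed.
Lemma ReJ (z : C) : Re (z^*%R) = Re z.
Proof. by case: z. Qed.
Lemma ImJ (z : C) : Im (z^*%R) = - Im z.
Proof. by case: z. Qed.

Lemma cderivE f l : cderiv f 0 l -> derive0 f = l.
Proof. by case=> f1 f2; apply: complexP; rewrite /= derive1E; apply: derive_val. Qed.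

Lemma eq_cderiv f g t l : (forall s, f s = g s) -> cderiv f t l -> cderiv g t l.
Proof. by move=> /funext ->. Qed.

Lemma cderiv_eq f t l l' : l = l' -> cderiv f t l -> cderiv f t l'.
Proof. by move=> ->. Qed.

Lemma cderiv_cst (z : C) t : cderiv (fun=> z) t 0.
Proof. by split; apply: is_derive_cst. Qed.

Lemma cderivD f g t l m : cderiv f t l -> cderiv g t m ->
  cderiv (fun s => f s + g s) t (l + m).
Proof.
move=> [f1 f2] [g1 g2]; split; rewrite ?ReD ?ImD.
  by under eq_fun do rewrite ReD; apply: is_deriveD.
by under eq_fun do rewrite ImD; apply: is_deriveD.
Qed.

Lemma cderivN f t l : cderiv f t l -> cderiv (fun s => - f s) t (- l).
Proof.
move=> [f1 f2]; split; rewrite ?ReN ?ImN.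
  by under eq_fun do rewrite ReN; apply: is_deriveN.
by under eq_fun do rewrite ImN; apply: is_deriveN.
Qed.

Lemma cderivJ f t l : cderiv f t l -> cderiv (fun s => (f s)^*%R) t (l^*%R).
Proof.
move=> [f1 f2]; split; rewrite ?ReJ ?ImJ.
  by under eq_fun do rewrite ReJ.
by under eq_fun do rewrite ImJ; apply: is_deriveN.
Qed.

Lemma cderivM f g t l m : cderiv f t l -> cderiv g t m ->
  cderiv (fun s => f s * g s) t (l * g t + f t * m).
Proof.
move=> [f1 f2] [g1 g2]; split.
  under eq_fun do rewrite ReM.
  apply: is_derive_eq; rewrite !ReD !ReM /GRing.scale /=; ring.
under eq_fun do rewrite ImM.
by apply: is_derive_eq; rewrite !ImD !ImM /GRing.scale /=; ring.
Qed.

Lemma cderiv_sum I (r : seq I) (P : pred I) (f : I -> R -> C) t (l : I -> C) :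
  (forall i, P i -> cderiv (f i) t (l i)) ->
  cderiv (fun s => \sum_(i <- r | P i) f i s) t (\sum_(i <- r | P i) l i).
Proof.
move=> fl; elim: r => [|i r IH].
  by rewrite big_nil; under eq_fun do rewrite big_nil; apply: cderiv_cst.
rewrite big_cons; under eq_fun do rewrite big_cons.
by case: ifP => // Pi; apply: cderivD => //; apply: fl.
Qed.

Lemma cderiv_real (f : R -> R) t (l : R) :
  is_derive t (1 : R) f l -> cderiv (fun s => (f s)%:C) t l%:C.
Proof. by move=> fl; split=> //=; apply: is_derive_cst. Qed.

(** With [n z = z conj(z)], the inverse is [conj(z) / n z], which reduces the
claim to the inverse of a real function. *)
Lemma cderivV f t l : cderiv f t l -> f t != 0 ->
  cderiv (fun s => (f s)^-1) t (- l / f t ^+ 2).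
Proof.
move=> fl f0.
pose n (z : C) : R := Re z ^+ 2 + Im z ^+ 2.
have nE z : (n z)%:C = z * z^*%R.
  by apply: complexP; rewrite ?ReM ?ImM ?ReJ ?ImJ /= /n; ring.
have VE z : z^-1 = z^*%R * ((n z)^-1)%:C.
  have [->|z0] := eqVneq z 0; first by rewrite invr0 conjC0 mul0r.
  have zJ0 : z^*%R != 0 by rewrite conjC_eq0.
  by rewrite fmorphV /= nE; field; rewrite z0 zJ0.
have n0 : n (f t) != 0.
  by apply/eqP => n0; move: (nE (f t)); rewrite n0 => /esym/eqP;
     rewrite mulf_eq0 conjC_eq0 (negPf f0).
have fJ0 : (f t)^*%R != 0 by rewrite conjC_eq0.
have [nf _] := cderivM fl (cderivJ fl).
under eq_fun do rewrite VE; apply: cderiv_eq; last first.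
  apply: cderivM; [exact: cderivJ fl | apply: cderiv_real].
  apply: is_deriveV => //; apply: near_eq_is_derive nf.
  by near=> s; rewrite -nE.
rewrite /GRing.scale /= !(rmorphM, rmorphN, fmorphV, rmorphXn) /=.
have -> : (Re (l * (f t)^*%R + f t * l^*%R))%:C = l * (f t)^*%R + f t * l^*%R.
  by apply: complexP => //=; rewrite ?ReD ?ImD ?ReM ?ImM ?ReJ ?ImJ /=; ring.
by rewrite nE; field; rewrite f0 fJ0.
Unshelve. all: by end_near. Qed.

End ComplexCurves.

(** * The matrix exponential *)

Section Exponential.
Variable R : realType.
Local Notation C := R[i].
Local Notation Re := (@complex.Re R).
Local Notation Im := (@complex.Im R).

(** The growth that makes the exponential generating series converge
everywhere. It is stable under the shift of indices, which is what
differentiation does to the coefficients. *)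
Definition exp_bounded (c : R^nat) := exists D : R, forall m, `|c m| <= D ^+ m.+1.

Definition egf (c : R^nat) (t : R) : R := limn (pseries (fun m => c m / m`!%:R) t).

Lemma egf_cvg c t : exp_bounded c -> cvgn (pseries (fun m => c m / m`!%:R) t).
Proof.
move=> [D cD]; have D0 : 0 <= D by rewrite -[D]expr1 (le_trans _ (cD 0)).
apply: normed_cvg; apply: (@series_le_cvg _ _ (fun m => D * exp_coeff (D * `|t|) m)).
- by move=> n /=.
- by move=> n; rewrite mulr_ge0 // exp_coeff_ge0 // mulr_ge0.
- move=> n; rewrite /exp_coeff /= !normrM normfV normrX [ `|n`!%:R|]ger0_norm ?ler0n //.
  rewrite exprMn -mulrA [leRHS](_ : _ = D ^+ n.+1 * (n`!%:R^-1 * `|t| ^+ n)).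
    by rewrite ler_wpM2r // mulr_ge0 ?invr_ge0 ?ler0n ?exprn_ge0.
  by rewrite exprS; ring.
- have -> : [series D * exp_coeff (D * `|t|) m]_m = D *: series (exp_coeff (D * `|t|)).
    by apply/funext => n; rewrite /series /= -mulr_sumr.
  by apply: is_cvgZr; apply: is_cvg_series_exp_coeff.
Qed.

Lemma exp_bounded_shift c : exp_bounded c -> exp_bounded (fun m => c m.+1).
Proof.
move=> [D cD]; have D0 : 0 <= D by rewrite -[D]expr1 (le_trans _ (cD 0)).
exists (D * (1 + D)) => m; apply: (le_trans (cD _)).
rewrite exprMn exprSr ler_wpM2l ?exprn_ge0 //.
by rewrite exprS (le_trans _ (ler_peMr _ _)) ?lerDr ?exprn_ege1 ?lerDl ?addr_ge0.
Qed.

(** Term by term differentiation: dividing by factorials turns the derivative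
into a shift of the coefficients. *)
Lemma egf_deriv c t : exp_bounded c ->
  is_derive t (1 : R) (egf c) (egf (fun m => c m.+1) t).
Proof.
have dE d : pseries_diffs (fun m => d m / m`!%:R) = (fun m => d m.+1 / m`!%:R) :> R^nat.
  apply/funext => m; rewrite /pseries_diffs factS natrM.
  by rewrite invfM mulrCA mulVKf // pnatr_eq0.
move=> cb; rewrite /egf -dE.
apply: (@pseries_snd_diffs _ _ (`|t| + 1)); rewrite ?dE; try apply: egf_cvg => //.
- exact: exp_bounded_shift.
- exact: (exp_bounded_shift (exp_bounded_shift cb)).
- by rewrite [ltRHS]ger0_norm// ltrDl.
Qed.

Lemma exp_boundedD c d : exp_bounded c -> exp_bounded d ->
  exp_bounded (fun m => c m + d m).
Proof.
move=> [D cD] [E dE].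
have D0 : 0 <= D by rewrite -[D]expr1 (le_trans _ (cD 0)).
have E0 : 0 <= E by rewrite -[E]expr1 (le_trans _ (dE 0)).
exists (D + E) => m; rewrite (le_trans (ler_normD _ _)) //.
rewrite (le_trans (lerD (cD _) (dE _))) // exprDn big_ord_recl big_ord_recr /=.
rewrite !subn0 !expr0 mulr1 subnn expr0 mul1r bin0 binn !mulr1n.
by rewrite lerD2l lerDr sumr_ge0 // => i _; rewrite mulrn_wge0 // mulr_ge0 ?exprn_ge0.
Qed.

Lemma exp_boundedZ a c : exp_bounded c -> exp_bounded (fun m => a * c m).
Proof.
move=> [D cD]; have D0 : 0 <= D by rewrite -[D]expr1 (le_trans _ (cD 0)).
exists ((1 + `|a|) * D) => m; rewrite normrM exprMn ler_pM //.
by rewrite exprS (le_trans _ (ler_peMr _ _)) ?lerDr ?exprn_ege1 ?lerDl ?addr_ge0.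
Qed.

Lemma egfD c d t : exp_bounded c -> exp_bounded d ->
  egf (fun m => c m + d m) t = egf c t + egf d t.
Proof.
move=> cb db; rewrite /egf -limD; try exact: egf_cvg.
congr (limn _); apply/funext => n.
transitivity (\sum_(0 <= k < n) (c k / k`!%:R * t ^+ k) +
              \sum_(0 <= k < n) (d k / k`!%:R * t ^+ k)) => //.
by rewrite -big_split; apply: eq_bigr => i _ /=; ring.
Qed.

Lemma egfZ a c t : exp_bounded c -> egf (fun m => a * c m) t = a * egf c t.
Proof.
move=> cb; transitivity (a *: egf c t) => //; rewrite /egf -lim_seriesZ; last exact: egf_cvg.
congr (limn (series _)); apply/funext => n.
by transitivity (a * (c n / n`!%:R * t ^+ n)) => //=; ring.
Qed.

Lemma egf_at0 c : egf c 0 = c 0.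
Proof.
apply: cvg_lim => //; rewrite -(cvg_shiftn 1) /=.
rewrite (_ : (fun n => _) = (fun=> c 0)); first exact: cvg_cst.
apply/funext => n; rewrite /pseries /series /= addn1 big_nat_recl //= expr0 mulr1 fact0 divr1.
by rewrite big1 ?addr0 // => i _; rewrite expr0n mulr0.
Qed.

Definition cexp_bounded (u : nat -> C) :=
  exp_bounded (fun m => Re (u m)) /\ exp_bounded (fun m => Im (u m)).

Definition cegf (u : nat -> C) (t : R) : C :=
  egf (fun m => Re (u m)) t +i* egf (fun m => Im (u m)) t.

Lemma cegf_deriv u t : cexp_bounded u -> cderiv (cegf u) t (cegf (fun m => u m.+1) t).
Proof. by move=> [ub vb]; split; apply: egf_deriv. Qed.

Lemma cexp_bounded_sum n (a : 'I_n -> C) (u : 'I_n -> nat -> C) :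
  (forall l, cexp_bounded (u l)) -> cexp_bounded (fun m => \sum_l a l * u l m).
Proof.
elim: n a u => [|n IH] a u ub.
  by split; exists 0 => m; rewrite big_ord0 /= normr0 exprn_ge0.
have [h1 h2] := IH (fun l => a (lift ord0 l)) (fun l => u (lift ord0 l)) (fun l => ub _).
have [v1 v2] := ub ord0.
split.
  rewrite (_ : (fun m => _) = (fun m => (Re (a ord0) * Re (u ord0 m) + (- Im (a ord0)) * Im (u ord0 m)) + Re (\sum_l a (lift ord0 l) * u (lift ord0 l) m))).
    by apply: exp_boundedD => //; apply: exp_boundedD; apply: exp_boundedZ.
  by apply/funext => m; rewrite big_ord_recl ReD ReM; ring.
rewrite (_ : (fun m => _) = (fun m => (Re (a ord0) * Im (u ord0 m) + Im (a ord0) * Re (u ord0 m)) + Im (\sum_l a (lift ord0 l) * u (lift ord0 l) m))).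
  by apply: exp_boundedD => //; apply: exp_boundedD; apply: exp_boundedZ.
by apply/funext => m; rewrite big_ord_recl ImD ImM; ring.
Qed.

Lemma cegf_sum n (a : 'I_n -> C) (u : 'I_n -> nat -> C) t :
  (forall l, cexp_bounded (u l)) ->
  cegf (fun m => \sum_l a l * u l m) t = \sum_l a l * cegf (u l) t.
Proof.
elim: n a u => [|n IH] a u ub.
  have egf0 : egf (fun=> 0) t = 0.
    rewrite -[RHS](mul0r (egf (fun=> 0) t)) -egfZ; last by exists 0 => m; rewrite normr0 exprn_ge0.
    by congr (egf _ t); apply/funext => m; rewrite mulr0.
  rewrite big_ord0 /cegf.
  by under eq_fun do rewrite big_ord0; under [X in _ +i* egf X t]eq_fun do rewrite big_ord0; rewrite egf0.
have [h1 h2] := cexp_bounded_sum (fun l => a (lift ord0 l)) (fun l => ub (lift ord0 l)).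
have [v1 v2] := ub ord0.
rewrite big_ord_recl -IH //; apply: complexP; rewrite ?ReD ?ImD ?ReM ?ImM /=.
  rewrite (_ : (fun m => _) = (fun m => (Re (a ord0) * Re (u ord0 m) + (- Im (a ord0)) * Im (u ord0 m)) + Re (\sum_l a (lift ord0 l) * u (lift ord0 l) m))).
    by rewrite !egfD ?egfZ ?mulNr //; try apply: exp_boundedD; try apply: exp_boundedZ.
  by apply/funext => m; rewrite big_ord_recl ReD ReM; ring.
rewrite (_ : (fun m => _) = (fun m => (Re (a ord0) * Im (u ord0 m) + Im (a ord0) * Re (u ord0 m)) + Im (\sum_l a (lift ord0 l) * u (lift ord0 l) m))).
  by rewrite !egfD ?egfZ //; try apply: exp_boundedD; try apply: exp_boundedZ.
by apply/funext => m; rewrite big_ord_recl ImD ImM; ring.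
Qed.

(** If [B] bounds the real and imaginary parts of the entries of [X], each new
factor [X] costs at most [6 B]: an entry of a product is a sum of three terms,
each made of two real products. *)
Lemma mx_powers_bounded (X : 'M[C]_3) i j : cexp_bounded (fun m => (X ^+ m) i j).
Proof.
pose B : R := 1 + \sum_i \sum_j (`|Re (X i j)| + `|Im (X i j)|).
have B1 : 1 <= B by rewrite lerDl sumr_ge0 // => ? _; rewrite sumr_ge0 // => ? _; rewrite addr_ge0.
have XB k l : `|Re (X k l)| <= B /\ `|Im (X k l)| <= B.
  have : `|Re (X k l)| + `|Im (X k l)| <= B.
    rewrite /B (bigD1 k) //= (bigD1 l) //=.
    set S := \sum_(_ | _ != l) _; set S' := \sum_(_ | _) _.
    have S0 : 0 <= S by apply: sumr_ge0 => ? _; rewrite addr_ge0.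
    have S'0 : 0 <= S'.
      by apply: sumr_ge0 => ? _; apply: sumr_ge0 => ? _; rewrite addr_ge0.
    lra.
  by move=> XB; split; apply: le_trans XB; rewrite ?lerDl ?lerDr.
have B0 : 0 <= 6 * B by rewrite mulr_ge0 // (le_trans _ B1).
suff H m : forall i j, `|Re ((X ^+ m) i j)| <= (6 * B) ^+ m /\ `|Im ((X ^+ m) i j)| <= (6 * B) ^+ m.
  have le6 m : (6 * B) ^+ m <= (6 * B) ^+ m.+1.
    rewrite exprS ler_peMl ?exprn_ge0 // (le_trans B1) // ler_peMl ?(le_trans _ B1) //.
    by rewrite ler1n.
  by split; exists (6 * B) => m; have [h1 h2] := H m i j; apply: le_trans (le6 m).
elim: m => [|m IH] k l.
  rewrite !expr0 mxE; case: (k == l); rewrite /= ?mulr1n ?mulr0n ?normr1 ?normr0; split => //.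
have step (f : 'I_3 -> R) : (forall p, `|f p| <= (B * (6 * B) ^+ m) *+ 2) ->
    `|\sum_p f p| <= (6 * B) ^+ m.+1.
  move=> fB; apply: (le_trans (ler_norm_sum _ _ _)).
  rewrite (le_trans (ler_sum _ (fun p _ => fB p))) //.
  by rewrite sumr_const card_ord exprS; lra.
have two (a b c d : R) : `|a| <= B -> `|b| <= B -> `|c| <= (6 * B) ^+ m ->
    `|d| <= (6 * B) ^+ m -> `|a * c + b * d| <= (B * (6 * B) ^+ m) *+ 2.
  move=> aB bB cB dB; rewrite (le_trans (ler_normD _ _)) // mulr2n lerD // normrM;
  by rewrite ler_pM.
have ReS (F : 'I_3 -> C) : Re (\sum_p F p) = \sum_p Re (F p) by rewrite raddf_sum.
have ImS (F : 'I_3 -> C) : Im (\sum_p F p) = \sum_p Im (F p) by rewrite raddf_sum.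
rewrite [X ^+ m.+1]exprS mxE ReS ImS.
split; apply: step => p; have [r1 i1] := XB k p; have [r2 i2] := IH p l.
  by rewrite ReM -mulNr two // normrN.
by rewrite ImM two.
Qed.

(** Entrywise limits of the partial sums are power series in the parameter. *)
Lemma mexpE (X : 'M[C]_3) (t : R) i j :
  mexp (t%:C *: X) i j = cegf (fun m => (X ^+ m) i j) t.
Proof.
have powE m : (t%:C *: X) ^+ m = (t ^+ m)%:C *: X ^+ m.
  by rewrite rmorphXn exprZn.
have termE n : (\sum_(m < n) (m`!%:R)^-1 *: (t%:C *: X) ^+ m) i j =
    \sum_(m < n) (t ^+ m / m`!%:R)%:C * (X ^+ m) i j.
  rewrite summxE; apply: eq_bigr => m _; rewrite powE scalerA mxE; congr (_ * _).
  by rewrite mulrC rmorphM fmorphV rmorph_nat.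
have ReS n (F : 'I_n -> C) : Re (\sum_p F p) = \sum_p Re (F p) by rewrite raddf_sum.
have ImS n (F : 'I_n -> C) : Im (\sum_p F p) = \sum_p Im (F p) by rewrite raddf_sum.
rewrite mxE /limC /cegf /egf.
rewrite (_ : (fun n => Re _) = pseries (fun m => Re ((X ^+ m) i j) / m`!%:R) t).
  rewrite (_ : (fun n => Im _) = pseries (fun m => Im ((X ^+ m) i j) / m`!%:R) t) //.
  apply/funext => n; rewrite termE ImS /pseries /series /= big_mkord.
  by apply: eq_bigr => m _; rewrite ImM /=; ring.
apply/funext => n; rewrite termE ReS /pseries /series /= big_mkord.
by apply: eq_bigr => m _; rewrite ReM /=; ring.
Qed.

(** Shifting the coefficients [X ^+ m] is left multiplication by [X]. *)
Lemma mexp_deriv (X : 'M[C]_3) (t : R) i j :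
  cderiv (fun t => mexp (t%:C *: X) i j) t ((X *m mexp (t%:C *: X)) i j).
Proof.
apply: cderiv_eq; last first.
  apply: (@eq_cderiv _ (cegf (fun m => (X ^+ m) i j))) => [s|]; first by rewrite mexpE.
  by apply: cegf_deriv; apply: mx_powers_bounded.
rewrite mxE.
under eq_bigr do rewrite mexpE.
rewrite -cegf_sum; last by move=> l; apply: mx_powers_bounded.
by congr (cegf _ t); apply/funext => m; rewrite exprS mxE.
Qed.

Lemma mexp0 : mexp (0 : 'M[C]_3) = 1%:M.
Proof.
apply/matrixP => i j; rewrite -(scale0r (0 : 'M[C]_3)) mexpE /cegf !egf_at0 expr0.
by apply: complexP.
Qed.

End Exponential.

(** * Curves of matrices and one-parameter subgroups *)

Section Group.
Variable R : realType.
Local Notation C := R[i].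
Local Notation Re := (@complex.Re R).
Local Notation Im := (@complex.Im R).

Lemma big3 (V : nmodType) (F : 'I_3 -> V) : \sum_i F i = F 0 + F 1 + F 2.
Proof.
by rewrite !big_ord_recr big_ord0 /= add0r; congr (F _ + F _ + F _); apply: val_inj.
Qed.

Lemma ord3P (P : 'I_3 -> Prop) : P 0 -> P 1 -> P 2 -> forall i, P i.
Proof.
by move=> P0 P1 P2 [[|[|[|//]]] p]; [move: P0|move: P1|move: P2]; congr P; apply: val_inj.
Qed.

Lemma big2 (V : nmodType) (F : 'I_2 -> V) : \sum_i F i = F 0 + F 1.
Proof.
by rewrite !big_ord_recr big_ord0 /= add0r; congr (F _ + F _); apply: val_inj.
Qed.

Lemma det2 (A : 'M[C]_2) : \det A = A 0 0 * A 1 1 - A 0 1 * A 1 0.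
Proof.
rewrite (expand_det_row _ 0) big2 /cofactor !det_mx11 !mxE.
rewrite (_ : lift 0 0 = 1) 1?(_ : lift 1 0 = 0); try exact: val_inj.
by rewrite /= !expr0 expr1; ring.
Qed.

Lemma det3 (A : 'M[C]_3) : \det A =
  A 0 0 * (A 1 1 * A 2 2 - A 1 2 * A 2 1) - A 0 1 * (A 1 0 * A 2 2 - A 1 2 * A 2 0)
  + A 0 2 * (A 1 0 * A 2 1 - A 1 1 * A 2 0).
Proof.
rewrite (expand_det_row _ 0) big3 /cofactor.
rewrite !det2 !mxE.
rewrite (_ : lift 0 0 = 1) 1?(_ : lift 0 1 = 2) 1?(_ : lift 1 0 = 0) 1?(_ : lift 1 1 = 2) 
 1?(_ : lift 2 0 = 0) 1?(_ : lift 2 1 = 1); try exact: val_inj.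
by rewrite /= !expr0 expr1 expr2; ring.
Qed.

Definition mxderiv m n (A : R -> 'M[C]_(m, n)) t (A' : 'M[C]_(m, n)) :=
  forall i j, cderiv (fun s => A s i j) t (A' i j).

Lemma mxderivM m n p (A : R -> 'M[C]_(m, n)) (B : R -> 'M[C]_(n, p)) t A' B' :
  mxderiv A t A' -> mxderiv B t B' ->
  mxderiv (fun s => A s *m B s) t (A' *m B t + A t *m B').
Proof.
move=> dA dB i j.
apply: (@eq_cderiv _ (fun s => \sum_k A s i k * B s k j)) => [s|]; first by rewrite mxE.
rewrite mxE [X in X + _]mxE [X in _ + X]mxE -big_split.
by apply: cderiv_sum => k _; apply: cderivM.
Qed.

Lemma mxderiv_cst m n (A : 'M[C]_(m, n)) t : mxderiv (fun=> A) t 0.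
Proof. by move=> i j; rewrite mxE; apply: cderiv_cst. Qed.

Lemma mxderivJ m n (A : R -> 'M[C]_(m, n)) t A' :
  mxderiv A t A' -> mxderiv (fun s => (A s) ^t*) t (A' ^t*).
Proof.
move=> dA i j; rewrite !mxE.
by apply: (eq_cderiv _ (cderivJ (dA j i))) => s; rewrite !mxE.
Qed.

Lemma cderiv0_cst (f : R -> C) s t : (forall u, cderiv f u 0) -> f s = f t.
Proof.
move=> f0; apply: complexP.
  by apply: (is_derive_0_is_cst (f := fun s => Re (f s))) => u; case: (f0 u).
by apply: (is_derive_0_is_cst (f := fun s => Im (f s))) => u; case: (f0 u).
Qed.

Lemma mexp_mxderiv (X : 'M[C]_3) t :
  mxderiv (fun s => mexp (s%:C *: X)) t (X *m mexp (t%:C *: X)).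
Proof. by move=> i j; apply: mexp_deriv. Qed.

(** Along the one-parameter group the hermitian form and the determinant have
zero derivative, by the two defining conditions of the Lie algebra. *)
Lemma mexp_in_SU21 (X : 'M[C]_3) t : su21 X -> in_SU21 (mexp (t%:C *: X)).
Proof.
move=> [XJ trX]; have dE := mexp_mxderiv X.
set E := fun s => mexp (s%:C *: X).
have E0 : E 0 = 1%:M by rewrite /E scale0r mexp0.
apply/andP; split; apply/eqP.
  apply/matrixP => i j.
  rewrite -[in RHS](_ : (E 0) ^t* *m J R *m E 0 = J R); last first.
    by rewrite E0 trmx1 map_mx1 mul1mx mulmx1.
  apply: (cderiv0_cst (f := fun s => ((E s) ^t* *m J R *m E s) i j)) => u.
  apply: cderiv_eq; last first.
    exact: (mxderivM (mxderivM (mxderivJ (dE u)) (mxderiv_cst (J R) u)) (dE u)).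
  rewrite adjM mulmx0 addr0 -!mulmxA -mulmxDr [J R *m (X *m _)]mulmxA [X ^t* *m (J R *m _)]mulmxA.
  by rewrite -mulmxDl XJ mul0mx mulmx0 mxE.
rewrite -[RHS](det1 C 3) -E0.
apply: (cderiv0_cst (f := fun s => \det (E s))) => u.
apply: (@eq_cderiv _ (fun s => E s 0 0 * (E s 1 1 * E s 2 2 - E s 1 2 * E s 2 1) - E s 0 1 * (E s 1 0 * E s 2 2 - E s 1 2 * E s 2 0)
  + E s 0 2 * (E s 1 0 * E s 2 1 - E s 1 1 * E s 2 0))) => [s|]; first by rewrite det3.
apply: cderiv_eq; last first.
  by repeat (apply: cderivD || apply: cderivN || apply: cderivM); apply: dE.
have X22 : X 2 2 = - (X 0 0 + X 1 1).
  by move: trX; rewrite /mxtrace big3 addrC => /eqP; rewrite addr_eq0 => /eqP.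
by rewrite /E; move: (mexp _) => Eu; rewrite !mxE !big3 X22; ring.
Qed.

Lemma expGE (X : 'M[C]_3) t : su21 X -> expG (t%:C *: X) = mexp (t%:C *: X) :> 'M[C]_3.
Proof. by move=> sX; rewrite /expG insubdK //; apply: mexp_in_SU21. Qed.

Lemma su21N (X : 'M[C]_3) : su21 X -> su21 (- X).
Proof.
move=> [h t]; split; last by rewrite raddfN /= t oppr0.
by rewrite linearN map_mxN mulNmx mulmxN -opprD h oppr0.
Qed.

End Group.

(** * Smooth functions along curves in the group *)

Section Differential.
Variable R : realType.
Local Notation C := R[i].
Local Notation Re := (@complex.Re R).
Local Notation Im := (@complex.Im R).

Lemma realify_curve (A : R -> 'M[C]_3) t A' : mxderiv A t A' ->
  differentiable (fun s => realify (A s)) t /\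
  'd (fun s => realify (A s)) t 1 = realify A'.
Proof.
move=> dA.
have H : forall h : C -> R, (forall i j, is_derive t (1:R) (fun s => h (A s i j)) (h (A' i j))) ->
   is_derive t (1 : R) (fun s => map_mx h (A s)) (map_mx h A').
  move=> h dh; have dR : derivable (fun s => map_mx h (A s)) t 1.
    apply/derivable_mxP => i j. under eq_fun do rewrite mxE. exact: ex_derive.
  split => //.
  rewrite derive_mx //; apply/matrixP => i j; rewrite !mxE; under eq_fun do rewrite mxE.
  exact: derive_val.
have [dR vR] := H Re (fun i j => proj1 (dA i j)).
have [dI vI] := H Im (fun i j => proj2 (dA i j)).
have dR' := (derivable1_diffP _ _).1 dR. 
have dI' := (derivable1_diffP _ _).1 dI.
split. apply: differentiable_pair; assumption.
have e1 := etrans (esym (deriveE (1:R) dR')) vR.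
have e2 := etrans (esym (deriveE (1:R) dI')) vI.
have e := congr1 (fun F => F (1 : R)) (diff_pair dR' dI').
apply: (etrans e).
exact: (congr2 pair e1 e2).
Qed.

(** The derivative of a local smooth extension gives one map [D] that serves
all curves through [g]. *)
Lemma smooth_differential (f : SU21 R -> C) (g : SU21 R) : smooth f ->
  exists D : 'M[C]_3 -> C, forall (c : R -> SU21 R) t A',
    c t = g -> mxderiv (fun s => c s : 'M[C]_3) t A' ->
    cderiv (fun s => f (c s)) t (D A').
Proof.
move=> /(_ g) [U [F1 [F2 [oU Ug sF1 sF2 fE]]]].
have dF1 := sF1 [::] _ Ug; have dF2 := sF2 [::] _ Ug.
exists (fun A' => 'd F1 (realify g) (realify A') +i* 'd F2 (realify g) (realify A')).
move=> c t A' ct dc; have [dr vr] := realify_curve dc.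
have nearU : \forall s \near t, U (realify (c s)).
  have /differentiable_continuous cr := dr.
  by apply: cr; rewrite ct; apply: open_nbhs_nbhs.
(* The chain rule, for the real and the imaginary part. *)
have key (F : _ -> R) : differentiable F (realify g) ->
    is_derive t (1 : R) (F \o (fun s => realify (c s))) ('d F (realify g) (realify A')).
  move=> dF; have dF' : differentiable F (realify (c t)) by rewrite ct.
  have dc' := differentiable_comp dr dF'.
  split; first exact/derivable1_diffP.
  by rewrite deriveE // diff_comp //= vr ct.
split=> /=.
  apply: near_eq_is_derive (key _ dF1); near=> s; rewrite fE //=; near: s; exact: nearU.
apply: near_eq_is_derive (key _ dF2); near=> s; rewrite fE //=; near: s; exact: nearU.
Unshelve. all: by end_near. Qed.

Lemma expG_mxderiv (X : 'M[C]_3) (g : SU21 R) : su21 X ->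
  mxderiv (fun s : R => (expG (- s%:C *: X) * g)%g : 'M[C]_3) 0 (- X *m g).
Proof.
move=> sX.
have -> : (fun s : R => (expG (- s%:C *: X) * g)%g : 'M[C]_3) =
  (fun s => mexp (s%:C *: - X) *m g :> 'M[C]_3).
  apply/funext => s /=; rewrite scaleNr -scalerN expGE //; exact: su21N.
have -> : - X *m g = (- X *m mexp (0%:C *: - X)) *m g + mexp (0%:C *: - X) *m 0.
  by rewrite scale0r mexp0 mulmx1 mulmx0 addr0.
apply: mxderivM; [exact: mexp_mxderiv | exact: mxderiv_cst].
Qed.

(** The action is defined with the curves [exp (- t X) g]; by the chain rule
any curve with velocity [- X c] computes it. This makes curves with explicit
entries available. *)
Lemma smooth_curve (f : SU21 R -> C) (c : R -> SU21 R) t (X : 'M[C]_3) :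
  smooth f -> su21 X -> mxderiv (fun s => c s : 'M[C]_3) t (- X *m c t) ->
  cderiv (fun s => f (c s)) t (actI X f (c t)).
Proof.
move=> sf sX dc; have [D hD] := smooth_differential (c t) sf.
have /cderivE : cderiv (fun s => f (expG (- s%:C *: X) * c t)%g) 0 (D (- X *m c t)).
  apply: hD.
    apply: val_inj => /=.
    have -> : - 0%:C *: X = 0%:C *: X by rewrite oppr0.
    by rewrite expGE // scale0r mexp0 mul1mx.
  exact: expG_mxderiv.
move=> E; rewrite /actI E; exact: hD.
Qed.

End Differential.

(** * The Lie algebra action on polynomials *)

Section Polynomials.
Variable R : realType.
Local Notation C := R[i].
Local Notation PV := (mpoly 3 C).
Implicit Types (p q : PV) (X : 'M[C]_3).

Definition lform (v : 'I_3 -> C) : PV := \sum_(j < 3) v j *: mpolyX C (mnm1 j).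

(** The vector field of the substitution [x_i |-> sum_j X_ji x_j]; it is the
infinitesimal action on polynomials, without any restriction on degrees. *)
Definition polyD X p : PV := \sum_(i < 3) lform (fun j => X j i) * mderiv i p.

(** Polynomials as the algebra generated by constants and variables: the
induction suited to derivations. *)
Lemma mpoly_alg_ind (P : PV -> Prop) :
  (forall c, P (mpolyC 3 c)) -> (forall i, P (mpolyX C (mnm1 i))) ->
  (forall p q, P p -> P q -> P (p + q)) -> (forall p q, P p -> P q -> P (p * q)) ->
  forall p, P p.
Proof.
move=> PC PX PD PM p; elim/mpolyind: p => [|c m p _ _ Pp]; first by rewrite -mpolyC0.
apply: PD => //; rewrite -mul_mpolyC; apply: (PM) => //.
rewrite mpolyXE_id; apply: (big_ind P); [by rewrite -mpolyC1 | by move=> ? ?; apply: (PM) |].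
move=> i _; have PE n : P (mpolyX C (mnm1 i) ^+ n).
  by elim: n => [|n IH]; rewrite ?expr0 -?mpolyC1 // exprS; apply: PM.
exact: PE.
Qed.

Lemma polyDC X c : polyD X (mpolyC 3 c) = 0.
Proof. by rewrite /polyD big1 // => i _; rewrite mderivC mulr0. Qed.

Lemma polyDD X p q : polyD X (p + q) = polyD X p + polyD X q.
Proof. by rewrite /polyD -big_split; apply: eq_bigr => i _ /=; rewrite mderivD mulrDr. Qed.

Lemma polyDM X p q : polyD X (p * q) = polyD X p * q + p * polyD X q.
Proof.
rewrite /polyD mulr_suml mulr_sumr -big_split; apply: eq_bigr => i _ /=.
by rewrite mderivM; ring.
Qed.

Lemma polyDZ X c p : polyD X (c *: p) = c *: polyD X p.
Proof. by rewrite -mul_mpolyC polyDM polyDC mul0r add0r mul_mpolyC. Qed.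

Lemma polyDU X i : polyD X (mpolyX C (mnm1 i)) = lform (fun j => X j i).
Proof.
rewrite /polyD (bigD1 i) //= big1 => [|j ji]; last first.
  by rewrite mderivX mnm1E eq_sym (negPf ji) scale0r mulr0.
rewrite mderivX mnm1E eqxx scale1r.
have -> : mnm_sub (mnm1 i) (mnm1 i) = mnm0 by apply/mnmP => j; rewrite mnmBE mnm0E subnn.
by rewrite mpolyX0 mulr1 addr0.
Qed.

Lemma polyD_sum X I (r : seq I) (F : I -> PV) :
  polyD X (\sum_(i <- r) F i) = \sum_(i <- r) polyD X (F i).
Proof.
elim: r => [|i r IH]; last by rewrite !big_cons polyDD IH.
by rewrite !big_nil -mpolyC0 polyDC.
Qed.

Lemma lform_lin a (v w : 'I_3 -> C) :
  lform (fun j => v j + a * w j) = lform v + a *: lform w.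
Proof.
rewrite /lform scaler_sumr -big_split; apply: eq_bigr => j _ /=.
by rewrite scalerDl scalerA.
Qed.

Lemma polyD_lin A B a p : polyD (A + a *: B) p = polyD A p + a *: polyD B p.
Proof.
rewrite /polyD scaler_sumr -big_split; apply: eq_bigr => i _ /=.
rewrite scalerAl -mulrDl -lform_lin; congr (lform _ * _).
by apply/funext => j; rewrite !mxE.
Qed.

Lemma homogP k p : homog k p <-> forall m, mdeg m != k -> mcoeff m p = 0.
Proof.
split=> [hp m mk|h]; first exact: (dhomog_nemf_coeff hp).
apply/dhomogP => m; rewrite mcoeff_msupp => pm.
by apply/eqP/negP => /negP mk; move: pm; rewrite (h _ mk) eqxx.
Qed.

Lemma homog_size k p : homog k p -> (msize p <= k.+1)%N.
Proof.
move=> /dhomogP hp; rewrite msizeE; apply/bigmax_leqP_seq => m mp _.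
by rewrite ltnS (hp _ mp).
Qed.

Lemma homogE k p : homog k p ->
  p = \sum_(m : bmultinom 3 k.+1) mcoeff m p *: mpolyX C m.
Proof. by move/homog_size/mpolywE. Qed.

Definition pderiv (c : R -> PV) t p : Prop :=
  forall m, cderiv (fun s => mcoeff m (c s)) t (mcoeff m p).

Lemma eq_pderiv c d t p : (forall s, c s = d s) -> pderiv c t p -> pderiv d t p.
Proof. by move=> /funext ->. Qed.

Lemma pderiv_eq c t p q : p = q -> pderiv c t p -> pderiv c t q.
Proof. by move=> ->. Qed.

Lemma pderiv_cst p t : pderiv (fun=> p) t 0.
Proof. by move=> m; rewrite mcoeff0; apply: cderiv_cst. Qed.

Lemma pderivC (f : R -> C) t l : cderiv f t l ->
  pderiv (fun s => mpolyC 3 (f s)) t (mpolyC 3 l).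
Proof.
move=> fl m; rewrite mcoeffC; under eq_fun do rewrite mcoeffC.
case: eqP => _; rewrite ?mulr1 ?mulr0.
  by under eq_fun do rewrite mulr1.
by under eq_fun do rewrite mulr0; apply: cderiv_cst.
Qed.

Lemma pderivD c d t p q : pderiv c t p -> pderiv d t q ->
  pderiv (fun s => c s + d s) t (p + q).
Proof.
move=> cp dq m; rewrite mcoeffD; under eq_fun do rewrite mcoeffD.
exact: cderivD.
Qed.

Lemma pderivM c d t p q : pderiv c t p -> pderiv d t q ->
  pderiv (fun s => c s * d s) t (p * d t + c t * q).
Proof.
move=> cp dq m; rewrite mcoeffD !mcoeffM -big_split.
apply: (@eq_cderiv _ (fun s => \sum_(k : bmultinom 3 (mdeg m).+1 * bmultinom 3 (mdeg m).+1 | m == mnm_add k.1 k.2) mcoeff k.1 (c s) * mcoeff k.2 (d s))).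
  by move=> s; rewrite mcoeffM.
by apply: cderiv_sum => k _; apply: cderivM.
Qed.

Lemma pderiv_sum n (c : 'I_n -> R -> PV) t (p : 'I_n -> PV) :
  (forall i, pderiv (c i) t (p i)) -> pderiv (fun s => \sum_i c i s) t (\sum_i p i).
Proof.
elim: n c p => [|n IH] c p cp.
  by rewrite big_ord0; under eq_fun do rewrite big_ord0; apply: pderiv_cst.
rewrite big_ord_recl; under eq_fun do rewrite big_ord_recl.
by apply: pderivD => //; apply: IH.
Qed.

(** At the identity both sides are derivations of the algebra of polynomials,
so the variables decide. *)
Lemma actVG_deriv (E : R -> 'M[C]_3) X p : E 0 = 1%:M -> mxderiv E 0 X ->
  pderiv (fun s => actVG (E s) p) 0 (polyD X p).
Proof.
move=> E0 dE; elim/mpoly_alg_ind: p => [c|i|p q IHp IHq|p q IHp IHq].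
- rewrite polyDC; apply: (eq_pderiv _ (pderiv_cst (mpolyC 3 c) 0)) => s.
  by rewrite /actVG comp_mpolyC.
- rewrite polyDU.
  apply: (@eq_pderiv (fun s => lform (fun j => E s j i))) => [s|].
    by rewrite /actVG comp_mpolyXU -tnth_nth tnth_mktuple.
  apply: pderiv_sum => j.
  rewrite -mul_mpolyC; apply: (@eq_pderiv (fun s => mpolyC 3 (E s j i) * mpolyX C (mnm1 j))).
    by move=> s; rewrite mul_mpolyC.
  apply: pderiv_eq (pderivM (pderivC (dE j i)) (pderiv_cst _ _)).
  by rewrite mulr0 addr0.
- rewrite polyDD; apply: (eq_pderiv _ (pderivD IHp IHq)) => s.
  by rewrite /actVG comp_mpolyD.
rewrite polyDM; apply: (@eq_pderiv (fun s => actVG (E s) p * actVG (E s) q)).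
  by move=> s; rewrite /actVG rmorphM.
apply: pderiv_eq (pderivM IHp IHq).
have id1 : [tuple \sum_(j < 3) (1%:M : 'M[C]_3) j i *: mpolyX C (mnm1 j) | i < 3] =
    [tuple mpolyX C (mnm1 i) | i < 3].
  apply: eq_from_tnth => i; rewrite !tnth_mktuple (bigD1 i) //= big1 => [|j ji].
    by rewrite mxE eqxx scale1r addr0.
  by rewrite mxE (negPf ji) scale0r.
by rewrite /actVG E0 id1 !comp_mpoly_id.
Qed.

End Polynomials.

(** * Computing the action on the tensor product *)

Section Action.
Variable R : realType.
Local Notation C := R[i].
Local Notation Re := (@complex.Re R).
Local Notation Im := (@complex.Im R).
Local Notation PV := (mpoly 3 C).
Local Notation G := (SU21 R).
Implicit Types (p q : PV) (X : 'M[C]_3).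

Lemma lform_mon_homog v (m : multinom 3) (i : 'I_3) : m i != 0%N ->
  homog (mdeg m) (lform v * mpolyX C (mnm_sub m (mnm1 i))).
Proof.
move=> m0.
have le1 : mpoly.lem (mnm1 i) m.
  by apply/mnm_lepP => j; rewrite mnm1E; case: eqP => // <-; rewrite lt0n.
have kE : mdeg m = (1 + mdeg (mnm_sub m (mnm1 i)))%N.
  by rewrite -{1}(submK le1) mdegD mdeg1 addnC.
rewrite kE; apply: dhomogM.
  by apply: rpred_sum => j _; apply: rpredZ; rewrite dhomogX /= mdeg1.
by rewrite dhomogX.
Qed.

Lemma polyD_homog X k p : homog k p -> homog k (polyD X p).
Proof.
move=> hp; rewrite (homogE hp) polyD_sum.
apply: rpred_sum => m _; rewrite polyDZ; have [mk|mk] := eqVneq (mdeg m) k; last first.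
  by rewrite ((homogP k p).1 hp _ mk) scale0r rpred0.
apply: rpredZ; apply: rpred_sum => i _.
rewrite mderivX; have [m0|m0] := eqVneq ((m : multinom 3) i) 0%N.
  by rewrite m0 scale0r mulr0 rpred0.
by rewrite -scalerAr; apply: rpredZ; move: (lform_mon_homog (fun j => X j i) m0); rewrite mk.
Qed.

(** [derive0V] truncates at degree [k], and the derivative of a monomial of
degree at most [k] does not exceed that degree. *)
Lemma actV_monE k X (m : bmultinom 3 k.+1) : su21 X ->
  actV k X (mpolyX C m) = polyD X (mpolyX C m).
Proof.
move=> sX; rewrite /actV /derive0V.
have E0 : mexp (0%:C *: X) = 1%:M by rewrite scale0r mexp0.
have dE : mxderiv (fun t : R => mexp (t%:C *: X)) 0 X.
  by move=> i j; apply: cderiv_eq (mexp_mxderiv X 0 i j); rewrite E0 mulmx1.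
have dp := actVG_deriv (mpolyX C m) E0 dE.
rewrite [RHS](@mpolywE _ _ k.+1); last first.
  have hm : homog (mdeg m) (mpolyX C m) by rewrite /homog dhomogX /=.
  by apply: leq_trans (homog_size (polyD_homog X hm)) _; case: (m) => /= m' ?.
by apply: eq_bigr => m' _; rewrite (cderivE (dp m')).
Qed.

Lemma actVC_monE k X (m : bmultinom 3 k.+1) : \tr X = 0 ->
  actVC k X (mpolyX C m) = polyD X (mpolyX C m).
Proof.
move=> tX; rewrite /actVC !actV_monE; [|exact: su21_imP|exact: su21_reP].
by rewrite [X in RHS](su21_decomp X) polyD_lin.
Qed.

(** [T X] is meant to be the full action of [X] on [F], on the coefficient
functions and on the values; removing the second part leaves the derivative of
[F] along [exp (- t X)]. The first clause extends this from the real Lie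
algebra to complex matrices. *)
Definition has_act (F : G -> PV) (T : 'M[C]_3 -> G -> PV) : Prop :=
  (forall A B g, T (A + 'i *: B) g = T A g + 'i *: T B g) /\
  forall X, su21 X -> forall g,
    pderiv (fun t => F (expG (- t%:C *: X) * g)%g) 0 (T X g - polyD X (F g)).

(** The tensor product action is defined monomial by monomial. Homogeneity
puts all the coefficients in the range of that sum, where the two parts of [T
X] can be identified separately. *)
Lemma actT_act k F T X : has_act F T -> (forall g, homog k (F g)) -> \tr X = 0 ->
  actT k X F = T X.
Proof.
move=> [Tlin dT] hF tX; apply/funext => g.
pose P Y := T Y g - polyD Y (F g).
have Plin A B : P (A + 'i *: B) = P A + 'i *: P B.
  rewrite /P Tlin polyD_lin; move: (T A g) (T B g) (polyD A _) (polyD B _) => a b c d.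
  by rewrite scalerBr; ring.
have sr := su21_reP tX; have si := su21_imP tX.
have hP Y : su21 Y -> homog k (P Y).
  move=> sY; apply/homogP => m mk; rewrite -(cderivE (dT Y sY g m)).
  apply: cderivE; apply: (@eq_cderiv _ (fun=> 0)) => [s|]; last exact: cderiv_cst.
  by rewrite ((homogP k _).1 (hF _) _ mk).
have hPX : homog k (P X).
  by rewrite (su21_decomp X) Plin; apply: rpredD; [|apply: rpredZ]; apply: hP.
have -> : T X g = P X + polyD X (F g) by rewrite /P subrK.
rewrite {1}(homogE hPX) {1}(homogE (hF g)) polyD_sum -big_split.
have -> : actT k X F g = \sum_(m : bmultinom 3 k.+1)
    (actIC X (fun g => mcoeff m (F g)) g *: mpolyX C m + mcoeff m (F g) *: actVC k X (mpolyX C m)).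
  by rewrite /actT fct_sumE.
apply: eq_bigr => m _ /=; rewrite polyDZ actVC_monE //; congr (_ *: _ + _).
rewrite [in RHS](su21_decomp X) Plin mcoeffD mcoeffZ /actIC.
by congr (_ + 'i * _); [exact: cderivE (dT _ sr g m)|exact: cderivE (dT _ si g m)].
Qed.

Lemma eq_act F T T' : (forall X g, T X g = T' X g) -> has_act F T -> has_act F T'.
Proof. by move=> e; have -> : T = T' by apply/funext => X; apply/funext. Qed.

Lemma eq_actF F F' T : (forall g, F g = F' g) -> has_act F T -> has_act F' T.
Proof. by move=> /funext ->. Qed.

Lemma act_poly p : has_act (fun=> p) (fun X _ => polyD X p).
Proof.
split=> [A B g|X sX g]; first by rewrite polyD_lin.
by rewrite subrr; apply: pderiv_cst.
Qed.

Lemma actD F1 T1 F2 T2 : has_act F1 T1 -> has_act F2 T2 ->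
  has_act (fun g => F1 g + F2 g) (fun X g => T1 X g + T2 X g).
Proof.
move=> [l1 d1] [l2 d2]; split=> [A B g|X sX g].
  by rewrite l1 l2 scalerDr addrACA.
apply: pderiv_eq (pderivD (d1 X sX g) (d2 X sX g)).
by rewrite polyDD opprD addrACA.
Qed.

Lemma expG0 X g : su21 X -> (expG (- 0%:C *: X) * g)%g = g.
Proof.
move=> sX; apply: val_inj => /=.
have -> : - 0%:C *: X = 0%:C *: X by rewrite oppr0.
by rewrite expGE // scale0r mexp0 mul1mx.
Qed.

(** Both the derivative along a curve and the action on values obey the
product rule. *)
Lemma actM F1 T1 F2 T2 : has_act F1 T1 -> has_act F2 T2 ->
  has_act (fun g => F1 g * F2 g) (fun X g => T1 X g * F2 g + F1 g * T2 X g).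
Proof.
move=> [l1 d1] [l2 d2]; split=> [A B g|X sX g].
  by rewrite l1 l2 mulrDl mulrDr scalerDr -scalerAl -scalerAr addrACA.
apply: pderiv_eq (pderivM (d1 X sX g) (d2 X sX g)).
have alg (A : comRingType) (t1 t2 f1 f2 p1 p2 : A) : (t1 - p1) * f2 + f1 * (t2 - p2) = t1 * f2 + f1 * t2 - (p1 * f2 + f1 * p2) by ring.
by rewrite !expG0 // polyDM alg.
Qed.

Lemma actX F T n : has_act F T ->
  has_act (fun g => F g ^+ n) (fun X g => n%:R * F g ^+ n.-1 * T X g).
Proof.
move=> aF; elim: n => [|n IH].
  apply: (eq_act _ (act_poly 1)) => X g.
  by rewrite -mpolyC1 polyDC !mul0r.
apply: (@eq_actF (fun g => F g * F g ^+ n)) => [g|]; first by rewrite exprS.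
apply: (eq_act _ (actM aF IH)) => X g /=.
have alg (A : comRingType) (a b : A) m : a * b ^+ m + b * (m%:R * b ^+ m.-1 * a) = m.+1%:R * b ^+ m * a.
  by case: m => [|m]; rewrite /= -?[m.+2%:R]natr1 ?exprS; ring.
exact: alg.
Qed.

Lemma act_scalar (f : G -> C) (T : 'M[C]_3 -> G -> C) :
  (forall A B g, T (A + 'i *: B) g = T A g + 'i * T B g) ->
  (forall X, su21 X -> forall g, cderiv (fun t => f (expG (- t%:C *: X) * g)%g) 0 (T X g)) ->
  has_act (fun g => mpolyC 3 (f g)) (fun X g => mpolyC 3 (T X g)).
Proof.
move=> lT dT; split=> [A B g|X sX g].
  by rewrite lT mpolyCD mpolyCM mul_mpolyC.
by rewrite polyDC subr0; apply: pderivC; apply: dT.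
Qed.

End Action.

(** * The isotropic vector of a group element *)

Section Cone.
Variable R : realType.
Local Notation C := R[i].
Local Notation PV := (mpoly 3 C).
Local Notation G := (SU21 R).
Implicit Types (X : 'M[C]_3) (g : G).

Definition v0 : 'cV[C]_3 := \col_i (i != 1)%:R.
Definition vc (i : 'I_3) (g : G) : C := ((g : 'M[C]_3) *m v0) i 0.

Lemma vcE i g : vc i g = (g : 'M[C]_3) i 0 + (g : 'M[C]_3) i 2.
Proof. by rewrite /vc mxE big3 !mxE /= mulr1 mulr0 addr0 mulr1. Qed.

Lemma JE i j : J R i j = (if i == 2 then -1 else 1) * (i == j)%:R.
Proof. by rewrite mxE; move: i j; do 2![apply: ord3P]; rewrite /= ?mulr1 ?mulr0. Qed.

Lemma J_form (u v : 'cV[C]_3) :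
  (u ^t* *m J R *m v) 0 0 = (u 0 0)^*%R * v 0 0 + (u 1 0)^*%R * v 1 0 - (u 2 0)^*%R * v 2 0.
Proof. by rewrite mxE big3 !mxE !big3 !JE !mxE /=; ring. Qed.

(** [g] preserves the form for which (1, 0, 1) is isotropic. *)
Lemma vc_isotropic g :
  vc 0 g * (vc 0 g)^*%R + vc 1 g * (vc 1 g)^*%R = vc 2 g * (vc 2 g)^*%R.
Proof.
have /andP[/eqP gJ _] := SU21P g.
have : (((g : 'M[C]_3) *m v0) ^t* *m J R *m ((g : 'M[C]_3) *m v0)) 0 0 = 0.
  rewrite adjM -[v0 ^t* *m _ *m J R]mulmxA -[v0 ^t* *m _ *m _]mulmxA [_ *m J R *m _]mulmxA gJ.
  by rewrite mulmxA J_form !mxE /= conjC1 conjC0; ring.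
rewrite J_form -/(vc 0 g) -/(vc 1 g) -/(vc 2 g) => /subr0_eq h.
by rewrite ![vc _ g * _]mulrC h.
Qed.

(** An isotropic vector with vanishing last entry is zero, since the form is
definite on the first two; but [g] is invertible. *)
Lemma vc2_neq0 g : vc 2 g != 0.
Proof.
apply/eqP => c0; have := vc_isotropic g; rewrite c0 mul0r -!normCK => /eqP.
rewrite paddr_eq0 ?exprn_ge0 // !expf_eq0 /= !normr_eq0 => /andP[/eqP a0 /eqP b0].
have gv : (g : 'M[C]_3) *m v0 = 0.
  by apply/matrixP => i j; rewrite ord1 [RHS]mxE -/(vc i g); move: i; apply: ord3P.
have : (SU21_inv_mx g *m (g : 'M[C]_3)) *m v0 = 0 by rewrite -mulmxA gv mulmx0.
rewrite SU21_mulVmx ?SU21P // mul1mx => /matrixP /(_ 0 0); rewrite !mxE /= => /eqP.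
by rewrite oner_eq0.
Qed.

Lemma vcM (h g : G) i : vc i (h * g)%g = \sum_j (h : 'M[C]_3) i j * vc j g.
Proof. by rewrite /vc /= -mulmxA mxE. Qed.

Lemma vc_deriv X g i : su21 X ->
  cderiv (fun t => vc i (expG (- t%:C *: X) * g)%g) 0 (- \sum_j X i j * vc j g).
Proof.
move=> sX; have d := mxderivM (expG_mxderiv g sX) (mxderiv_cst v0 0).
apply: cderiv_eq (d i 0).
by rewrite mulmx0 addr0 !mulNmx mxE -mulmxA mxE.
Qed.

Definition eps (i : 'I_3) : C := if i == 2 then -1 else 1.

(** This makes the derivative of a conjugated coordinate complex linear in
[X], hence extendable to complex matrices. *)
Lemma su21_conj X i j : su21 X -> (X i j)^*%R = - (eps i * eps j * X j i).
Proof.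
move=> [/matrixP /(_ j i) h _].
have {}h : (X i j)^*%R * eps i + eps j * X j i = 0.
  move: h; rewrite !mxE (bigD1 i) //= big1 ?addr0 => [|p pi]; last first.
    by rewrite JE (negPf pi) !mulr0.
  rewrite (bigD1 j) //= big1 ?addr0 => [|p pj]; last by rewrite JE [j == p]eq_sym (negPf pj) mulr0 mul0r.
  by rewrite !JE !eqxx !mulr1 !mxE.
have e2 : eps i * eps i = 1 by rewrite /eps; case: ifP => _; rewrite ?mulrNN mulr1.
by rewrite -[LHS]mulr1 -e2 mulrA; move/eqP: h; rewrite addr_eq0 => /eqP ->; ring.
Qed.

Definition pc (z : C) : PV := mpolyC 3 z.
(** The following functions are [v_i], [conj v_i], [1 / v2], [1 / conj v2] and
the variables, all as polynomials, so that scalar and polynomial factors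
multiply in one ring. [Dva], [Dvb] and [Dx] are their images under the action.
*)
Definition va i g : PV := pc (vc i g).
Definition vb i g : PV := pc ((vc i g)^*%R).
Definition ci g : PV := pc ((vc 2 g)^-1).
Definition cbi g : PV := pc (((vc 2 g)^*%R)^-1).
Definition px (i : 'I_3) : PV := mpolyX C (mnm1 i).

Definition Dva X i g : PV := pc (X i 0) * va 0 g + pc (X i 1) * va 1 g + pc (X i 2) * va 2 g.
Definition Dvb X i g : PV := pc (eps i) *
  (pc (X 0 i) * vb 0 g + pc (X 1 i) * vb 1 g - pc (X 2 i) * vb 2 g).
Definition Dx X i : PV := pc (X 0 i) * px 0 + pc (X 1 i) * px 1 + pc (X 2 i) * px 2.

Lemma act_vb i : has_act (vb i) (fun X g => Dvb X i g).
Proof.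
apply: (@eq_act _ _ (fun X g => pc (\sum_j eps i * eps j * X j i * (vc j g)^*%R))).
  move=> X g; rewrite /Dvb /vb /pc -!(mpolyCM, mpolyCD, mpolyCN); congr (mpolyC 3 _).
  by rewrite big3 /eps /=; ring.
apply: act_scalar => [A B g|X sX g].
  by rewrite mulr_sumr -big_split; apply: eq_bigr => j _; rewrite !mxE /=; ring.
apply: cderiv_eq (cderivJ (vc_deriv g i sX)).
rewrite rmorphN rmorph_sum -sumrN; apply: eq_bigr => j _.
by rewrite rmorphM /= su21_conj //; ring.
Qed.

Lemma act_ci : has_act ci (fun X g => ci g ^+ 2 * Dva X 2 g).
Proof.
apply: (@eq_act _ _ (fun X g => pc ((\sum_j X 2 j * vc j g) / vc 2 g ^+ 2))).
  move=> X g; rewrite /Dva /va /ci /pc [in RHS]expr2 -!(mpolyCM, mpolyCD); congr (mpolyC 3 _).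
  by rewrite big3; field; rewrite vc2_neq0.
apply: act_scalar => [A B g|X sX g].
  by rewrite mulrA -mulrDl mulr_sumr -big_split; congr (_ / _); apply: eq_bigr => j _; rewrite !mxE /=; ring.
apply: cderiv_eq (cderivV (vc_deriv g 2 sX) (vc2_neq0 _)).
by rewrite expG0 // opprK.
Qed.

Lemma act_cbi : has_act cbi (fun X g => - (cbi g ^+ 2 * Dvb X 2 g)).
Proof.
apply: (@eq_act _ _ (fun X g => pc (- (\sum_j eps 2 * eps j * X j 2 * (vc j g)^*%R) / ((vc 2 g)^*%R) ^+ 2))).
  move=> X g; rewrite /Dvb /vb /cbi /pc [in RHS]expr2 -!(mpolyCM, mpolyCD, mpolyCN); congr (mpolyC 3 _).
  by rewrite big3 /eps /=; field; rewrite conjC_eq0 vc2_neq0.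
apply: act_scalar => [A B g|X sX g].
  rewrite mulrA -mulrDl mulrN -opprD mulr_sumr -big_split; congr (- _ / _).
  by apply: eq_bigr => j _; rewrite !mxE /=; ring.
have n0 h : (vc 2 h)^*%R != 0 by rewrite conjC_eq0 vc2_neq0.
apply: cderiv_eq (cderivV (cderivJ (vc_deriv g 2 sX)) (n0 _)).
rewrite expG0 //; congr (- _ / _).
rewrite rmorphN rmorph_sum -sumrN; apply: eq_bigr => j _.
by rewrite rmorphM /= su21_conj //; ring.
Qed.

Lemma act_px i : has_act (fun=> px i) (fun X g => Dx X i).
Proof.
apply: eq_act (act_poly _) => X g.
by rewrite polyDU /lform big3 /Dx /pc !mul_mpolyC.
Qed.

End Cone.

(** * The functions S_j *)

Section Explicit.
Variable R : realType.
Local Notation C := R[i].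
Local Notation PV := (mpoly 3 C).
Local Notation G := (SU21 R).
Implicit Types (X : 'M[C]_3) (g : G).

(** The linear form [conj(v0) y - conj(v1) x], whose [k]-th power carries all
the Wigner functions at once. *)
Definition pL g : PV := vb 0 g * px R 1 - vb 1 g * px R 0.
Definition Sk (k j : nat) g : PV := ci g ^+ k.+3 * cbi g ^+ j * pL g ^+ k.
(** The derivative of [Sk] with respect to its factor [pL]. *)
Definition Sk' (k j : nat) g : PV := ci g ^+ k.+3 * cbi g ^+ j * (k%:R * pL g ^+ k.-1).
Definition DpL X g : PV :=
  Dvb X 0 g * px R 1 + vb 0 g * Dx X 1 - (Dvb X 1 g * px R 0 + vb 1 g * Dx X 0).
Definition DSk (k j : nat) X g : PV :=
  (k.+3%:R * ci g * Dva X 2 g - j%:R * cbi g * Dvb X 2 g) * Sk k j g + Sk' k j g * DpL X g.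

Lemma Sk'_pL k j g : Sk' k j g * pL g = k%:R * Sk k j g.
Proof.
have alg (A : comRingType) (a l : A) n : a * (n%:R * l ^+ n.-1) * l = n%:R * (a * l ^+ n).
  by case: n => [|n]; rewrite /= ?exprS; ring.
exact: alg.
Qed.

Lemma actN F T : has_act F T -> has_act (fun g : G => - F g) (fun X g => - T X g).
Proof.
move=> aF; apply: (@eq_actF _ (fun g => (fun=> -1) g * F g)) => [g|]; first by rewrite mulN1r.
apply: eq_act (actM (act_poly (-1)) aF) => X g.
by rewrite -mpolyC1 -mpolyCN polyDC mul0r add0r mpolyCN mpolyC1 mulN1r.
Qed.

Lemma act_pL : has_act pL DpL.
Proof.
have a := actD (actM (@act_vb R 0) (@act_px R 1)) (actN (actM (@act_vb R 1) (@act_px R 0))).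
apply: (eq_act _ a) => X g; by [].
Qed.

Lemma act_Sk k j : has_act (Sk k j) (DSk k j).
Proof.
have a := actM (actM (actX k.+3 (@act_ci R)) (actX j (@act_cbi R))) (actX k act_pL).
apply: (eq_act _ a) => X g.
have alg (A : comRingType) (x y l u v w : A) n m :
  ((n.+1%:R * x ^+ n.+1.-1 * (x ^+ 2 * u)) * y ^+ m + x ^+ n.+1 * (m%:R * y ^+ m.-1 * - (y ^+ 2 * v))) * l ^+ k + x ^+ n.+1 * y ^+ m * (k%:R * l ^+ k.-1 * w) =
  (n.+1%:R * x * u - m%:R * y * v) * (x ^+ n.+1 * y ^+ m * l ^+ k) + x ^+ n.+1 * y ^+ m * (k%:R * l ^+ k.-1) * w.
  by case: m => [|m]; rewrite /= ?(exprS _ n) ?(exprS _ m); ring.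
exact: alg.
Qed.

Lemma pc_homog (z : C) : homog 0 (pc z).
Proof. by rewrite /homog /pc -[mpolyC 3 z]mulr1 mul_mpolyC; apply: rpredZ; apply: dhomog1. Qed.

Lemma homogM d e n (p q : PV) : homog d p -> homog e q -> n = (d + e)%N -> homog n (p * q).
Proof. by move=> hp hq ->; apply: dhomogM. Qed.

Lemma homogX d e n (p : PV) : homog d p -> e = (d * n)%N -> homog e (p ^+ n).
Proof. by move=> hp ->; apply: dhomogMn. Qed.

Lemma px_homog i : homog 1 (px R i).
Proof. by rewrite /homog dhomogX /= mdeg1. Qed.

Lemma pL_homog g : homog 1 (pL g).
Proof.
by apply: rpredB; apply: (homogM (pc_homog _) (px_homog _)).
Qed.

Lemma Sk_homog k j g : homog k (Sk k j g).
Proof.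
apply: (@homogM 0 k); last by [].
  apply: (@homogM 0 0) => //; apply: (@homogX 0) => //; exact: pc_homog.
by apply: (@homogX 1); rewrite ?mul1n //; apply: pL_homog.
Qed.

Lemma actT_Sk k j q Tq X : has_act q Tq -> (forall g, homog 0 (q g)) -> \tr X = 0 ->
  actT k X (fun g => q g * Sk k j g) = fun g => Tq X g * Sk k j g + q g * DSk k j X g.
Proof.
move=> aq hq tX; rewrite (actT_act (actM aq (act_Sk k j))) // => g.
by apply: (homogM (hq g) (Sk_homog _ _ _)).
Qed.

End Explicit.

(** * The three cochains as functions of matrices *)

Section Cochains.
Variable R : realType.
Variable k : nat.
Local Notation C := R[i].
Local Notation PV := (mpoly 3 C).
Local Notation G := (SU21 R).
Implicit Types (X Y Z U : 'M[C]_3) (g : G).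

Definition in_p X := [/\ X 0 0 = 0, X 0 1 = 0, X 1 0 = 0, X 1 1 = 0 & X 2 2 = 0].
Definition in_l X := [/\ X 0 2 = 0, X 1 2 = 0, X 2 0 = 0, X 2 1 = 0 & X 2 2 = - (X 0 0 + X 1 1)].

(** [nf Y] and [mf Y] are linear forms in [conj v0, conj v1] attached to the
components of [Y] in the two abelian subspaces of [p]: the bottom row for
[nf], the last column for [mf]. *)
Definition nf Y g : PV := pc (Y 2 1) * vb 0 g - pc (Y 2 0) * vb 1 g.
Definition mf Y g : PV := pc (Y 0 2) * vb 0 g + pc (Y 1 2) * vb 1 g.
Definition Dnf Y X g : PV := pc (Y 2 1) * Dvb X 0 g - pc (Y 2 0) * Dvb X 1 g.
Definition Dmf Y X g : PV := pc (Y 0 2) * Dvb X 0 g + pc (Y 1 2) * Dvb X 1 g.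

Definition chiX Y g : PV := nf Y g * Sk k 1 g.
Definition psiX Y Z g : PV := (mf Y g * nf Z g - mf Z g * nf Y g) * Sk k 2 g.
Definition psi0X Y Z g : PV := (pc (Y 2 0) * pc (Z 2 1) - pc (Y 2 1) * pc (Z 2 0)) * Sk k 0 g.

Lemma act_pc z : has_act (fun=> pc z) (fun (_ : 'M[C]_3) (_ : G) => 0).
Proof. by apply: eq_act (act_poly _) => X g; rewrite polyDC. Qed.

Lemma act_nf Y : has_act (nf Y) (Dnf Y).
Proof.
have a := actD (actM (act_pc (Y 2 1)) (@act_vb R 0)) (actN (actM (act_pc (Y 2 0)) (@act_vb R 1))).
apply: (eq_act _ a) => X g.
have alg (A : comRingType) (u v x y p q : A) : 0 * u + x * y + - (0 * v + p * q) = x * y - p * q by rewrite !mul0r !add0r.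
exact: alg.
Qed.

Lemma act_mf Y : has_act (mf Y) (Dmf Y).
Proof.
have a := actD (actM (act_pc (Y 0 2)) (@act_vb R 0)) (actM (act_pc (Y 1 2)) (@act_vb R 1)).
apply: (eq_act _ a) => X g.
have alg (A : comRingType) (u v x y p q : A) : 0 * u + x * y + (0 * v + p * q) = x * y + p * q by rewrite !mul0r !add0r.
exact: alg.
Qed.

Lemma nf_homog Y g : homog 0 (nf Y g).
Proof. by apply: rpredB; apply: (homogM (pc_homog _) (pc_homog _)). Qed.

Lemma mf_homog Y g : homog 0 (mf Y g).
Proof. by apply: rpredD; apply: (homogM (pc_homog _) (pc_homog _)). Qed.

Lemma actT_chiX Y X : \tr X = 0 -> actT k X (chiX Y) =
  fun g => Dnf Y X g * Sk k 1 g + nf Y g * DSk k 1 X g.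
Proof. by move=> tX; rewrite (actT_Sk _ _ (act_nf Y)) // => g; apply: nf_homog. Qed.

Lemma actT_psiX Y Z X : \tr X = 0 -> actT k X (psiX Y Z) = fun g =>
  ((Dmf Y X g * nf Z g + mf Y g * Dnf Z X g) - (Dmf Z X g * nf Y g + mf Z g * Dnf Y X g)) * Sk k 2 g
  + (mf Y g * nf Z g - mf Z g * nf Y g) * DSk k 2 X g.
Proof.
move=> tX; rewrite (actT_Sk _ _ (actD (actM (act_mf Y) (act_nf Z)) (actN (actM (act_mf Z) (act_nf Y))))) // => g.
by apply: rpredB; apply: (homogM (mf_homog _ _) (nf_homog _ _)).
Qed.

Lemma actT_psi0X Y Z X : \tr X = 0 -> actT k X (psi0X Y Z) = fun g =>
  (pc (Y 2 0) * pc (Z 2 1) - pc (Y 2 1) * pc (Z 2 0)) * DSk k 0 X g.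
Proof.
move=> tX.
have a := actD (actM (act_pc (Y 2 0)) (act_pc (Z 2 1))) (actN (actM (act_pc (Y 2 1)) (act_pc (Z 2 0)))).
rewrite (actT_Sk _ _ a) // => [|g].
  by apply/funext => g; rewrite !(mulr0, mul0r) addr0 subr0 mul0r add0r.
by apply: rpredB; apply: (homogM (pc_homog _) (pc_homog _)).
Qed.

Lemma in_l_tr U : in_l U -> \tr U = 0.
Proof. by case=> _ _ _ _ h; rewrite /mxtrace big3 h subrr. Qed.
Lemma in_p_tr U : in_p U -> \tr U = 0.
Proof. by case=> h1 _ _ h2 h3; rewrite /mxtrace big3 h1 h2 h3 !addr0. Qed.

Lemma pc0 : pc (0 : C) = 0. Proof. exact: mpolyC0. Qed.
Lemma pcD (x y : C) : pc (x + y) = pc x + pc y. Proof. exact: mpolyCD. Qed.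
Lemma pcN (x : C) : pc (- x) = - pc x. Proof. exact: mpolyCN. Qed.
Lemma pcM (x y : C) : pc (x * y) = pc x * pc y. Proof. exact: mpolyCM. Qed.
Lemma pc1 : pc (1 : C) = 1. Proof. exact: mpolyC1. Qed.

Lemma epsE : (eps R 0 = 1) * (eps R 1 = 1) * (eps R 2 = -1).
Proof. by []. Qed.

Lemma ci_va g : ci g * va 2 g = 1.
Proof. by rewrite /ci /va -pcM mulVf ?vc2_neq0 ?pc1. Qed.
Lemma cbi_vb g : cbi g * vb 2 g = 1.
Proof. by rewrite /cbi /vb -pcM mulVf ?conjC_eq0 ?vc2_neq0 ?pc1. Qed.

Lemma Dvb_l U g : in_l U ->
  [/\ Dvb U 0 g = pc (U 0 0) * vb 0 g + pc (U 1 0) * vb 1 g,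
      Dvb U 1 g = pc (U 0 1) * vb 0 g + pc (U 1 1) * vb 1 g &
      Dvb U 2 g = - (pc (U 0 0) + pc (U 1 1)) * vb 2 g].
Proof.
case=> u02 u12 u20 u21 u22; rewrite /Dvb !epsE u02 u12 u20 u21 u22 !(pcD, pcN, pc0, pc1).
have alg (A : comRingType) (u v x y z : A) : 1 * (u * x + v * y - 0 * z) = u * x + v * y by ring.
have alg2 (A : comRingType) (t x y z : A) : -1 * (0 * x + 0 * y - (- t * z)) = - t * z by ring.
by split; [exact: alg | exact: alg | exact: alg2].
Qed.

Lemma Dva_l U g : in_l U -> Dva U 2 g = - (pc (U 0 0) + pc (U 1 1)) * va 2 g.
Proof.
case=> u02 u12 u20 u21 u22; rewrite /Dva u20 u21 u22 !(pcD, pcN, pc0).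
have alg (A : comRingType) (t x y z : A) : 0 * x + 0 * y + (- t * z) = - t * z by ring.
exact: alg.
Qed.

Lemma Dx_l U : in_l U ->
  Dx U 0 = pc (U 0 0) * px R 0 + pc (U 1 0) * px R 1 /\
  Dx U 1 = pc (U 0 1) * px R 0 + pc (U 1 1) * px R 1.
Proof.
case=> u02 u12 u20 u21 u22; rewrite /Dx u20 u21 pc0.
have alg (A : comRingType) (u v x y z : A) : u * x + v * y + 0 * z = u * x + v * y by ring.
by split; exact: alg.
Qed.

(** [pL] is a determinant in [conj v] and the variables, so [l] acts on it, as
on [v2], through the trace of the upper block; the total weight is [j - 3]. *)
Lemma DSk_l j U g : in_l U ->
  DSk k j U g = (j%:R - 3%:R) * (pc (U 0 0) + pc (U 1 1)) * Sk k j g.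
Proof.
move=> Ul; have [eb0 eb1 eb2] := Dvb_l g Ul; have [ex0 ex1] := Dx_l Ul.
have alg (A : comRingType) (K K3 n i ib a x y b0 b1 b2 u00 u01 u10 u11 S S' : A) :
    K3 = K + 3%:R -> i * a = 1 -> ib * b2 = 1 -> S' * (b0 * y - b1 * x) = K * S ->
    (K3 * i * (- (u00 + u11) * a) - n * ib * (- (u00 + u11) * b2)) * S +
    S' * ((u00 * b0 + u10 * b1) * y + b0 * (u01 * x + u11 * y) -
          ((u01 * b0 + u11 * b1) * x + b1 * (u00 * x + u10 * y))) =
    (n - 3%:R) * (u00 + u11) * S.
  move=> -> ia ib2 SL; apply: subr0_eq.
  transitivity ((u00 + u11) * (- (K + 3%:R) * S * (i * a - 1) + n * S * (ib * b2 - 1) +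
     (S' * (b0 * y - b1 * x) - K * S))); first by ring.
  by rewrite ia ib2 SL !subrr !mulr0 !addr0 mulr0.
rewrite /DSk /DpL eb0 eb1 eb2 ex0 ex1 (Dva_l g Ul).
have e3 : k.+3%:R = k%:R + 3%:R :> PV by rewrite -natrD addn3.
exact: alg e3 (ci_va g) (cbi_vb g) (Sk'_pL k j g).
Qed.

Lemma Dvb_p X g : in_p X ->
  [/\ Dvb X 0 g = - (pc (X 2 0) * vb 2 g),
      Dvb X 1 g = - (pc (X 2 1) * vb 2 g) &
      Dvb X 2 g = - mf X g].
Proof.
case=> x00 x01 x10 x11 x22; rewrite /Dvb /mf !epsE x00 x01 x10 x11 x22 pcN !(pc0, pc1).
have alg (A : comRingType) (u x y z : A) : 1 * (0 * x + 0 * y - u * z) = - (u * z) by ring.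
have alg2 (A : comRingType) (u v x y z : A) : -1 * (u * x + v * y - 0 * z) = - (u * x + v * y) by ring.
by split; [exact: alg | exact: alg | exact: alg2].
Qed.

Lemma Dva_p X g : in_p X -> Dva X 2 g = pc (X 2 0) * va 0 g + pc (X 2 1) * va 1 g.
Proof.
case=> x00 x01 x10 x11 x22; rewrite /Dva x22 pc0.
have alg (A : comRingType) (u v x y z : A) : u * x + v * y + 0 * z = u * x + v * y by ring.
exact: alg.
Qed.

Lemma Dx_p X : in_p X -> Dx X 0 = pc (X 2 0) * px R 2 /\ Dx X 1 = pc (X 2 1) * px R 2.
Proof.
case=> x00 x01 x10 x11 x22; rewrite /Dx x00 x01 x10 x11 pc0.
have alg (A : comRingType) (u x y z : A) : 0 * x + 0 * y + u * z = u * z by ring.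
by split; exact: alg.
Qed.

Definition d34 X Y : PV := pc (X 2 0) * pc (Y 2 1) - pc (X 2 1) * pc (Y 2 0).

Lemma isotropic g : va 0 g * vb 0 g + va 1 g * vb 1 g = va 2 g * vb 2 g.
Proof. by rewrite /va /vb -!(pcM, pcD) vc_isotropic. Qed.

(** [PS] and [QS] are the coefficients of the bottom row of [X] in the action
of [X] on [Sk]. *)
Definition PS j g : PV :=
  k.+3%:R * ci g * va 0 g * Sk k j g - Sk' k j g * (vb 2 g * px R 1 + vb 1 g * px R 2).
Definition QS j g : PV :=
  k.+3%:R * ci g * va 1 g * Sk k j g + Sk' k j g * (vb 2 g * px R 0 + vb 0 g * px R 2).

Lemma DSk_p j X g : in_p X ->
  DSk k j X g = pc (X 2 0) * PS j g + pc (X 2 1) * QS j g + j%:R * cbi g * mf X g * Sk k j g.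
Proof.
move=> Xp; have [eb0 eb1 eb2] := Dvb_p g Xp; have [ex0 ex1] := Dx_p Xp.
have alg (A : comRingType) (K3 n i ib a b x y z b0 b1 b2 p q m S S' : A) :
    (K3 * i * (p * a + q * b) - n * ib * - m) * S +
       S' * (- (p * b2) * y + b0 * (q * z) - (- (q * b2) * x + b1 * (p * z))) =
    p * (K3 * i * a * S - S' * (b2 * y + b1 * z)) + q * (K3 * i * b * S + S' * (b2 * x + b0 * z))
    + n * ib * m * S by ring.
by rewrite /DSk /DpL eb0 eb1 eb2 ex0 ex1 (Dva_p g Xp); apply: alg.
Qed.

(** An Euler type relation, and the point where the isotropy of [v] is used.
*)
Lemma PQ_sum j g : vb 0 g * PS j g + vb 1 g * QS j g = 3%:R * vb 2 g * Sk k j g.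
Proof.
have alg (A : comRingType) (K K3 i a b c x y z b0 b1 b2 S S' : A) :
    K3 = K + 3%:R -> i * c = 1 -> a * b0 + b * b1 = c * b2 -> S' * (b0 * y - b1 * x) = K * S ->
    b0 * (K3 * i * a * S - S' * (b2 * y + b1 * z)) + b1 * (K3 * i * b * S + S' * (b2 * x + b0 * z))
    = 3%:R * b2 * S.
  move=> -> ic iso SL; apply: subr0_eq.
  transitivity ((K + 3%:R) * S * (i * (a * b0 + b * b1 - c * b2) + b2 * (i * c - 1)) - b2 * (S' * (b0 * y - b1 * x) - K * S)); first by ring.
  by rewrite ic iso SL !subrr !mulr0 !addr0 !mulr0 subrr.
have e3 : k.+3%:R = k%:R + 3%:R :> PV by rewrite -natrD addn3.
exact: alg e3 (ci_va g) (isotropic g) (Sk'_pL k j g).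
Qed.

End Cochains.

(** * Equivariance and differentials *)

Section Identities.
Variable R : realType.
Variable k : nat.
Local Notation C := R[i].
Local Notation PV := (mpoly 3 C).
Local Notation G := (SU21 R).
Implicit Types (X Y Z U : 'M[C]_3) (g : G).

(** The bracket with [l] preserves [p]; the entries are recorded in polynomial
form for the identities below. *)
Lemma bracket_lp U Y : in_l U -> in_p Y -> let B := bracket U Y in
  [/\ in_p B,
      pc (B 2 0) = - (pc (U 0 0) + pc (U 1 1)) * pc (Y 2 0) - (pc (Y 2 0) * pc (U 0 0) + pc (Y 2 1) * pc (U 1 0)),
      pc (B 2 1) = - (pc (U 0 0) + pc (U 1 1)) * pc (Y 2 1) - (pc (Y 2 0) * pc (U 0 1) + pc (Y 2 1) * pc (U 1 1)),
      pc (B 0 2) = pc (U 0 0) * pc (Y 0 2) + pc (U 0 1) * pc (Y 1 2) + (pc (U 0 0) + pc (U 1 1)) * pc (Y 0 2) &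
      pc (B 1 2) = pc (U 1 0) * pc (Y 0 2) + pc (U 1 1) * pc (Y 1 2) + (pc (U 0 0) + pc (U 1 1)) * pc (Y 1 2)].
Proof.
case=> u02 u12 u20 u21 u22 [y00 y01 y10 y11 y22] B.
have BE i j : B i j = \sum_l U i l * Y l j - \sum_l Y i l * U l j by rewrite !mxE.
split; first by split; rewrite BE !big3 ?u02 ?u12 ?u20 ?u21 ?u22 ?y00 ?y01 ?y10 ?y11 ?y22; ring.
- by rewrite BE !big3 u20 u21 u22 y00 y10 y22 -!(pcM, pcD, pcN); congr pc; ring.
- by rewrite BE !big3 u20 u21 u22 y01 y11 y22 -!(pcM, pcD, pcN); congr pc; ring.
- by rewrite BE !big3 u02 u12 u22 y00 y01 y22 -!(pcM, pcD, pcN); congr pc; ring.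
- by rewrite BE !big3 u02 u12 u22 y10 y11 y22 -!(pcM, pcD, pcN); congr pc; ring.
Qed.

Lemma Dnf_l U Y g : in_l U -> in_p Y ->
  Dnf Y U g = nf (bracket U Y) g + 2%:R * (pc (U 0 0) + pc (U 1 1)) * nf Y g.
Proof.
move=> Ul Yp; have [b0 b1 _] := Dvb_l g Ul; have [_ e0 e1 _ _] := bracket_lp Ul Yp.
rewrite /Dnf /nf b0 b1 e0 e1.
have alg (A : comRingType) (x y u00 u01 u10 u11 y0 y1 : A) :
  y1 * (u00 * x + u10 * y) - y0 * (u01 * x + u11 * y) =
  (- (u00 + u11) * y1 - (y0 * u01 + y1 * u11)) * x - (- (u00 + u11) * y0 - (y0 * u00 + y1 * u10)) * y + 2%:R * (u00 + u11) * (y1 * x - y0 * y) by ring.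
exact: alg.
Qed.

Lemma Dmf_l U Y g : in_l U -> in_p Y ->
  Dmf Y U g = mf (bracket U Y) g - (pc (U 0 0) + pc (U 1 1)) * mf Y g.
Proof.
move=> Ul Yp; have [b0 b1 _] := Dvb_l g Ul; have [_ _ _ e0 e1] := bracket_lp Ul Yp.
rewrite /Dmf /mf b0 b1 e0 e1.
have alg (A : comRingType) (x y u00 u01 u10 u11 y0 y1 : A) :
  y0 * (u00 * x + u10 * y) + y1 * (u01 * x + u11 * y) =
  (u00 * y0 + u01 * y1 + (u00 + u11) * y0) * x + (u10 * y0 + u11 * y1 + (u00 + u11) * y1) * y - (u00 + u11) * (y0 * x + y1 * y) by ring.
exact: alg.
Qed.

Lemma d34_l U Y Z : in_l U -> in_p Y -> in_p Z ->
  d34 (bracket U Y) Z + d34 Y (bracket U Z) = - (3%:R * (pc (U 0 0) + pc (U 1 1)) * d34 Y Z).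
Proof.
move=> Ul Yp Zp; have [_ e0 e1 _ _] := bracket_lp Ul Yp; have [_ f0 f1 _ _] := bracket_lp Ul Zp.
rewrite /d34 e0 e1 f0 f1.
have alg (A : comRingType) (u00 u01 u10 u11 y0 y1 z0 z1 : A) :
  (- (u00 + u11) * y0 - (y0 * u00 + y1 * u10)) * z1 - (- (u00 + u11) * y1 - (y0 * u01 + y1 * u11)) * z0
  + (y0 * (- (u00 + u11) * z1 - (z0 * u01 + z1 * u11)) - y1 * (- (u00 + u11) * z0 - (z0 * u00 + z1 * u10)))
  = - (3%:R * (u00 + u11) * (y0 * z1 - y1 * z0)) by ring.
exact: alg.
Qed.

Lemma chiX_equiv U Y : in_l U -> in_p Y -> actT k U (chiX k Y) = chiX k (bracket U Y).
Proof.
move=> Ul Yp; rewrite actT_chiX ?in_l_tr //; apply/funext => g.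
rewrite /chiX (Dnf_l g Ul Yp) (DSk_l _ _ g Ul).
have alg (A : comRingType) (n n' t S : A) : (n' + 2%:R * t * n) * S + n * ((1 - 3%:R) * t * S) = n' * S by ring.
exact: alg.
Qed.

Lemma psiX_equiv U Y Z : in_l U -> in_p Y -> in_p Z ->
  actT k U (psiX k Y Z) = psiX k (bracket U Y) Z + psiX k Y (bracket U Z).
Proof.
move=> Ul Yp Zp; rewrite actT_psiX ?in_l_tr //; apply/funext => g.
rewrite [RHS]/(psiX _ _ _ g + psiX _ _ _ g) /psiX.
rewrite (Dnf_l g Ul Yp) (Dnf_l g Ul Zp) (Dmf_l g Ul Yp) (Dmf_l g Ul Zp) (DSk_l _ _ g Ul).
have alg (A : comRingType) (n n' m m' nb nb' mb mb' t S : A) :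
  ((mb - t * m) * n' + m * (nb' + 2%:R * t * n') - ((mb' - t * m') * n + m' * (nb + 2%:R * t * n))) * S
  + (m * n' - m' * n) * ((2%:R - 3%:R) * t * S) =
  (mb * n' - m' * nb) * S + (m * nb' - mb' * n) * S by ring.
exact: alg.
Qed.

Lemma psi0X_equiv U Y Z : in_l U -> in_p Y -> in_p Z ->
  actT k U (psi0X k Y Z) = psi0X k (bracket U Y) Z + psi0X k Y (bracket U Z).
Proof.
move=> Ul Yp Zp; rewrite actT_psi0X ?in_l_tr //; apply/funext => g.
rewrite [RHS]/(d34 _ _ * _ + d34 _ _ * _) (DSk_l _ _ g Ul) -/(d34 Y Z).
have alg (A : comRingType) (d d1 d2 t S : A) : d1 + d2 = - (3%:R * t * d) ->
    d * ((0 - 3%:R) * t * S) = d1 * S + d2 * S.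
  by move=> e; rewrite -mulrDl e; ring.
exact: alg (d34_l Ul Yp Zp).
Qed.

Lemma SkS j g : Sk k j g = vb 2 g * Sk k j.+1 g.
Proof.
have alg (A : comRingType) (x y z b l : A) : y * b = 1 -> x * z * l = b * (x * (y * z) * l).
  by move=> yb; transitivity ((y * b) * (x * z * l)); [rewrite yb mul1r | ring].
rewrite /Sk [cbi g ^+ j.+1]exprS; apply: alg; exact: cbi_vb.
Qed.

Lemma SkV j g : cbi g * Sk k j g = Sk k j.+1 g.
Proof.
have alg (A : comRingType) (x y z l : A) : y * (x * z * l) = x * (y * z) * l by ring.
rewrite /Sk [cbi g ^+ j.+1]exprS; exact: alg.
Qed.

Lemma Dnf_p X Y g : in_p X -> Dnf Y X g = - (d34 X Y * vb 2 g).
Proof.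
move=> Xp; have [b0 b1 _] := Dvb_p g Xp; rewrite /Dnf b0 b1 /d34.
have alg (A : comRingType) (x0 x1 y0 y1 b : A) : y1 * - (x0 * b) - y0 * - (x1 * b) = - ((x0 * y1 - x1 * y0) * b) by ring.
exact: alg.
Qed.

(** Three contributions: differentiating [nf] gives [- 2 psi0X], the bottom
row part of the action on [Sk k 1] gives [3 psi0X] by [PQ_sum], and the part
coming from [conj v2] gives [psiX]. *)
Lemma dchiX Y Z : in_p Y -> in_p Z ->
  actT k Y (chiX k Z) - actT k Z (chiX k Y) = psiX k Y Z + psi0X k Y Z.
Proof.
move=> Yp Zp; rewrite !actT_chiX ?in_p_tr //; apply/funext => g.
rewrite [LHS]/(_ * _ + _ * _ - (_ * _ + _ * _)).
rewrite [RHS]/(_ * _ + d34 _ _ * _) (SkS 0) -(SkV 1).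
rewrite (Dnf_p _ g Yp) (Dnf_p _ g Zp) /d34 (DSk_p _ _ g Yp) (DSk_p _ _ g Zp).
have alg (A : comRingType) (a b P Q c m m' S y0 y1 z0 z1 b2 : A) :
   a * P + b * Q = 3%:R * b2 * S ->
   - ((y0 * z1 - y1 * z0) * b2) * S + (z1 * a - z0 * b) * (y0 * P + y1 * Q + 1 * c * m * S)
   - (- ((z0 * y1 - z1 * y0) * b2) * S + (y1 * a - y0 * b) * (z0 * P + z1 * Q + 1 * c * m' * S)) =
   (m * (z1 * a - z0 * b) - m' * (y1 * a - y0 * b)) * (c * S) + (y0 * z1 - y1 * z0) * (b2 * S).
  move=> e; apply: subr0_eq.
  transitivity ((y0 * z1 - y1 * z0) * ((a * P + b * Q) - 3%:R * b2 * S)); first by ring.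
  by rewrite e subrr mulr0.
exact: alg (PQ_sum k 1 g).
Qed.

(** Antisymmetrising over three arguments kills the bottom row part because
bottom rows form a space of dimension two. *)
Lemma dpsi0X X Y Z : in_p X -> in_p Y -> in_p Z ->
  actT k X (psi0X k Y Z) - actT k Y (psi0X k X Z) + actT k Z (psi0X k X Y) = 0.
Proof.
move=> Xp Yp Zp; rewrite !actT_psi0X ?in_p_tr //; apply/funext => g.
rewrite [LHS]/(_ * _ - _ * _ + _ * _) [RHS]/(0 : PV) (DSk_p _ _ g Xp) (DSk_p _ _ g Yp) (DSk_p _ _ g Zp).
have alg (A : comRingType) (P Q c m m' m'' S x0 x1 y0 y1 z0 z1 : A) :
  (y0 * z1 - y1 * z0) * (x0 * P + x1 * Q + 0 * c * m * S)
  - (x0 * z1 - x1 * z0) * (y0 * P + y1 * Q + 0 * c * m' * S)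
  + (x0 * y1 - x1 * y0) * (z0 * P + z1 * Q + 0 * c * m'' * S) = 0 by ring.
exact: alg.
Qed.

Lemma Dmf_p X Y g : in_p X ->
  Dmf Y X g = - ((pc (Y 0 2) * pc (X 2 0) + pc (Y 1 2) * pc (X 2 1)) * vb 2 g).
Proof.
move=> Xp; have [b0 b1 _] := Dvb_p g Xp; rewrite /Dmf b0 b1.
have alg (A : comRingType) (x0 x1 y0 y1 b : A) : y0 * - (x0 * b) + y1 * - (x1 * b) = - ((y0 * x0 + y1 * x1) * b) by ring.
exact: alg.
Qed.

(** One term of the alternating sum, with the functions replaced by elements
of an arbitrary ring and the entries by scalars: [x, y, z] for the bottom rows
and [u, v, w] for the last columns of the three matrices. *)
Definition dpsi_term (A : comRingType)
    (a b P Q c S b2 x0 x1 u0 u1 y0 y1 v0 v1 z0 z1 w0 w1 : A) : A :=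
  ((- ((v0 * x0 + v1 * x1) * b2) * (z1 * a - z0 * b) +
    (v0 * a + v1 * b) * - ((x0 * z1 - x1 * z0) * b2)) -
   (- ((w0 * x0 + w1 * x1) * b2) * (y1 * a - y0 * b) +
    (w0 * a + w1 * b) * - ((x0 * y1 - x1 * y0) * b2))) * S +
  ((v0 * a + v1 * b) * (z1 * a - z0 * b) - (w0 * a + w1 * b) * (y1 * a - y0 * b)) *
  (x0 * P + x1 * Q + 2%:R * c * (u0 * a + u1 * b) * S).

(** The alternating sum is a multiple of the relation [PQ_sum]. *)
Lemma dpsi_term_alt (A : comRingType)
    (a b P Q c S b2 x0 x1 u0 u1 y0 y1 v0 v1 z0 z1 w0 w1 : A) :
  a * P + b * Q = 3%:R * b2 * S ->
  dpsi_term a b P Q c S b2 x0 x1 u0 u1 y0 y1 v0 v1 z0 z1 w0 w1 -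
  dpsi_term a b P Q c S b2 y0 y1 v0 v1 x0 x1 u0 u1 z0 z1 w0 w1 +
  dpsi_term a b P Q c S b2 z0 z1 w0 w1 x0 x1 u0 u1 y0 y1 v0 v1 = 0.
Proof.
move=> e; rewrite /dpsi_term.
transitivity (((v0 * a + v1 * b) * (x0 * z1 - x1 * z0) - (u0 * a + u1 * b) * (y0 * z1 - y1 * z0)
   - (w0 * a + w1 * b) * (x0 * y1 - x1 * y0)) * ((a * P + b * Q) - 3%:R * b2 * S)); first by ring.
by rewrite e subrr mulr0.
Qed.

Lemma act_psiX_p X Y Z g : in_p X -> actT k X (psiX k Y Z) g =
  dpsi_term (vb 0 g) (vb 1 g) (PS k 2 g) (QS k 2 g) (cbi g) (Sk k 2 g) (vb 2 g)
    (pc (X 2 0)) (pc (X 2 1)) (pc (X 0 2)) (pc (X 1 2))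
    (pc (Y 2 0)) (pc (Y 2 1)) (pc (Y 0 2)) (pc (Y 1 2))
    (pc (Z 2 0)) (pc (Z 2 1)) (pc (Z 0 2)) (pc (Z 1 2)).
Proof.
move=> Xp; rewrite actT_psiX ?in_p_tr // (DSk_p _ _ g Xp).
by rewrite !(Dnf_p _ g Xp, Dmf_p _ g Xp).
Qed.

Lemma dpsiX X Y Z : in_p X -> in_p Y -> in_p Z ->
  actT k X (psiX k Y Z) - actT k Y (psiX k X Z) + actT k Z (psiX k X Y) = 0.
Proof.
move=> Xp Yp Zp; apply/funext => g.
rewrite [LHS]/(actT k X _ g - actT k Y _ g + actT k Z _ g) !act_psiX_p //.
exact: dpsi_term_alt (PQ_sum k 2 g).
Qed.

End Identities.

(** * Smoothness of rational functions *)

Section NearDiff.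
Variables (R : realType) (V W : normedModType R).

(** Differentiability is a property of germs: the remainder terms agree near
the point. *)
Lemma near_eq_differentiable (f g : V -> W) (x : V) :
  (\near x, f x = g x) -> differentiable f x -> differentiable g x.
Proof.
move=> fg /diff_locallyP [dc df].
have h : g \o shift x = cst (g x) + 'd f x +o_ 0 id.
  apply/eqaddoP => _/posnumP[e].
  have /eqaddoP /(_ e%:num (gt0 e)) := df.
  have fgx : f x = g x by apply: nbhs_singleton fg.
  have fg0 : \forall h \near 0, f (h + x) = g (h + x).
    by have := fg; rewrite (near_shift 0) /= subr0.
  move=> fo; near=> h.
  have -> : (g \o shift x - (cst (g x) + 'd f x)) h = (f \o shift x - (cst (f x) + 'd f x)) h.
    have e1 : f (h + x) = g (h + x) by near: h.
    by rewrite -[LHS]/(g (h + x) - (g x + 'd f x h)) -e1 -fgx.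
  by near: h.
have dg := diff_unique dc h.
by apply/diff_locallyP; rewrite dg.
Unshelve. all: by end_near. Qed.
End NearDiff.

Section Rational.
Variable R : realType.
Local Notation C := R[i].
Local Notation G := (SU21 R).
Local Notation E := ('M[R]_3 * 'M[R]_3)%type.

(** [`|v2|^2] in the real coordinates of the matrix. *)
Definition den (x : E) : R := (x.1 2 0 + x.1 2 2) ^+ 2 + (x.2 2 0 + x.2 2 2) ^+ 2.

(** Polynomials in the real coordinates and in [1 / den]. This class is closed
under directional derivatives, which is what iterating derivatives requires.
*)
Inductive ratfun : (E -> R) -> Prop :=
| rat_cst c : ratfun (fun=> c)
| rat_re i j : ratfun (fun x => x.1 i j)
| rat_im i j : ratfun (fun x => x.2 i j)
| rat_add F1 F2 : ratfun F1 -> ratfun F2 -> ratfun (fun x => F1 x + F2 x)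
| rat_mul F1 F2 : ratfun F1 -> ratfun F2 -> ratfun (fun x => F1 x * F2 x)
| rat_inv : ratfun (fun x => (den x)^-1).

Definition dratfun (F : E -> R) := exists2 DF : E -> E -> R,
  (forall v, ratfun (DF v)) &
  (forall x, den x != 0 -> differentiable F x /\ forall v, 'D_v F x = DF v x).

Lemma drat_cst c : dratfun (fun=> c).
Proof.
exists (fun _ _ : E => 0); first by move=> v; apply: rat_cst.
by move=> x _; split=> [|v]; [apply: differentiable_cst | apply: derive_cst].
Qed.

Lemma derive_affine (F : E -> R) (l : R) (v x : E) :
  (forall h, F (h *: v + x) = h * l + F x) -> 'D_v F x = l.
Proof.
move=> Fl; apply: cvg_lim => //; apply: cvg_near_cst; near=> h.
rewrite /= Fl addrK /GRing.scale /= mulKf //.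
by near: h; exact: nbhs_dnbhs_neq.
Unshelve. all: by end_near. Qed.

Lemma drat_re i j : dratfun (fun x => x.1 i j).
Proof.
exists (fun (v _ : E) => v.1 i j) => [v|x _]; first exact: rat_cst.
split=> [|v]; last by apply: derive_affine => h; rewrite !mxE.
have d1 : differentiable (fst : E -> 'M[R]_3) x by apply: linear_differentiable => y; exact: cvg_fst.
exact: (differentiable_comp d1 (differentiable_coord x.1 i j)).
Qed.

Lemma drat_im i j : dratfun (fun x => x.2 i j).
Proof.
exists (fun (v _ : E) => v.2 i j) => [v|x _]; first exact: rat_cst.
split=> [|v]; last by apply: derive_affine => h; rewrite !mxE.
have d1 : differentiable (snd : E -> 'M[R]_3) x by apply: linear_differentiable => y; exact: cvg_snd.
exact: (differentiable_comp d1 (differentiable_coord x.2 i j)).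
Qed.

Lemma drat_add F1 F2 : dratfun F1 -> dratfun F2 -> dratfun (fun x => F1 x + F2 x).
Proof.
move=> [D1 r1 d1] [D2 r2 d2]; exists (fun v x : E => D1 v x + D2 v x) => [v|x x0].
  exact: rat_add.
have [f1 e1] := d1 _ x0; have [f2 e2] := d2 _ x0.
split=> [|v]; first exact: differentiableD.
by rewrite -e1 -e2; apply: deriveD; apply: diff_derivable.
Qed.

Lemma drat_mul F1 F2 : ratfun F1 -> ratfun F2 -> dratfun F1 -> dratfun F2 -> dratfun (fun x => F1 x * F2 x).
Proof.
move=> q1 q2 [D1 r1 d1] [D2 r2 d2].
exists (fun v x : E => F1 x * D2 v x + F2 x * D1 v x) => [v|x x0].
  by apply: rat_add; apply: rat_mul.
have [f1 e1] := d1 _ x0; have [f2 e2] := d2 _ x0.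
split=> [|v]; first exact: differentiableM.
by rewrite -e1 -e2; apply: deriveM; apply: diff_derivable.
Qed.

Lemma drat_den : dratfun den.
Proof.
have a : ratfun (fun x => x.1 2 0 + x.1 2 2) by apply: rat_add; apply: rat_re.
have b : ratfun (fun x => x.2 2 0 + x.2 2 2) by apply: rat_add; apply: rat_im.
have da : dratfun (fun x => x.1 2 0 + x.1 2 2) by apply: drat_add; apply: drat_re.
have db : dratfun (fun x => x.2 2 0 + x.2 2 2) by apply: drat_add; apply: drat_im.
by apply: drat_add; apply: drat_mul.
Qed.

Lemma drat_inv : dratfun (fun x => (den x)^-1).
Proof.
have [D r d] := drat_den.
exists (fun v x : E => (-1) * ((den x)^-1 * (den x)^-1) * D v x) => [v|x x0].
  by do 2?apply: rat_mul => //; [apply: rat_cst | apply: rat_mul; apply: rat_inv].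
have [f e] := d _ x0; split=> [|v]; first exact: differentiableV.
rewrite deriveV //; last exact: diff_derivable.
by rewrite e /GRing.scale /= expr2 invfM mulN1r.
Qed.

Lemma ratfun_drat F : ratfun F -> dratfun F.
Proof.
elim=> {F} *; [exact: drat_cst|exact: drat_re|exact: drat_im|exact: drat_add|exact: drat_mul|exact: drat_inv].
Qed.

Lemma den_open : open [set x | den x != 0].
Proof.
rewrite openE => x /= x0.
have [D _ /(_ _ x0) [/differentiable_continuous c _]] := drat_den.
have h : nbhs (den x) [set y : R | y != 0] by exact: (open_nbhs_nbhs (conj (@open_neq R 0) x0)).
have h2 : nbhs x [set x1 : E | den x1 != 0] := c _ h. exact: h2.
Qed.

Lemma den_near (x : E) : den x != 0 -> \forall y \near x, den y != 0.
Proof. by move=> x0; apply: open_nbhs_nbhs; split => //; exact: den_open. Qed.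

(** By induction on the directions, an iterated derivative agrees on the open
set [den != 0] with a function of the same class. *)
Lemma ratfun_smooth F : ratfun F -> smooth_on [set x | den x != 0] F.
Proof.
move=> rF vs.
have [H rH eH] : exists2 H, ratfun H & forall x, den x != 0 -> foldr (fun v (H : E -> R) => 'D_v H) F vs x = H x.
  elim: vs => [|v vs [H rH eH]]; first by exists F.
  have [D r d] := ratfun_drat rH; exists (D v) => // x x0 /=.
  rewrite -(d _ x0).2; apply: near_eq_derive.
  by apply: filterS (den_near x0) => y; apply: eH.
move=> x x0; have [D _ d] := ratfun_drat rH.
apply: near_eq_differentiable (d _ x0).1.
by apply: filterS (den_near x0) => y y0; rewrite eH.
Qed.

End Rational.

(** * Regular K-finite functions *)

Section Nice.
Variable R : realType.
Local Notation C := R[i].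
Local Notation Re := (@complex.Re R).
Local Notation Im := (@complex.Im R).
Local Notation PV := (mpoly 3 C).
Local Notation G := (SU21 R).
Local Notation E := ('M[R]_3 * 'M[R]_3)%type.
Implicit Types (f : G -> C) (F : G -> PV).

(** Restrictions of rational functions; the denominators are powers of
[`|v2|^2], which does not vanish on the group. *)
Definition regular f := exists F1 F2 : E -> R, [/\ ratfun F1, ratfun F2 &
  forall g, f g = F1 (realify g) +i* F2 (realify g)].

Lemma den_realify (g : G) : den (realify g) = Re (vc 2 g) ^+ 2 + Im (vc 2 g) ^+ 2.
Proof. by rewrite /den /= !mxE vcE ReD ImD. Qed.

Lemma den_realify_neq0 (g : G) : den (realify g) != 0.
Proof.
rewrite den_realify paddr_eq0 ?sqr_ge0 // !sqrf_eq0; apply/negP => /andP[/eqP r0 /eqP i0].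
by have /eqP := vc2_neq0 g; apply; apply: complexP.
Qed.

Lemma regular_smooth f : regular f -> smooth f.
Proof.
move=> [F1 [F2 [r1 r2 fE]]] g; exists [set x | den x != 0], F1, F2; split.
- exact: den_open.
- exact: den_realify_neq0.
- exact: ratfun_smooth.
- exact: ratfun_smooth.
- by move=> h _; apply: fE.
Qed.

Lemma regular_cst z : regular (fun=> z).
Proof.
exists (fun=> Re z), (fun=> Im z); split; try exact: rat_cst.
by move=> g; apply: complexP.
Qed.

Lemma regularD f1 f2 : regular f1 -> regular f2 -> regular (fun g => f1 g + f2 g).
Proof.
move=> [a [b [ra rb e]]] [c [d [rc rd e']]].
exists (fun x => a x + c x), (fun x => b x + d x); split; try exact: rat_add.
by move=> g; rewrite e e'.
Qed.

Lemma regularM f1 f2 : regular f1 -> regular f2 -> regular (fun g => f1 g * f2 g).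
Proof.
move=> [a [b [ra rb e]]] [c [d [rc rd e']]].
exists (fun x => a x * c x + (-1) * (b x * d x)), (fun x => a x * d x + b x * c x); split.
- by apply: rat_add; apply: rat_mul => //; [apply: rat_cst | apply: rat_mul].
- by apply: rat_add; apply: rat_mul.
- by move=> g; rewrite e e'; apply: complexP => /=; ring.
Qed.

Lemma regularJ f : regular f -> regular (fun g => (f g)^*%R).
Proof.
move=> [a [b [ra rb e]]]; exists a, (fun x => (-1) * b x); split => //.
  by apply: rat_mul => //; apply: rat_cst.
by move=> g; rewrite e; apply: complexP => /=; ring.
Qed.

Lemma regular_vc i : regular (vc i).
Proof.
exists (fun x : E => x.1 i 0 + x.1 i 2), (fun x : E => x.2 i 0 + x.2 i 2); split.
- by apply: rat_add; apply: rat_re.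
- by apply: rat_add; apply: rat_im.
- by move=> g; rewrite vcE /= !mxE; apply: complexP; rewrite ?ReD ?ImD.
Qed.

Lemma regular_vc2V : regular (fun g => (vc 2 g)^-1).
Proof.
have [a [b [ra rb e]]] := regularJ (regular_vc 2).
exists (fun x => a x * (den x)^-1), (fun x => b x * (den x)^-1); split.
- by apply: rat_mul => //; apply: rat_inv.
- by apply: rat_mul => //; apply: rat_inv.
move=> g; have := den_realify_neq0 g; set d := den _ => d0.
have nE : d%:C = vc 2 g * (vc 2 g)^*%R.
  by rewrite /d den_realify; apply: complexP; rewrite ?ReM ?ImM ?ReJ ?ImJ /=; ring.
have -> : (vc 2 g)^-1 = (vc 2 g)^*%R * (d^-1)%:C.
  by rewrite fmorphV /= nE; field; rewrite conjC_eq0 vc2_neq0.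
by rewrite e; apply: complexP => /=; ring.
Qed.

Lemma Kfinite_cst z : Kfinite (fun=> z : C).
Proof.
exists 1%N, (fun _ _ => 1) => h _; exists (fun=> z) => g.
by rewrite big_ord_recl big_ord0 mulr1 addr0.
Qed.

Lemma Kfinite_finType (T : finType) (e : T -> G -> C) f :
  (forall h, Kinf h -> exists c : T -> C,
     forall g, f (h^-1 * g)%g = \sum_i c i * e i g) -> Kfinite f.
Proof.
move=> H; exists #|T|, (fun i => e (enum_val i)) => h Kh.
have [c hc] := H h Kh; exists (fun i => c (enum_val i)) => g.
rewrite hc (reindex (@enum_val T T)) //.
by exists enum_rank => i _; rewrite ?enum_rankK ?enum_valK.
Qed.

Lemma KfiniteD f1 f2 : Kfinite f1 -> Kfinite f2 -> Kfinite (fun g => f1 g + f2 g).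
Proof.
move=> [n [e H]] [m [e' H']].
apply: (@Kfinite_finType ('I_n + 'I_m)%type
  (fun i => match i with inl a => e a | inr b => e' b end)) => h Kh.
have [c hc] := H h Kh; have [c' hc'] := H' h Kh.
exists (fun i => match i with inl a => c a | inr b => c' b end) => g.
by rewrite big_sumType hc hc'.
Qed.

Lemma KfiniteM f1 f2 : Kfinite f1 -> Kfinite f2 -> Kfinite (fun g => f1 g * f2 g).
Proof.
move=> [n [e H]] [m [e' H']].
apply: (@Kfinite_finType ('I_n * 'I_m)%type (fun i g => e i.1 g * e' i.2 g)) => h Kh.
have [c hc] := H h Kh; have [c' hc'] := H' h Kh.
exists (fun i => c i.1 * c' i.2) => g.
rewrite hc hc' big_distrlr pair_big /=.
by apply: eq_bigr => i _; rewrite mulrACA.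
Qed.

Lemma KfiniteJ f : Kfinite f -> Kfinite (fun g => (f g)^*%R).
Proof.
move=> [n [e H]]; exists n, (fun i g => (e i g)^*%R) => h Kh.
have [c hc] := H h Kh; exists (fun i => (c i)^*%R) => g.
by rewrite hc rmorph_sum; apply: eq_bigr => i _; rewrite rmorphM.
Qed.

Lemma Kfinite_vc i : Kfinite (vc (R := R) i).
Proof.
exists 3%N, (@vc R) => h _; exists (fun j => (h^-1%g : 'M[C]_3) i j) => g.
exact: vcM.
Qed.

Lemma Kmx_entries (U : 'M[C]_2) :
  [/\ Kmx U 0 2 = 0, Kmx U 1 2 = 0, Kmx U 2 0 = 0, Kmx U 2 1 = 0 & Kmx U 2 2 = (\det U)^-1] /\
  [/\ Kmx U 0 0 = U 0 0, Kmx U 0 1 = U 0 1, Kmx U 1 0 = U 1 0 & Kmx U 1 1 = U 1 1].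
Proof.
have b1 (i : 'I_2) (j : 'I_1) : Kmx U (lshift 1 i) (rshift 2 j) = 0.
  by apply: etrans (block_mxEur U 0 0 (\det U)^-1%:M i j) _; rewrite mxE.
have b2 (i : 'I_2) (j : 'I_1) : Kmx U (rshift 2 j) (lshift 1 i) = 0.
  by apply: etrans (block_mxEdl U 0 0 (\det U)^-1%:M j i) _; rewrite mxE.
have b3 (i j : 'I_2) : Kmx U (lshift 1 i) (lshift 1 j) = U i j.
  by apply: etrans (block_mxEul U 0 0 (\det U)^-1%:M i j) _ => //.
have b4 (i j : 'I_1) : Kmx U (rshift 2 i) (rshift 2 j) = (\det U)^-1.
  by apply: etrans (block_mxEdr U 0 0 (\det U)^-1%:M i j) _; rewrite mxE !ord1 eqxx.
split; split.
- by rewrite -(b1 0 0); congr (Kmx U _ _); apply: val_inj.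
- by rewrite -(b1 1 0); congr (Kmx U _ _); apply: val_inj.
- by rewrite -(b2 0 0); congr (Kmx U _ _); apply: val_inj.
- by rewrite -(b2 1 0); congr (Kmx U _ _); apply: val_inj.
- by rewrite -(b4 0 0); congr (Kmx U _ _); apply: val_inj.
- by rewrite -(b3 0 0); congr (Kmx U _ _); apply: val_inj.
- by rewrite -(b3 0 1); congr (Kmx U _ _); apply: val_inj.
- by rewrite -(b3 1 0); congr (Kmx U _ _); apply: val_inj.
- by rewrite -(b3 1 1); congr (Kmx U _ _); apply: val_inj.
Qed.

Lemma SU21_invE (h : G) i j :
  (h^-1%g : 'M[C]_3) i j = eps R i * eps R j * ((h : 'M[C]_3) j i)^*%R.
Proof.
rewrite /= /SU21_inv_mx mxE (bigD1 j) //= big1 ?addr0 => [|p pj]; last by rewrite JE (negPf pj) !mulr0.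
rewrite mxE (bigD1 i) //= big1 ?addr0 => [|p pi]; last by rewrite JE [i == p]eq_sym (negPf pi) mulr0 mul0r.
by rewrite !JE !eqxx !mulr1 !mxE -/(eps R i) -/(eps R j); ring.
Qed.

(** Elements of the compact subgroup are block diagonal, so they only rescale
[v2]. *)
Lemma Kfinite_vc2V : Kfinite (fun g : G => (vc 2 g)^-1).
Proof.
exists 1%N, (fun _ g => (vc 2 g)^-1) => h Kh.
exists (fun=> ((h^-1%g : 'M[C]_3) 2 2)^-1) => g.
rewrite big_ord_recl big_ord0 addr0 vcM big3.
have [h02 h12] : (h : 'M[C]_3) 0 2 = 0 /\ (h : 'M[C]_3) 1 2 = 0.
  by case: Kh => U _ ->; have [[? ?]] := Kmx_entries U.
have z j : j != 2 -> (h^-1%g : 'M[C]_3) 2 j = 0.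
  by move: j; apply: ord3P => //; rewrite SU21_invE ?h02 ?h12 conjC0 mulr0.
by rewrite (z 0) // (z 1) // !mul0r !add0r invfM.
Qed.

(** The two analytic conditions in the induced representation; the third
condition, homogeneity, is checked separately because sums and products treat
it differently. *)
Definition nice f := regular f /\ Kfinite f.

Lemma nice_cst z : nice (fun=> z).
Proof. by split; [apply: regular_cst | apply: Kfinite_cst]. Qed.
Lemma niceD f1 f2 : nice f1 -> nice f2 -> nice (fun g => f1 g + f2 g).
Proof. by move=> [? ?] [? ?]; split; [apply: regularD | apply: KfiniteD]. Qed.
Lemma niceM f1 f2 : nice f1 -> nice f2 -> nice (fun g => f1 g * f2 g).
Proof. by move=> [? ?] [? ?]; split; [apply: regularM | apply: KfiniteM]. Qed.
Lemma niceJ f : nice f -> nice (fun g => (f g)^*%R).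
Proof. by move=> [? ?]; split; [apply: regularJ | apply: KfiniteJ]. Qed.
Lemma nice_vc i : nice (vc i).
Proof. by split; [apply: regular_vc | apply: Kfinite_vc]. Qed.
Lemma nice_vc2V : nice (fun g => (vc 2 g)^-1).
Proof. by split; [apply: regular_vc2V | apply: Kfinite_vc2V]. Qed.

Lemma nice_sum I (r : seq I) (P : pred I) (f : I -> G -> C) :
  (forall i, P i -> nice (f i)) -> nice (fun g => \sum_(i <- r | P i) f i g).
Proof.
move=> fP; elim: r => [|i r IH].
  have -> : (fun g => \sum_(i <- [::] | P i) f i g) = fun=> 0 by apply/funext => g; rewrite big_nil.
  exact: nice_cst.
have -> : (fun g => \sum_(j <- i :: r | P j) f j g) = fun g => (if P i then f i g else 0) + \sum_(i <- r | P i) f i g.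
  by apply/funext => g; rewrite big_cons; case: ifP; rewrite ?add0r.
by apply: niceD => //; case Pi: (P i); [exact: fP | exact: nice_cst].
Qed.

Definition nicep F := forall m, nice (fun g => mcoeff m (F g)).

Lemma nicep_cst p : nicep (fun=> p).
Proof. by move=> m; apply: nice_cst. Qed.

Lemma nicepC f : nice f -> nicep (fun g => pc (f g)).
Proof.
move=> nf m; have -> : (fun g => mcoeff m (pc (f g))) = fun g => f g * (m == mnm0)%:R.
  by apply/funext => g; rewrite mcoeffC.
by apply: niceM => //; apply: nice_cst.
Qed.

Lemma nicepD F1 F2 : nicep F1 -> nicep F2 -> nicep (fun g => F1 g + F2 g).
Proof.
move=> n1 n2 m; have -> : (fun g => mcoeff m (F1 g + F2 g)) = (fun g => mcoeff m (F1 g) + mcoeff m (F2 g)) by (apply/funext => g; rewrite mcoeffD).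
exact: niceD.
Qed.

Lemma nicepM F1 F2 : nicep F1 -> nicep F2 -> nicep (fun g => F1 g * F2 g).
Proof.
move=> n1 n2 m; have -> : (fun g => mcoeff m (F1 g * F2 g)) = (fun g => \sum_(k : bmultinom 3 (mdeg m).+1 * bmultinom 3 (mdeg m).+1 | m == mnm_add k.1 k.2) mcoeff k.1 (F1 g) * mcoeff k.2 (F2 g)).
  by apply/funext => g; rewrite mcoeffM.
by apply: nice_sum => i _; apply: niceM.
Qed.

Lemma nicepN F : nicep F -> nicep (fun g => - F g).
Proof.
move=> n; have -> : (fun g => - F g) = (fun g => -1 * F g) by apply/funext => g; rewrite mulN1r.
by apply: nicepM => //; apply: nicep_cst.
Qed.

Lemma nicepX F n : nicep F -> nicep (fun g => F g ^+ n).
Proof.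
move=> nF; elim: n => [|n IH]; first exact: nicep_cst.
have -> : (fun g => F g ^+ n.+1) = (fun g => F g * F g ^+ n) by apply/funext => g; rewrite exprS.
exact: nicepM.
Qed.

Lemma nicep_Sk k j : nicep (Sk k j).
Proof.
apply: nicepM; last first.
  apply: nicepX; apply: nicepD; last apply: nicepN; apply: nicepM; try exact: nicep_cst;
  by apply: nicepC; apply: niceJ; apply: nice_vc.
apply: nicepM; apply: nicepX; apply: nicepC; first exact: nice_vc2V.
have := niceJ nice_vc2V.
by have -> : (fun g : G => ((vc 2 g)^-1)^*%R) = (fun g => ((vc 2 g)^*%R)^-1) by apply/funext => g; rewrite fmorphV.
Qed.

End Nice.

(** * The Borel subgroup as the stabiliser of an isotropic line *)

Section Borel.
Variable R : realType.
Local Notation C := R[i].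
Local Notation Re := (@complex.Re R).
Local Notation Im := (@complex.Im R).
Local Notation G := (SU21 R).

Lemma expiD (a b : R) : expi (a + b) = expi a * expi b.
Proof. by apply: complexP; rewrite ?ReM ?ImM /= ?cosD ?sinD; ring. Qed.

Lemma expi0 : expi (0 : R) = 1.
Proof. by rewrite /expi cos0 sin0. Qed.

Lemma expiJ (a : R) : (expi a)^*%R = expi (- a).
Proof. by apply: complexP; rewrite /= ?cosN ?sinN. Qed.

Lemma expiVJ (a : R) : expi a * (expi a)^*%R = 1.
Proof. by rewrite expiJ -expiD subrr expi0. Qed.

Lemma expi_neq0 (a : R) : expi a != 0.
Proof. by apply/eqP => e0; have := expiVJ a; rewrite e0 mul0r => /eqP; rewrite eq_sym oner_eq0. Qed.

Lemma expiN (a : R) : expi (- a) = (expi a)^-1.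
Proof. by apply: (mulfI (expi_neq0 a)); rewrite mulfV ?expi_neq0 // -expiJ expiVJ. Qed.

Lemma expiMn (a : R) n : expi (a *+ n) = expi a ^+ n.
Proof. by elim: n => [|n IH]; rewrite ?mulr0n ?expr0 ?expi0 // mulrSr expiD IH exprSr. Qed.

(** Arc cosine covers the upper half circle; the sign of [y] decides between
[acos x] and its opposite. *)
Lemma expi_surj (x y : R) : x ^+ 2 + y ^+ 2 = 1 ->
  exists2 t, - pi < t <= pi & expi t = x +i* y.
Proof.
move=> xy1; have x1 : -1 <= x <= 1.
  by have := sqr_ge0 y; move: xy1; rewrite !expr2 => xy1 y2; apply/andP; split; nra.
have x1i : x \in `[-1, 1] by rewrite in_itv.
have s2 : Num.sqrt (1 - x ^+ 2) = `|y|.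
  by rewrite -xy1 addrC addKr sqrtr_sqr.
have [y0|y0] := leP 0 y.
  exists (acos x).
    by rewrite acos_lepi // andbT (lt_le_trans _ (acos_ge0 _)) // oppr_lt0 pi_gt0.
  by rewrite /expi acosK // sin_acos // s2 ger0_norm.
exists (- acos x).
  rewrite ltrN2 lt_neqAle acos_lepi // andbT; apply/andP; split.
    apply/eqP => e; have := acosK x1i; rewrite e cospi => xE.
    by move: xy1; rewrite -xE sqrrN expr1n => /eqP; rewrite addrC -subr_eq0 addrK sqrf_eq0 lt_eqF.
  by rewrite (le_trans _ (pi_ge0 R)) // oppr_le0 acos_ge0.
by rewrite /expi cosN sinN acosK // sin_acos // s2 ltr0_norm // opprK.
Qed.

Lemma polar (z : C) : z != 0 -> exists r t : R,
  [/\ 0 < r, - pi < t <= pi & z = r%:C * expi t].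
Proof.
move=> z0; pose r := Num.sqrt (Re z ^+ 2 + Im z ^+ 2).
have n0 : 0 < Re z ^+ 2 + Im z ^+ 2.
  rewrite lt_def addr_ge0 ?sqr_ge0 // andbT paddr_eq0 ?sqr_ge0 // !sqrf_eq0.
  by apply/negP => /andP[/eqP a /eqP b]; case/eqP: z0; apply: complexP.
have r0 : 0 < r by rewrite sqrtr_gt0.
have rr : r ^+ 2 = Re z ^+ 2 + Im z ^+ 2 by rewrite sqr_sqrtr // ltW.
have [t tI te] : exists2 t, - pi < t <= pi & expi t = (Re z / r) +i* (Im z / r).
  apply: expi_surj; rewrite !exprMn -mulrDl -rr -exprMn divff ?expr1n //.
  by rewrite lt0r_neq0.
exists r, t; split=> //; rewrite te; apply: complexP; rewrite ?ReM ?ImM /=.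
  by field; rewrite lt0r_neq0.
by field; rewrite lt0r_neq0.
Qed.

Local Notation s := (rsqrt2 R).
Lemma rsqrt2_sqr : s * s = 2%:R^-1.
Proof.
rewrite /rsqrt2 -rmorphM /= -invfM -expr2 sqr_sqrtr ?ler0n // fmorphV /=.
by rewrite rmorph_nat.
Qed.
Lemma rsqrt2J : s^*%R = s.
Proof. by apply: complexP; rewrite /= ?oppr0. Qed.

Lemma gamE : [/\ gam R 0 0 = s, gam R 0 1 = 0 & gam R 0 2 = s] /\
  [/\ gam R 1 0 = 0, gam R 1 1 = 1 & gam R 1 2 = 0] /\
  [/\ gam R 2 0 = s, gam R 2 1 = 0 & gam R 2 2 = - s].
Proof. by do !split; rewrite mxE. Qed.

Lemma gam_sqr : gam R *m gam R = 1%:M.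
Proof.
have [[g00 g01 g02] [[g10 g11 g12] [g20 g21 g22]]] := gamE.
have s2 : s * s + s * s = 1 by rewrite rsqrt2_sqr; field.
apply/matrixP; do 2![apply: ord3P]; rewrite !mxE big3 ?(g00, g01, g02, g10, g11, g12, g20, g21, g22) /=
  ?(mulr0, mul0r, addr0, add0r, mulr1, mulrN, mulNr, opprK) ?s2 ?subrr //.
Qed.

Lemma invmx_gam : invmx (gam R) = gam R.
Proof.
have [u _] := mulmx1_unit gam_sqr.
by rewrite -[LHS]mulmx1 -gam_sqr mulmxA mulVmx // mul1mx.
Qed.

Lemma gam_v0 : gam R *m v0 R = (2%:R * s) *: delta_mx 0 0.
Proof.
have [[g00 g01 g02] [[g10 g11 g12] [g20 g21 g22]]] := gamE.
apply/matrixP => i j; rewrite ord1; move: i; apply: ord3P; rewrite !mxE big3 !mxE /=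
  ?(g00, g01, g02, g10, g11, g12, g20, g21, g22); ring.
Qed.

Definition e1v : 'cV[C]_3 := delta_mx 0 0.

Lemma gam_e1 : gam R *m e1v = s *: v0 R.
Proof.
have [[g00 g01 g02] [[g10 g11 g12] [g20 g21 g22]]] := gamE.
apply/matrixP => i j; rewrite ord1; move: i; apply: ord3P; rewrite !mxE big3 !mxE /=
  ?(g00, g01, g02, g10, g11, g12, g20, g21, g22); ring.
Qed.

Lemma TmxE (r t : R) i j : Tmx r t i j = (i == j)%:R *
  (if i == 0 then r%:C * expi t else if i == 1 then expi (- (t *+ 2)) else r^-1%:C * expi t).
Proof. by rewrite mxE; move: i j; do 2![apply: ord3P]; rewrite /= ?mul1r ?mul0r. Qed.

(** The first basis vector is fixed by unipotent upper triangular matrices and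
scaled by the torus, and [gam] exchanges it, up to a factor, with (1, 0, 1).
*)
Lemma borel_vc (b : G) r t n : Nmx n -> b = gam R *m (Tmx r t *m n) *m invmx (gam R) :> 'M[C]_3 ->
  forall g i, vc i (g * b)%g = r%:C * expi t * vc i g.
Proof.
move=> [_ nd nu] bE g i.
have ne1 : n *m e1v = e1v.
  apply/matrixP => p q; rewrite ord1 !mxE (bigD1 0) //= big1 ?addr0 => [|l l0]; last first.
    by rewrite mxE (negPf l0) mulr0.
  rewrite !mxE mulr1; have [->|p0] := eqVneq p 0; first by rewrite nd.
  by rewrite nu // lt0n.
have Te1 : Tmx r t *m e1v = (r%:C * expi t) *: e1v.
  apply/matrixP => p q; rewrite ord1 !mxE (bigD1 0) //= big1 ?addr0 => [|l l0]; last first.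
    by rewrite !mxE (negPf l0) mulr0.
  rewrite TmxE !mxE mulr1; case: (eqVneq p 0) => [_|_]; first by rewrite mul1r mulr1.
  by rewrite mul0r mulr0.
have bv : (b : 'M[C]_3) *m v0 R = (r%:C * expi t) *: v0 R.
  rewrite bE invmx_gam -!mulmxA gam_v0 -/e1v -!scalemxAr ne1 Te1 -scalemxAr gam_e1.
  rewrite !scalerA; congr (_ *: _).
  transitivity (r%:C * expi t * (2%:R * (s * s))); first by ring.
  by rewrite rsqrt2_sqr; field.
by rewrite /vc /= -mulmxA bv -scalemxAr mxE.
Qed.

(** The antidiagonal form, which is [J] seen through [gam]. *)
Definition J' : 'M[C]_3 := \matrix_(i, j) (i + j == 2 :> nat)%:R.

Lemma gamJ : (gam R) ^t* = gam R.
Proof.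
have [[g00 g01 g02] [[g10 g11 g12] [g20 g21 g22]]] := gamE.
apply/matrixP; do 2![apply: ord3P]; rewrite !mxE /= ?rmorphN ?rsqrt2J ?conjC0 ?conjC1 //.
by congr (- _); exact: rsqrt2J.
Qed.

Lemma gam_J_gam : gam R *m J R *m gam R = J'.
Proof.
have [[g00 g01 g02] [[g10 g11 g12] [g20 g21 g22]]] := gamE.
have s2 : s * s + s * s = 1 by rewrite rsqrt2_sqr; field.
have E i j : (gam R *m J R *m gam R) i j =
    gam R i 0 * gam R 0 j + gam R i 1 * gam R 1 j - gam R i 2 * gam R 2 j.
  by rewrite [LHS]mxE big3 ![(gam R *m J R) _ _]mxE !big3 !JE /=; ring.
apply/matrixP => i j; rewrite E [RHS]mxE; move: i j.
by do 2![apply: ord3P]; rewrite ?(g00, g01, g02, g10, g11, g12, g20, g21, g22) /=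
  ?(mulr0, mul0r, addr0, add0r, mulr1, mulrN, mulNr, opprK, subr0, oppr0) ?s2 ?subrr ?addNr.
Qed.

Lemma gam_J'_gam : gam R *m J' *m gam R = J R.
Proof.
by rewrite -gam_J_gam !mulmxA gam_sqr mul1mx -mulmxA gam_sqr mulmx1.
Qed.

Definition Tdiag (r t : R) (i : 'I_3) : C :=
  if i == 0 then r%:C * expi t else if i == 1 then expi (- (t *+ 2)) else r^-1%:C * expi t.

Lemma Tmx_mul (r t : R) (A : 'M[C]_3) i j : (Tmx r t *m A) i j = Tdiag r t i * A i j.
Proof.
rewrite mxE (bigD1 i) //= big1 ?addr0 => [|l li]; last by rewrite TmxE eq_sym (negPf li) !mul0r.
by rewrite TmxE eqxx mul1r.
Qed.

Lemma mul_Tmx (r t : R) (A : 'M[C]_3) i j : (A *m Tmx r t) i j = A i j * Tdiag r t j.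
Proof.
rewrite mxE (bigD1 j) //= big1 ?addr0 => [|l li]; last by rewrite TmxE (negPf li) !mul0r mulr0.
by rewrite TmxE eqxx mul1r.
Qed.

Lemma expi_mul3 (t : R) : expi t * (expi (- (t *+ 2)) * expi t) = 1.
Proof. by rewrite -!expiD -[RHS]expi0; congr expi; rewrite mulr2n; ring. Qed.

Lemma Tdiag_form (r t : R) : r != 0 ->
  [/\ (Tdiag r t 0)^*%R * Tdiag r t 2 = 1, (Tdiag r t 1)^*%R * Tdiag r t 1 = 1,
      (Tdiag r t 2)^*%R * Tdiag r t 0 = 1 & Tdiag r t 0 * (Tdiag r t 1 * Tdiag r t 2) = 1].
Proof.
move=> r0; have rV : r%:C * r^-1%:C = 1 :> C by rewrite -rmorphM /= divff.
have rJ (x : R) : (x%:C)^*%R = x%:C by apply: complexP; rewrite /= ?oppr0.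
rewrite /Tdiag /= !rmorphM /= !rJ; split.
- transitivity ((r%:C * r^-1%:C) * (expi t * (expi t)^*%R)); first by ring.
  by rewrite rV expiVJ mulr1.
- by rewrite mulrC expiVJ.
- transitivity ((r%:C * r^-1%:C) * (expi t * (expi t)^*%R)); first by ring.
  by rewrite rV expiVJ mulr1.
- transitivity ((r%:C * r^-1%:C) * (expi t * (expi (- (t *+ 2)) * expi t))); first by ring.
  by rewrite rV expi_mul3 mulr1.
Qed.

Lemma adjE m p (A : 'M[C]_(m, p)) i j : (A ^t*) i j = (A j i)^*%R.
Proof. by rewrite !mxE. Qed.

Lemma Tmx_J' (r t : R) : r != 0 -> (Tmx r t) ^t* *m J' *m Tmx r t = J'.
Proof.
move=> r0; have [d02 d11 d20 _] := Tdiag_form t r0.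
have E i j : ((Tmx r t) ^t* *m J' *m Tmx r t) i j = (Tdiag r t i)^*%R * Tdiag r t j * J' i j.
  rewrite mul_Tmx mxE (bigD1 i) //= big1 ?addr0 => [|l li].
    by rewrite adjE TmxE eqxx mul1r -/(Tdiag r t i) mulrAC.
  by rewrite adjE TmxE (negPf li) mul0r conjC0 mul0r.
apply/matrixP => i j; rewrite E; move: i j.
by do 2![apply: ord3P]; rewrite !mxE /= ?mulr0 ?mulr1.
Qed.

Lemma gam_Tmx_SU21 (r t : R) : r != 0 -> in_SU21 (gam R *m Tmx r t *m gam R).
Proof.
move=> r0; apply/andP; split; apply/eqP.
  rewrite !adjM gamJ.
  have alg (g t' j u : 'M[C]_3) : g *m (t' *m g) *m j *m (g *m u *m g) = g *m (t' *m (g *m j *m g) *m u) *m g.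
    by rewrite !mulmxA.
  by rewrite alg gam_J_gam Tmx_J' // gam_J'_gam.
rewrite !det_mulmx mulrAC -det_mulmx gam_sqr det1 mul1r det3 !TmxE /=.
have [_ _ _ d] := Tdiag_form t r0; rewrite -[RHS]d /Tdiag /=; ring.
Qed.

Lemma gam_form (h : G) : let H := gam R *m (h : 'M[C]_3) *m gam R in
  H ^t* *m J' *m H = J' /\ \det H = 1.
Proof.
have /andP[/eqP hJ /eqP hd] := SU21P h => H; split.
  rewrite /H !adjM gamJ.
  have alg (g t' j u : 'M[C]_3) : g *m (t' *m g) *m j *m (g *m u *m g) = g *m (t' *m (g *m j *m g) *m u) *m g.
    by rewrite !mulmxA.
  by rewrite alg gam_J'_gam hJ gam_J_gam.
by rewrite /H !det_mulmx hd mulr1 -det_mulmx gam_sqr det1.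
Qed.

Lemma J'_formE (H : 'M[C]_3) i j : (H ^t* *m J' *m H) i j =
  (H 0 i)^*%R * H 2 j + (H 1 i)^*%R * H 1 j + (H 2 i)^*%R * H 0 j.
Proof. by rewrite mxE big3 !mxE !big3 !mxE /=; ring. Qed.

(** The converse of [borel_vc]. Conjugated by [gam], the element has first
column [l e_1]; the antidiagonal form then forces it to be upper triangular
and expresses its diagonal through [l], so that a torus element can be split
off. *)
Lemma borel_stab (h : G) (l : C) : (forall i, vc i h = l * v0 R i 0) ->
  exists r t n, [/\ r != 0, Nmx n, l = r%:C * expi t & h = gam R *m (Tmx r t *m n) *m invmx (gam R) :> 'M[C]_3].
Proof.
move=> hv; have l0 : l != 0.
  by apply: contraNneq (vc2_neq0 h) => l0; rewrite hv l0 mul0r.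
have [r [t [r0 _ lE]]] := polar l0; have rn0 : r != 0 by rewrite lt0r_neq0.
have [H HE] : {H | H = gam R *m (h : 'M[C]_3) *m gam R} by exists (gam R *m (h : 'M[C]_3) *m gam R).
have [HJ Hd] := gam_form h; rewrite -HE in HJ Hd.
have He1 : H *m e1v = l *: e1v.
  rewrite HE -!mulmxA gam_e1 -scalemxAr.
  have -> : (h : 'M[C]_3) *m v0 R = l *: v0 R.
    by apply/matrixP => i j; rewrite ord1 [RHS]mxE -hv.
  rewrite -!scalemxAr gam_v0 !scalerA; congr (_ *: _).
  transitivity (l * (2%:R * (s * s))); first by ring.
  by rewrite rsqrt2_sqr; field.
have col0 i : H i 0 = l * (i == 0)%:R.
  have := congr1 (fun A : 'cV[C]_3 => A i 0) He1.
  rewrite !mxE (bigD1 0) //= big1 ?addr0 => [|p p0]; last by rewrite !mxE (negPf p0) mulr0.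
  by rewrite !mxE /= mulr1 andbT.
have F := J'_formE H; rewrite HJ in F.
have lJ0 : l^*%R != 0 by rewrite conjC_eq0.
have h00 : H 0 0 = l by rewrite col0 mulr1.
have h10 : H 1 0 = 0 by rewrite col0 mulr0.
have h20 : H 2 0 = 0 by rewrite col0 mulr0.
have h21 : H 2 1 = 0.
  have := F 0 1; rewrite h00 h10 h20 conjC0 !mul0r !addr0 mxE /= => /esym/eqP.
  by rewrite mulf_eq0 (negPf lJ0) => /eqP.
have h22 : l^*%R * H 2 2 = 1.
  by have := F 0 2; rewrite h00 h10 h20 conjC0 !mul0r !addr0 mxE.
have h11 : l * H 1 1 * H 2 2 = 1 by rewrite -Hd det3 h00 h10 h20 h21; ring.
have [d02 d11 d20 d] := Tdiag_form t rn0.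
have d0 : Tdiag r t 0 = l by rewrite lE.
have d2 : Tdiag r t 2 = H 2 2 by apply: (mulfI lJ0); rewrite h22 -d0 d02.
have d1 : Tdiag r t 1 = H 1 1.
  have h220 : H 2 2 != 0 by apply/eqP => z; move: h22; rewrite z mulr0 => /eqP; rewrite eq_sym oner_eq0.
  by apply: (mulIf h220); apply: (mulfI l0); rewrite [RHS]mulrA h11 -[RHS]d d0 d2.
have dn0 i : Tdiag r t i != 0.
  move: i; apply: ord3P; apply/eqP => z; move: d; rewrite z ?mul0r ?mulr0 => /eqP; by rewrite eq_sym oner_eq0.
(* The unipotent part. *)
pose n : 'M[C]_3 := \matrix_(i, j) ((Tdiag r t i)^-1 * H i j).
have Tn : Tmx r t *m n = H.
  by apply/matrixP => i j; rewrite Tmx_mul mxE mulVKf.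
have hE : h = gam R *m (Tmx r t *m n) *m invmx (gam R) :> 'M[C]_3.
  by rewrite Tn invmx_gam HE !mulmxA gam_sqr mul1mx -mulmxA gam_sqr mulmx1.
exists r, t, n; split=> //; split.
- have TT : Tmx r^-1 (- t) *m Tmx r t = 1%:M.
    apply/matrixP => i j; rewrite Tmx_mul TmxE -/(Tdiag r t i) mxE.
    case: eqVneq => [_|_]; last by rewrite mul0r mulr0.
    rewrite mul1r /Tdiag invrK; move: i; apply: ord3P => /=.
    + by rewrite mulrACA -rmorphM /= mulVf // mul1r expiN mulVf // expi_neq0.
    + by rewrite -expiD mulNrn opprK addrC addNr expi0.
    + by rewrite mulrACA -rmorphM /= divff // mul1r expiN mulVf // expi_neq0.
  have -> : gam R *m n *m invmx (gam R) = (gam R *m Tmx r^-1 (- t) *m gam R) *m h.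
    rewrite hE invmx_gam -[n in LHS]mul1mx -TT.
    by rewrite !mulmxA -[_ *m gam R *m gam R]mulmxA gam_sqr mulmx1.
  by apply: in_SU21_M; [apply: gam_Tmx_SU21; rewrite invr_eq0 | apply: SU21P].
- by apply: ord3P; rewrite mxE ?d0 ?d1 ?d2 -?h00 ?mulVf // -?d1 -?d2 ?h00.
- move=> i j ij; rewrite mxE.
  have -> : H i j = 0 by move: i j ij; do 2![apply: ord3P].
  by rewrite mulr0.
Qed.

End Borel.

(** * Homogeneous functions and Euler angles *)

Section Extension.
Variable R : realType.
Variable k : nat.
Local Notation C := R[i].
Local Notation PV := (mpoly 3 C).
Local Notation Re := (@complex.Re R).
Local Notation Im := (@complex.Im R).
Local Notation G := (SU21 R).

(** The inverse of the inducing character, in terms of the scalar by which the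
torus element acts on (1, 0, 1). *)
Definition wt (l : C) : C := (l^-1) ^+ k.+3 * (l^*%R) ^+ k.

Lemma realCJ (x : R) : (x%:C)^*%R = x%:C :> C.
Proof. by apply: complexP; rewrite /= ?oppr0. Qed.

Lemma wt_phi (r t : R) : r != 0 -> wt (r%:C * expi t) = (phi_inf k r t)^-1.
Proof.
move=> r0; have rC0 : r%:C != 0 :> C by rewrite fmorph_eq0.
rewrite /wt /phi_inf rmorphM /= realCJ expiJ expiN rmorphXn /= !exprVn !exprMn !exprVn.
have -> : (2 * k + 3 = k + k.+3)%N by rewrite mul2n -addnn -addnA addn3.
rewrite exprD.
have -> : r%:C ^+ k.+3 = r%:C ^+ 3 * r%:C ^+ k :> C by rewrite -exprD addnC addn3.
field.
by apply/and4P; split; rewrite ?expf_neq0 ?expi_neq0.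
Qed.

Definition homogeneous (f : G -> C) :=
  forall (g h : G) l, l != 0 -> (forall i, vc i h = l * vc i g) -> f h = wt l * f g.

Lemma nice_I_phi f : nice f -> homogeneous f -> I_phi k f.
Proof.
move=> [rf Kf] hf; split=> //; first exact: regular_smooth.
move=> g b r t n r0 Nn bE; rewrite -wt_phi //; apply: hf => [|i].
  by rewrite mulf_neq0 ?expi_neq0 // fmorph_eq0.
exact: borel_vc Nn bE _ _.
Qed.

(** Two elements with proportional vectors differ by right multiplication with
an element fixing the line of (1, 0, 1). *)
Lemma I_phi_homogeneous f : I_phi k f -> homogeneous f.
Proof.
move=> [_ ef _] g h l l0 hg.
have [r [t [n [r0 Nn lE bE]]]] : exists r t n, [/\ r != 0, Nmx n, l = r%:C * expi t &
    (g^-1 * h)%g = gam R *m (Tmx r t *m n) *m invmx (gam R) :> 'M[C]_3].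
  apply: borel_stab => i; rewrite vcM.
  under eq_bigr do rewrite hg mulrCA.
  rewrite -mulr_sumr -vcM mulVg; congr (_ * _).
  by rewrite /vc /= mul1mx.
have -> : h = (g * (g^-1 * h))%g by rewrite mulgA mulgV mul1g.
by rewrite (ef _ _ _ _ _ r0 Nn bE) lE wt_phi.
Qed.

Lemma adj_formE (A : 'M[C]_3) i j : (A ^t* *m J R *m A) i j =
  (A 0 i)^*%R * A 0 j + (A 1 i)^*%R * A 1 j - (A 2 i)^*%R * A 2 j.
Proof. by rewrite mxE big3 ![(A ^t* *m _) _ _]mxE !big3 !JE !adjE /=; ring. Qed.

Lemma Kmx_SU21 (U : 'M[C]_2) :
  (U 0 0)^*%R * U 0 0 + (U 1 0)^*%R * U 1 0 = 1 ->
  (U 0 0)^*%R * U 0 1 + (U 1 0)^*%R * U 1 1 = 0 ->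
  (U 0 1)^*%R * U 0 1 + (U 1 1)^*%R * U 1 1 = 1 ->
  (\det U)^*%R * \det U = 1 -> in_SU21 (Kmx U).
Proof.
move=> u00 u01 u11 d.
have [[k02 k12 k20 k21 k22] [k00 k01 k10 k11]] := Kmx_entries U.
have d0 : \det U != 0 by apply/eqP => z; move: d; rewrite z mulr0 => /eqP; rewrite eq_sym oner_eq0.
have u10 : (U 0 1)^*%R * U 0 0 + (U 1 1)^*%R * U 1 0 = 0.
  by have := congr1 Num.conj u01; rewrite rmorphD !rmorphM /= !conjCK conjC0 => <-; ring.
apply/andP; split; apply/eqP; last first.
  by rewrite det3 k00 k01 k02 k10 k11 k12 k20 k21 k22 det2; rewrite det2 in d0; field.
apply/matrixP => i j; rewrite adj_formE JE; move: i j.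
do 2![apply: ord3P]; rewrite ?(k00, k01, k02, k10, k11, k12, k20, k21, k22) ?conjC0
 ?(mul0r, mulr0, addr0, add0r, subr0) ?mulr1 ?u00 ?u01 ?u11 ?u10 ?subrr ?oppr0 //=.
by rewrite ?mul0r ?sub0r fmorphV -invfM d invr1 ?mulr1.
Qed.

Lemma det_euler z ph th ps : \det (eulermx z ph th ps : 'M[C]_2) = expi (- z).
Proof.
rewrite det2 !mxE /=.
have e1 : expi ((- z - ph - ps) / 2%:R) * expi ((- z + ph + ps) / 2%:R) = expi (- z) :> C.
  by rewrite -expiD; congr expi; field.
have e2 : expi ((- z + ph - ps) / 2%:R) * expi ((- z - ph + ps) / 2%:R) = expi (- z) :> C.
  by rewrite -expiD; congr expi; field.
transitivity ((expi ((- z - ph - ps) / 2%:R) * expi ((- z + ph + ps) / 2%:R)) * (cos (th / 2%:R) ^+ 2)%:C +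
   (expi ((- z + ph - ps) / 2%:R) * expi ((- z - ph + ps) / 2%:R)) * (sin (th / 2%:R) ^+ 2)%:C).
  by rewrite !rmorphXn /=; ring.
by rewrite e1 e2 -mulrDr -rmorphD /= cos2Dsin2 mulr1.
Qed.

Lemma euler_SU21 z ph th ps : in_SU21 (Kmx (eulermx z ph th ps : 'M[C]_2)).
Proof.
have cs : (cos (th / 2%:R))%:C * (cos (th / 2%:R))%:C + (sin (th / 2%:R))%:C * (sin (th / 2%:R))%:C = 1 :> C.
  by rewrite -!rmorphM -rmorphD /= -!expr2 cos2Dsin2.
apply: Kmx_SU21; rewrite ?det_euler; last by rewrite mulrC expiVJ.
all: rewrite !mxE /= ?rmorphN ?rmorphM /= !realCJ.
all: set c := (cos _)%:C in cs *; set s := (sin _)%:C in cs *.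
- transitivity (c * c * (expi ((- z - ph - ps) / 2%:R) * (expi ((- z - ph - ps) / 2%:R))^*%R) +
     s * s * (expi ((- z - ph + ps) / 2%:R) * (expi ((- z - ph + ps) / 2%:R))^*%R)); first by ring.
  by rewrite !expiVJ !mulr1.
- rewrite !expiJ.
  transitivity (c * s * (expi (- ((- z - ph + ps) / 2%:R)) * expi ((- z + ph + ps) / 2%:R) -
     expi (- ((- z - ph - ps) / 2%:R)) * expi ((- z + ph - ps) / 2%:R))); first by ring.
  rewrite -!expiD [X in expi X](_ : _ = ph); last by field.
  by rewrite [X in _ - expi X](_ : _ = ph) ?subrr ?mulr0 //; field.
- transitivity (s * s * (expi ((- z + ph - ps) / 2%:R) * (expi ((- z + ph - ps) / 2%:R))^*%R) +
     c * c * (expi ((- z + ph + ps) / 2%:R) * (expi ((- z + ph + ps) / 2%:R))^*%R)); first by ring.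
  by rewrite !expiVJ !mulr1 addrC.
Qed.

(** The element of the compact subgroup with Euler angle [phi = 0]. Right
multiplication by the torus moves [phi], so nothing is lost for functions in
the induced representation. *)
Definition kap (z th ps : R) : G := MkSU21 (euler_SU21 z 0 th ps).

Lemma kapE z th ps :
  [/\ (kap z th ps : 'M[C]_3) 0 2 = 0, (kap z th ps : 'M[C]_3) 1 2 = 0,
      (kap z th ps : 'M[C]_3) 2 0 = 0, (kap z th ps : 'M[C]_3) 2 1 = 0 &
      (kap z th ps : 'M[C]_3) 2 2 = expi z] /\
  [/\ (kap z th ps : 'M[C]_3) 0 0 = expi ((- z - ps) / 2%:R) * (cos (th / 2%:R))%:C,
      (kap z th ps : 'M[C]_3) 0 1 = - (expi ((- z - ps) / 2%:R) * (sin (th / 2%:R))%:C),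
      (kap z th ps : 'M[C]_3) 1 0 = expi ((- z + ps) / 2%:R) * (sin (th / 2%:R))%:C &
      (kap z th ps : 'M[C]_3) 1 1 = expi ((- z + ps) / 2%:R) * (cos (th / 2%:R))%:C].
Proof.
have [[k02 k12 k20 k21 k22] [k00 k01 k10 k11]] := Kmx_entries (eulermx z 0 th ps : 'M[C]_2).
rewrite /= k02 k12 k20 k21 k22 k00 k01 k10 k11 det_euler expiN invrK; do !split => //;
  by rewrite mxE /= ?subr0 ?addr0.
Qed.

Local Opaque kap.

(** Scaling [v] to [v2 = 1], isotropy reads [`|v0|^2 + `|v1|^2 = 1]; the two
moduli are a cosine and a sine, and the two arguments determine the other
angles. *)
Lemma kap_rep (g : G) : vc 0 g != 0 -> vc 1 g != 0 -> exists z th ps l,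
  [/\ 0 < th < pi, - pi < ps <= pi, l != 0 & forall i, vc i g = l * vc i (kap z th ps)].
Proof.
move=> a0 b0; have c0 := vc2_neq0 g; have iso := vc_isotropic g.
(* [al] is the argument of [v0 / v2], and [al + be] that of [v1 / v2]. *)
have [r [al [r0 _ aE]]] := polar (mulf_neq0 a0 (invr_neq0 c0)).
have [q [be [q0 beI bE]]] : exists q be : R, [/\ 0 < q, - pi < be <= pi &
    vc 1 g / vc 2 g = q%:C * expi (al + be)].
  have ea := expi_neq0 al.
  have [q [be [q0 beI bE]]] := polar (mulf_neq0 (mulf_neq0 b0 (invr_neq0 c0)) (invr_neq0 ea)).
  exists q, be; split=> //; rewrite expiD.
  by rewrite [expi al * _]mulrC mulrA -bE mulfVK.
have rq1 : r ^+ 2 + q ^+ 2 = 1.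
  have : (r ^+ 2 + q ^+ 2)%:C = 1 :> C.
    have -> : (r ^+ 2 + q ^+ 2)%:C = (r%:C * expi al) * (r%:C * expi al)^*%R + (q%:C * expi (al + be)) * (q%:C * expi (al + be))^*%R.
      rewrite !rmorphM /= !realCJ rmorphD /= !rmorphXn /=.
      transitivity (r%:C * r%:C * (expi al * (expi al)^*%R) + q%:C * q%:C * (expi (al + be) * (expi (al + be))^*%R)); last by ring.
      by rewrite !expiVJ !mulr1 !expr2.
    rewrite -aE -bE !rmorphM /= !fmorphV.
    transitivity ((vc 0 g * (vc 0 g)^*%R + vc 1 g * (vc 1 g)^*%R) / (vc 2 g * (vc 2 g)^*%R)).
      by field; rewrite conjC_eq0 c0.
    by rewrite iso divff // mulf_neq0 // conjC_eq0.
  by move=> /(congr1 Re).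
have [t tI tE] := expi_surj rq1.
have tE' : cos t = r /\ sin t = q by case: tE.
have [ct st] := tE'.
have t0 : 0 < t.
  rewrite ltNge; apply/negP => tle; have : 0 <= sin (- t).
    by apply: sin_ge0_pi; rewrite oppr_ge0 tle /=; lra.
  by rewrite sinN st oppr_ge0 leNgt q0.
have t2 : t < pi / 2%:R.
  rewrite ltNge; apply/negP => tge; have : 0 <= sin (t - pi / 2%:R).
    by apply: sin_ge0_pi; have := pi_gt0 R; lra.
  by rewrite -oppr_le0 -cosDpihalf subrK ct leNgt r0.
(* The unknown [z] is found from the two arguments: [al = - 3 z / 2 - be / 2]. *)
exists (- (al + al + be) / 3%:R), (t *+ 2), be, (vc 2 g * expi ((al + al + be) / 3%:R)).
split=> //.
- by lra.
- by rewrite mulf_neq0 // expi_neq0.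
have [[k02 k12 k20 k21 k22] [k00 k01 k10 k11]] := kapE (- (al + al + be) / 3%:R) (t *+ 2) be.
have t2E : t *+ 2 / 2%:R = t by field.
rewrite t2E in k00 k10.
have key (x y z : C) (u v w : R) : x / vc 2 g = z * expi w -> u + v = w -> x = vc 2 g * expi u * (expi v * z).
  move=> xE uv; rewrite -uv expiD in xE.
  by rewrite -[LHS](divfK c0) xE; ring.
apply: ord3P; rewrite [vc _ (kap _ _ _)]vcE ?k02 ?k12 ?k20 ?k22 ?addr0 ?add0r.
- by rewrite k00 ct; apply: (key _ 0) aE _; field.
- by rewrite k10 st; apply: (key _ 0) bE _; field.
- by rewrite -mulrA -expiD [X in expi X](_ : _ = 0) ?expi0 ?mulr1 //; field.
Qed.

Lemma cderiv_expi (u : R -> R) t (u' : R) : is_derive t (1 : R) u u' ->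
  cderiv (fun s => expi (u s)) t ('i * u'%:C * expi (u t)).
Proof.
move=> du; split.
  rewrite (_ : Re _ = - sin (u t) * u'); first exact: (is_derive1_comp (is_derive_cos (u t)) du).
  by rewrite !ReM !ImM /=; ring.
rewrite (_ : Im _ = cos (u t) * u'); first exact: (is_derive1_comp (is_derive_sin (u t)) du).
by rewrite !ImM !ReM /=; ring.
Qed.

Lemma is_derive_lin (a b t : R) : is_derive t (1 : R) (fun s => (a + b * s) / 2%:R) (b / 2%:R).
Proof.
have h : is_derive t (1 : R) (fun s : R => (b / 2%:R) *: s + a / 2%:R) ((b / 2%:R) *: (1 : R) + 0).
  exact: is_deriveD.
rewrite (_ : (fun s => _) = (fun s : R => (b / 2%:R) *: s + a / 2%:R)).
  by move: h; rewrite /GRing.scale /= mulr1 addr0.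
by apply/funext => s; rewrite /GRing.scale /=; ring.
Qed.

Definition Xth : 'M[C]_3 := 2%:R^-1 *: (delta_mx 1 0 - delta_mx 0 1).
Definition dg (d : 'I_3 -> C) : 'M[C]_3 := \matrix_(i, j) ((i == j)%:R * d i).

Lemma dgE d i j : dg d i j = (i == j)%:R * d i. Proof. by rewrite mxE. Qed.

Lemma mul_dgE d (A : 'M[C]_3) i j : (dg d *m A) i j = d i * A i j.
Proof.
rewrite mxE (bigD1 i) //= big1 ?addr0 => [|l li]; first by rewrite dgE eqxx mul1r.
by rewrite dgE eq_sym (negPf li) !mul0r.
Qed.

(** The logarithmic derivatives of the rows of [kap (z0 + a s) th (p0 + b s)]
in [s]. *)
Definition torus_wt (a b : R) (i : 'I_3) : C :=
  'i%R * (if i == 0 then (- a - b) / 2%:R else if i == 1 then (- a + b) / 2%:R else a)%:C.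

Lemma is_derive_half (t : R) : is_derive t (1 : R) (fun s : R => s / 2%:R) (2%:R^-1).
Proof.
have := is_derive_lin 0 1 t; rewrite mul1r.
by rewrite (_ : (fun s => _) = (fun s : R => s / 2%:R)) //; apply/funext => s; rewrite add0r mul1r.
Qed.

Lemma kap_thE (s : R) :
  [/\ (kap 0 s 0 : 'M[C]_3) 0 2 = 0, (kap 0 s 0 : 'M[C]_3) 1 2 = 0, (kap 0 s 0 : 'M[C]_3) 2 0 = 0,
      (kap 0 s 0 : 'M[C]_3) 2 1 = 0 & (kap 0 s 0 : 'M[C]_3) 2 2 = 1] /\
  [/\ (kap 0 s 0 : 'M[C]_3) 0 0 = (cos (s / 2%:R))%:C, (kap 0 s 0 : 'M[C]_3) 0 1 = - (sin (s / 2%:R))%:C,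
      (kap 0 s 0 : 'M[C]_3) 1 0 = (sin (s / 2%:R))%:C & (kap 0 s 0 : 'M[C]_3) 1 1 = (cos (s / 2%:R))%:C].
Proof.
have [[k02 k12 k20 k21 k22] [k00 k01 k10 k11]] := kapE 0 s 0.
by rewrite k00 k01 k02 k10 k11 k12 k20 k21 k22 !(subr0, oppr0, addr0, mul0r, expi0, mul1r).
Qed.

(** Rotation in the plane of the first two coordinates, by half the angle. *)
Lemma kap_th t : mxderiv (fun s => kap 0 s 0 : 'M[C]_3) t (Xth *m kap 0 t 0).
Proof.
have [[z02 z12 _ _ _] [z00 z01 z10 z11]] := kap_thE t.
have X0 j : (Xth *m kap 0 t 0) 0 j = - (2%:R^-1 * (kap 0 t 0 : 'M[C]_3) 1 j).
  by rewrite mxE big3 !mxE /=; ring.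
have X1 j : (Xth *m kap 0 t 0) 1 j = 2%:R^-1 * (kap 0 t 0 : 'M[C]_3) 0 j.
  by rewrite mxE big3 !mxE /=; ring.
have X2 j : (Xth *m kap 0 t 0) 2 j = 0.
  by rewrite mxE big3 !mxE /=; ring.
have dc : is_derive t (1 : R) (fun s => cos (s / 2%:R)) (- sin (t / 2%:R) * 2%:R^-1).
  exact: (@is_derive1_comp R cos (fun s => s / 2%:R) t _ _ (is_derive_cos (t / 2%:R)) (is_derive_half t)).
have ds : is_derive t (1 : R) (fun s => sin (s / 2%:R)) (cos (t / 2%:R) * 2%:R^-1).
  exact: (@is_derive1_comp R sin (fun s => s / 2%:R) t _ _ (is_derive_sin (t / 2%:R)) (is_derive_half t)).
have h2 : (2%:R^-1)%:C = 2%:R^-1 :> C by rewrite fmorphV /= rmorph_nat.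
have dcC := cderiv_real dc; rewrite rmorphM rmorphN /= h2 in dcC.
have dsC := cderiv_real ds; rewrite rmorphM /= h2 in dsC.
have cst (f : R -> C) x : (forall s, f s = x) -> cderiv f t 0.
  by move=> fx; apply: (@eq_cderiv _ (fun=> x)) => [s|]; [rewrite fx | exact: cderiv_cst].
have e00 := X0 0; rewrite z10 mulrC -mulNr in e00.
have e01 := X0 1; rewrite z11 mulrC in e01.
have e02 := X0 2; rewrite z12 mulr0 oppr0 in e02.
have e10 := X1 0; rewrite z00 mulrC in e10.
have e11 := X1 1; rewrite z01 mulrC in e11.
have e12 := X1 2; rewrite z02 mulr0 in e12.
apply: ord3P; apply: ord3P.
- apply: (cderiv_eq (esym e00)); apply: (eq_cderiv _ dcC) => s.
  by have [_ [-> _ _ _]] := kap_thE s.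
- apply: (cderiv_eq (esym e01)); apply: (eq_cderiv _ (cderivN dsC)) => s.
  by have [_ [_ -> _ _]] := kap_thE s.
- by apply: (cderiv_eq (esym e02)); apply: cst => s; have [[-> _ _ _ _] _] := kap_thE s.
- apply: (cderiv_eq (esym e10)); apply: (eq_cderiv _ dsC) => s.
  by have [_ [_ _ -> _]] := kap_thE s.
- apply: (cderiv_eq (esym e11)); apply: (eq_cderiv _ dcC) => s.
  by have [_ [_ _ _ ->]] := kap_thE s.
- by apply: (cderiv_eq (esym e12)); apply: cst => s; have [[_ -> _ _ _] _] := kap_thE s.
- by apply: (cderiv_eq (esym (X2 0))); apply: cst => s; have [[_ _ -> _ _] _] := kap_thE s.
- by apply: (cderiv_eq (esym (X2 1))); apply: cst => s; have [[_ _ _ -> _] _] := kap_thE s.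
- by apply: (cderiv_eq (esym (X2 2))); apply: cst => s; have [[_ _ _ _ ->] _] := kap_thE s.
Qed.

Lemma cderiv_expi_lin (a b : R) (z : C) t :
  cderiv (fun s : R => expi ((a + b * s) / 2%:R) * z) t ((b / 2%:R)%:C * 'i * (expi ((a + b * t) / 2%:R) * z)).
Proof.
apply: cderiv_eq (cderivM (cderiv_expi (is_derive_lin a b t)) (cderiv_cst z t)).
by rewrite mulr0 addr0; ring.
Qed.

Lemma half_expi_deriv (f : R -> C) (a b w : R) (z : C) t :
  (forall s, f s = expi ((a + b * s) / 2%:R) * z) -> w = b / 2%:R -> cderiv f t ('i%R * w%:C * f t).
Proof.
move=> fE ->; rewrite [in X in cderiv _ _ X]fE [_ * (b / 2%:R)%:C]mulrC.
by apply: (eq_cderiv _ (cderiv_expi_lin a b z t)) => s; rewrite fE.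
Qed.

(** Each entry is an exponential times a constant; the frequencies are halves
because Euler angles enter by halves. *)
Lemma kap_torus z0 a p0 b th t :
  mxderiv (fun s => kap (z0 + a * s) th (p0 + b * s) : 'M[C]_3) t
    (dg (torus_wt a b) *m kap (z0 + a * t) th (p0 + b * t)).
Proof.
have E s := kapE (z0 + a * s) th (p0 + b * s).
move=> i j; apply: (cderiv_eq (esym (mul_dgE _ _ _ _))); move: i j.
apply: ord3P; apply: ord3P; rewrite /torus_wt /=.
- apply: (@half_expi_deriv _ (- z0 - p0) (- a - b)) => [s|//].
  by have [_ [-> _ _ _]] := E s; congr (expi (_ / _) * _); ring.
- apply: (@half_expi_deriv _ (- z0 - p0) (- a - b) _ (- (sin (th / 2%:R))%:C)) => [s|//].
  by have [_ [_ -> _ _]] := E s; rewrite mulrN; congr (- (expi (_ / _) * _)); ring.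
- apply: (@half_expi_deriv _ 0 (- a - b) _ 0) => [s|//].
  by rewrite mulr0; have [[-> _ _ _ _] _] := E s.
- apply: (@half_expi_deriv _ (- z0 + p0) (- a + b)) => [s|//].
  by have [_ [_ _ -> _]] := E s; congr (expi (_ / _) * _); ring.
- apply: (@half_expi_deriv _ (- z0 + p0) (- a + b)) => [s|//].
  by have [_ [_ _ _ ->]] := E s; congr (expi (_ / _) * _); ring.
- apply: (@half_expi_deriv _ 0 (- a + b) _ 0) => [s|//].
  by rewrite mulr0; have [[_ -> _ _ _] _] := E s.
- apply: (@half_expi_deriv _ 0 (2%:R * a) _ 0) => [s|]; last by field.
  by rewrite mulr0; have [[_ _ -> _ _] _] := E s.
- apply: (@half_expi_deriv _ 0 (2%:R * a) _ 0) => [s|]; last by field.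
  by rewrite mulr0; have [[_ _ _ -> _] _] := E s.
- apply: (@half_expi_deriv _ (2%:R * z0) (2%:R * a) _ 1) => [s|]; last by field.
  by have [[_ _ _ _ ->] _] := E s; rewrite mulr1; congr expi; field.
Qed.

Lemma kap0 : kap 0 0 0 = 1%g.
Proof.
apply: val_inj => /=; have [[k02 k12 k20 k21 k22] [k00 k01 k10 k11]] := kapE 0 0 0.
rewrite /= in k02 k12 k20 k21 k22 k00 k01 k10 k11.
rewrite !(subr0, oppr0, addr0, mul0r, cos0, sin0, expi0, mulr1, mulr0) in k22 k00 k01 k10 k11.
apply/matrixP => i j; rewrite [RHS]mxE; move: i j.
by do 2![apply: ord3P]; rewrite ?(k00, k01, k02, k10, k11, k12, k20, k21, k22) /=.
Qed.

Lemma half_range (t : R) : 0 < t < pi ->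
  - (pi / 2%:R) < t / 2%:R < pi / 2%:R /\ 0 < t / 2%:R < pi.
Proof. by have := pi_gt0 R; split; lra. Qed.

Lemma lim0_right (F : R -> R) : derivable F 0 1 -> (forall t, 0 < t < pi -> F t = 0) -> F 0 = 0.
Proof.
move=> dF F0; have cF : {for (0 : R), continuous F}.
  by apply: differentiable_continuous; apply/derivable1_diffP.
have [//|F0n] := eqVneq (F 0) 0; exfalso.
have nF : \forall x \near (0 : R), F x != 0.
  exact: (cF [set y | y != 0] (open_nbhs_nbhs (conj (@open_neq R 0) F0n))).
have /nbhs_ballP [e /= e0 eF] := nF.
pose t := Num.min (e / 2%:R) 1.
have t0 : 0 < t by rewrite lt_min divr_gt0 //= ltr01.
have te : t < e by rewrite gt_min; apply/orP; left; lra.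
have tp : t < pi.
  by rewrite gt_min; apply/orP; right; have := pi_ge2 R; lra.
have := eF t; rewrite /ball /= sub0r normrN ger0_norm ?ltW // => /(_ te).
by rewrite F0 ?eqxx // t0 tp.
Qed.

(** The angles cover the elements with [v0] and [v1] nonzero. Any other
element is moved into this set by a small rotation [kap 0 t 0] with [t > 0],
and continuity concludes. *)
Lemma I_phi_eq f1 f2 : I_phi k f1 -> I_phi k f2 ->
  (forall z th ps, 0 < th < pi -> - pi < ps <= pi -> f1 (kap z th ps) = f2 (kap z th ps)) ->
  f1 = f2.
Proof.
move=> If1 If2 f12; apply/funext => g.
have hf1 := I_phi_homogeneous If1; have hf2 := I_phi_homogeneous If2.
have gen h : vc 0 h != 0 -> vc 1 h != 0 -> f1 h = f2 h.
  move=> a0 b0; have [z [th [ps [l [thI psI l0 lE]]]]] := kap_rep a0 b0.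
  by rewrite (hf1 _ _ _ l0 lE) (hf2 _ _ _ l0 lE) f12.
have [|ab] := boolP ((vc 0 g != 0) && (vc 1 g != 0)); first by case/andP; apply: gen.
pose c t := (kap 0 t 0 * g)%g.
have c0 : c 0 = g by rewrite /c kap0 mul1g.
have dc := mxderivM (kap_th 0) (mxderiv_cst (g : 'M[C]_3) 0).
have [sf1 _ _] := If1; have [sf2 _ _] := If2.
have [D1 /(_ c 0 _ c0 dc) d1] := smooth_differential g sf1.
have [D2 /(_ c 0 _ c0 dc) d2] := smooth_differential g sf2.
have [df1 df2] := cderivD d1 (cderivN d2).
have fc t : 0 < t < pi -> f1 (c t) - f2 (c t) = 0.
  move=> tI; apply/eqP; rewrite subr_eq0; apply/eqP.
  have cn0 : (cos (t / 2%:R))%:C != 0 :> C.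
    by rewrite fmorph_eq0 gt_eqF // cos_gt0_pihalf //; case: (half_range tI).
  have sn0 : (sin (t / 2%:R))%:C != 0 :> C.
    by rewrite fmorph_eq0 gt_eqF // sin_gt0_pi //; case: (half_range tI).
  have [[k02 k12 k20 k21 k22] [k00 k01 k10 k11]] := kapE 0 t 0.
  have v0E : vc 0 (c t) = (cos (t / 2%:R))%:C * vc 0 g - (sin (t / 2%:R))%:C * vc 1 g.
    by rewrite vcM big3 k00 k01 k02 !(subr0, oppr0, mul0r, expi0, mul1r, addr0) mulNr.
  have v1E : vc 1 (c t) = (sin (t / 2%:R))%:C * vc 0 g + (cos (t / 2%:R))%:C * vc 1 g.
    by rewrite vcM big3 k10 k11 k12 !(subr0, oppr0, mul0r, expi0, mul1r, addr0).
  have ab0 : (vc 0 g == 0) && (vc 1 g == 0) = false.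
    apply/negP => /andP[/eqP a /eqP b]; have := vc_isotropic g.
    by rewrite a b !mul0r addr0 => /esym/eqP; rewrite mulf_eq0 conjC_eq0 (negPf (vc2_neq0 g)).
  move: ab ab0; rewrite negb_and !negbK; case: eqVneq => [a|a] /=.
    by move=> _ /negbT b0; apply: gen; rewrite ?v0E ?v1E a mulr0 ?sub0r ?add0r ?oppr_eq0 mulf_neq0.
  by move=> /eqP b _; apply: gen; rewrite ?v0E ?v1E b mulr0 ?subr0 ?addr0 mulf_neq0.
apply/eqP; rewrite -subr_eq0 -c0; apply/eqP/complexP.
  by apply: (@lim0_right (fun t => Re (f1 (c t) - f2 (c t)))) => [|t tI]; [apply: ex_derive | rewrite fc].
by apply: (@lim0_right (fun t => Im (f1 (c t) - f2 (c t)))) => [|t tI]; [apply: ex_derive | rewrite fc].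
Qed.

End Extension.

(** * Wigner functions of extremal weight *)

Section Wigner.
Variable R : realType.
Variable k : nat.
Local Notation C := R[i].
Local Notation PV := (mpoly 3 C).
Local Notation G := (SU21 R).

Definition wfun (J p q : nat) (g : G) : C :=
  (vc 2 g)^-1 ^+ k.+3 * ((vc 2 g)^*%R)^-1 ^+ J * ((- (vc 1 g)^*%R) ^+ p * ((vc 0 g)^*%R) ^+ q).

Lemma nice_exp (f : G -> C) n : nice f -> nice (fun g => f g ^+ n).
Proof.
move=> nf; elim: n => [|n IH]; first exact: nice_cst.
have -> : (fun g => f g ^+ n.+1) = (fun g => f g * f g ^+ n) by apply/funext => g; rewrite exprS.
exact: niceM.
Qed.

Lemma nice_wfun J p q : nice (wfun J p q).
Proof.
apply: niceM; apply: niceM; apply: nice_exp.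
- exact: nice_vc2V.
- have -> : (fun g : G => ((vc 2 g)^*%R)^-1) = (fun g => ((vc 2 g)^-1)^*%R).
    by apply/funext => g; rewrite fmorphV.
  exact: niceJ (nice_vc2V R).
- have -> : (fun g : G => - (vc 1 g)^*%R) = (fun g => -1 * (vc 1 g)^*%R).
    by apply/funext => g; rewrite mulN1r.
  by apply: niceM; [apply: nice_cst | apply: niceJ; apply: nice_vc].
- by apply: niceJ; apply: nice_vc.
Qed.

(** The [p + q] conjugated factors in the numerator exceed the [J] in the
denominator by [k]. *)
Lemma wfun_homogeneous J p q : (p + q = k + J)%N -> homogeneous k (wfun J p q).
Proof.
move=> pq g h l l0 hg; rewrite /wfun /wt !hg !rmorphM /=.
have lJ0 : l^*%R != 0 by rewrite conjC_eq0.
rewrite !invfM !exprMn -mulrN !exprMn.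
have vJ : (l^*%R) ^+ p * (l^*%R) ^+ q = (l^*%R) ^+ k * (l^*%R) ^+ J by rewrite -!exprD pq.
have vJ1 : (l^*%R)^-1 ^+ J * (l^*%R) ^+ J = 1 by rewrite -exprMn mulVf ?expr1n.
set A := l^-1 ^+ k.+3; set B := (l^*%R)^-1 ^+ J in vJ1 *; set D := (l^*%R) ^+ p in vJ *; set F := (l^*%R) ^+ q in vJ *.
set M := (l^*%R) ^+ k in vJ *; set N := (l^*%R) ^+ J in vJ vJ1.
set a := _^-1 ^+ k.+3; set b := _^-1 ^+ J; set c := (- _) ^+ p; set d := _ ^+ q.
transitivity (A * a * (B * b) * ((D * F) * (c * d))); first by ring.
rewrite vJ; transitivity ((B * N) * (A * M * (a * b * (c * d)))); first by ring.
by rewrite vJ1 mul1r.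
Qed.

(** For [m2 = j] the first binomial coefficient in the Jacobi sum has upper
entry 0, so only the last term survives, and [(cos th - 1) / 2 = - sin^2 (th /
2)] turns the function into a monomial in half-angle sine and cosine. *)
Lemma wigner_val_top (p q : nat) (n j m1 : R) z ph th ps : j = (p + q)%:R / 2%:R ->
  m1 = (q%:R - p%:R) / 2%:R -> 0 < th < pi ->
  wigner_val j n m1 j z ph th ps = (Num.sqrt 'C(p + q, q)%:R)%:C * expi (n * z) *
    expi (m1 * ps + j * ph) * ((-1) ^+ p * sin (th / 2%:R) ^+ p * cos (th / 2%:R) ^+ q)%:C.
Proof.
move=> jE m1E thI.
have e1 : j + m1 = q%:R by rewrite jE m1E natrD; field.
have e2 : j - m1 = p%:R by rewrite jE m1E natrD; field.
have e3 : j + j = (p + q)%:R by rewrite jE; field.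
have s0 : sin (th / 2%:R) != 0 by rewrite gt_eqF // sin_gt0_pi //; case: (half_range thI).
have fN0 (m : nat) : m`!%:R != 0 :> R by rewrite pnatr_eq0 -lt0n fact_gt0.
rewrite /wigner_val /wigner_c /wigner_d /jacobi.
have e4 : m1 - j = - (p%:R : R) by rewrite -e2 opprB.
have e5 : m1 + j = q%:R by rewrite addrC.
rewrite e1 e2 e3 e4 e5 subrr.
have tr0 : Num.truncn (0 : R) = 0%N by rewrite -[0 : R]/(0%:R) natrK.
rewrite !natrK tr0 fact0 muln1.
have fl1 : Num.floor (- p%:R : R) = - p%:Z.
  have -> : - p%:R = (- p%:Z)%:~R :> R by rewrite mulrNz.
  by rewrite intrKfloor.
have fl2 : Num.floor (q%:R : R) = q%:Z by rewrite -[q%:R]/((q%:Z)%:~R) intrKfloor.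
rewrite fl1 fl2.
(* Only the term [s = j - m1] of the Jacobi sum survives. *)
have binz s : (0 < s)%N -> binomR (0 : R) s = 0.
  by case: s => // s _; rewrite /binomR big_ord_recl subrr !mul0r.
have bin0 : binomR (0 : R) 0 = 1 by rewrite /binomR big_ord0 fact0 divr1.
rewrite big_ord_recr /= subrr subnn bin0 mul1r expr0 mulr1 big1 ?add0r; last first.
  by move=> i _; rewrite binz ?mul0r // subn_gt0.
have hb : binomR (p%:R + q%:R : R) p = (p + q)`!%:R / (p`!%:R * q`!%:R).
  rewrite /binomR -natrD.
  have -> : \prod_(i < p) ((p + q)%:R - i%:R : R) = ((p + q) ^_ p)%:R.
    rewrite ffact_prod natr_prod; apply: eq_bigr => i _.
    by rewrite natrB // (leq_trans (ltnW (ltn_ord i))) // leq_addr.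
  have /(congr1 (fun m => m%:R : R)) := ffact_fact (leq_addr q p).
  by rewrite addKn natrM => <-; field; rewrite !fN0.
rewrite hb.
have hc : (cos th - 1) / 2%:R = - sin (th / 2%:R) ^+ 2.
  have -> : cos th = cos (th / 2%:R) ^+ 2 *+ 2 - 1.
    by rewrite -cos_mulr2n; congr cos; field.
  by have := cos2Dsin2 (th / 2%:R); lra.
rewrite hc; set u := th / 2%:R in s0 *.
have sE : exprz (sin u) (- p%:Z) = (sin u ^+ p)^-1 by rewrite -exprnN.
have cE : exprz (cos u) q%:Z = cos u ^+ q by [].
rewrite sE cE.
have sqE : Num.sqrt (q`! * p`!)%:R * Num.sqrt (p + q)`!%:R = Num.sqrt 'C(p + q, q)%:R * (p`!%:R * q`!%:R) :> R.
  have /(congr1 (fun m => m%:R : R)) := bin_fact (leq_addl p q).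
  rewrite addnK !natrM => <-.
  have -> : q`!%:R * p`!%:R = (p`!%:R * q`!%:R : R) by rewrite mulrC.
  rewrite -sqrtrM ?mulr_ge0 ?ler0n //.
  have -> : p`!%:R * q`!%:R * ('C(p + q, q)%:R * (p`!%:R * q`!%:R)) = 'C(p + q, q)%:R * (p`!%:R * q`!%:R) ^+ 2 :> R by ring.
  by rewrite sqrtrM ?ler0n // sqrtr_sqr ger0_norm // mulr_ge0 ?ler0n.
have key (A B D D' : R) (x y : C) : A * D = B * D' -> A%:C * x * y * D%:C = B%:C * x * y * D'%:C.
  move=> h; transitivity ((A * D)%:C * x * y); first by rewrite rmorphM /=; ring.
  by rewrite h rmorphM /=; ring.
apply: key; rewrite sqE.
have -> : (- sin u ^+ 2) ^+ p = (-1) ^+ p * (sin u ^+ p * sin u ^+ p).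
  rewrite -[- sin u ^+ 2]mulN1r exprMn; congr (_ * _).
  by rewrite -exprM mul2n -addnn exprD.
have sp0 : sin u ^+ p != 0 by rewrite expf_neq0.
by field; rewrite !fN0 sp0.
Qed.

Lemma euler_vc z ph th ps (h : G) : h = Kmx (eulermx z ph th ps) :> 'M[C]_3 ->
  [/\ vc 0 h = expi ((- z - ph - ps) / 2%:R) * (cos (th / 2%:R))%:C,
      vc 1 h = expi ((- z - ph + ps) / 2%:R) * (sin (th / 2%:R))%:C & vc 2 h = expi z].
Proof.
move=> hE; have [[k02 k12 k20 k21 k22] [k00 k01 k10 k11]] := Kmx_entries (eulermx z ph th ps : 'M[C]_2).
by rewrite !vcE hE k00 k02 k10 k12 k20 k22 det_euler expiN invrK !addr0 add0r; split; rewrite // mxE.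
Qed.

Definition wcoef (p q : nat) : C := (Num.sqrt 'C(p + q, q)%:R)%:C.

(** [v = (e^(i(-z-ph-ps)/2) cos (th/2), e^(i(-z-ph+ps)/2) sin (th/2), e^(iz))]
at the matrix with these Euler angles, so both sides are the same monomial. *)
Lemma wfun_euler (J p q : nat) (n j m1 : R) z ph th ps (h : G) : (p + q = k + J)%N ->
  j = (p + q)%:R / 2%:R -> m1 = (q%:R - p%:R) / 2%:R ->
  n = J%:R - k.+3%:R + j -> 0 < th < pi ->
  h = Kmx (eulermx z ph th ps) :> 'M[C]_3 ->
  wcoef p q * wfun J p q h = wigner_val j n m1 j z ph th ps.
Proof.
move=> pq jE mE nE thI hE; have [v0E v1E v2E] := euler_vc hE.
rewrite (@wigner_val_top p q n j m1 z ph th ps jE mE thI) /wfun v0E v1E v2E.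
rewrite !rmorphM !rmorphXn /= rmorphN rmorph1 !realCJ !expiJ -!expiN opprK.
set S := (sin _)%:C; set K := (cos _)%:C.
have -> : expi (n * z) = expi (- z *+ k.+3) * expi (z *+ J) * expi (j * z).
  by rewrite -!expiD; congr expi; rewrite nE -[- z *+ _]mulr_natl -[z *+ _]mulr_natl; ring.
have eE : expi (m1 * ps + j * ph) * expi (j * z) = expi (- ((- z - ph + ps) / 2%:R) *+ p) * expi (- ((- z - ph - ps) / 2%:R) *+ q).
  by rewrite -!expiD; congr expi; rewrite jE mE natrD -[_ *+ p]mulr_natl -[_ *+ q]mulr_natl; field.
have NS x : (- (x * S)) ^+ p = (-1) ^+ p * (x ^+ p * S ^+ p) by rewrite -[- (x * S)]mulN1r !exprMn.
rewrite NS exprMn -!expiMn.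
transitivity (wcoef p q * (expi (- z *+ k.+3) * expi (z *+ J)) * (expi (- ((- z - ph + ps) / 2%:R) *+ p) * expi (- ((- z - ph - ps) / 2%:R) *+ q)) * ((-1) ^+ p * S ^+ p * K ^+ q)); first by ring.
by rewrite -eE /wcoef; ring.
Qed.

(** The right hand side has the prescribed values and lies in the induced
representation; uniqueness is [I_phi_eq]. *)
Lemma wigner_wfun (J p q : nat) (n j m1 m2 : R) : (p + q = k + J)%N ->
  j = (p + q)%:R / 2%:R -> m1 = (q%:R - p%:R) / 2%:R -> m2 = j ->
  n = J%:R - k.+3%:R + j ->
  wigner k j n m1 m2 = fun g => wcoef p q * wfun J p q g.
Proof.
move=> pq jE mE -> nE; apply: xget_unique.
  split.
    apply: nice_I_phi; first by apply: niceM; [apply: nice_cst | apply: nice_wfun].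
    by move=> g h l l0 hg; rewrite (wfun_homogeneous pq l0 hg) mulrCA.
  by move=> z ph th ps h _ thI _ hE; apply: wfun_euler.
move=> f [If fE]; apply: (I_phi_eq If).
  apply: nice_I_phi; first by apply: niceM; [apply: nice_cst | apply: nice_wfun].
  by move=> g h l l0 hg; rewrite (wfun_homogeneous pq l0 hg) mulrCA.
move=> z th ps thI psI.
have pi0 := pi_gt0 R.
rewrite (fE z 0 th ps) //; last 2 first.
- by rewrite oppr_lt0 pi0 ltW.
- by case/andP: psI => -> psI /=; rewrite (le_trans psI) //; lra.
by apply/esym/wfun_euler.
Qed.

End Wigner.

(** * Coordinates on the two summands of the Lie algebra *)

Section Identify.
Variable R : realType.
Variable k : nat.
Local Notation C := R[i].
Local Notation PV := (mpoly 3 C).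
Local Notation G := (SU21 R).
Local Notation P := (subvs_of (pC R)).

Lemma big4 (V : nmodType) (F : 'I_4 -> V) : \sum_i F i = F 0 + F 1 + F 2 + F 3.
Proof.
by rewrite !big_ord_recr big_ord0 /= add0r; congr (F _ + F _ + F _ + F _); apply: val_inj.
Qed.

Lemma XsE (a b c d : C) (M := a *: X1 R + b *: X2 R + c *: X3 R + d *: X4 R) :
  [/\ M 0 2 = a, M 1 2 = b, M 2 0 = c & M 2 1 = d] /\ in_p M.
Proof.
have E i j : M i j = a * ((i == 0) && (j == 2))%:R + b * ((i == 1) && (j == 2))%:R +
   c * ((i == 2) && (j == 0))%:R + d * ((i == 2) && (j == 1))%:R by rewrite !mxE.
by split; split; rewrite E /= !(mulr0, mulr1, addr0, add0r).
Qed.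

Lemma pcoordE (y : P) :
  [/\ vsval y 0 2 = pcoord y 0, vsval y 1 2 = pcoord y 1, vsval y 2 0 = pcoord y 2 &
      vsval y 2 1 = pcoord y 3] /\ in_p (vsval y).
Proof.
have /coord_span := subvsP y; rewrite big4 /= -!/(pcoord y _) => yE.
have := XsE (pcoord y 0) (pcoord y 1) (pcoord y 2) (pcoord y 3).
by rewrite -yE.
Qed.

Lemma pcoord_in_p (y : P) : in_p (vsval y). Proof. by case: (pcoordE y). Qed.

Lemma in_lD (X Y : 'M[C]_3) : in_l X -> in_l Y -> in_l (X + Y).
Proof.
have E (i j : 'I_3) : (X + Y) i j = X i j + Y i j by rewrite mxE.
move=> [a1 a2 a3 a4 a5] [b1 b2 b3 b4 b5]; split; rewrite !E.
- by rewrite a1 b1 addr0.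
- by rewrite a2 b2 addr0.
- by rewrite a3 b3 addr0.
- by rewrite a4 b4 addr0.
- by rewrite a5 b5 -opprD addrACA.
Qed.

Lemma in_lZ (a : C) (X : 'M[C]_3) : in_l X -> in_l (a *: X).
Proof.
have E (i j : 'I_3) : (a *: X) i j = a * X i j by rewrite mxE.
move=> [a1 a2 a3 a4 a5]; split; rewrite !E.
- by rewrite a1 mulr0.
- by rewrite a2 mulr0.
- by rewrite a3 mulr0.
- by rewrite a4 mulr0.
- by rewrite a5 -mulrDr mulrN.
Qed.

Lemma in_lN (X : 'M[C]_3) : in_l X -> in_l (- X).
Proof. by move=> h; rewrite -scaleN1r; apply: in_lZ. Qed.

Lemma in_l_E01 : in_l (Emx R 0 1).
Proof. by split; rewrite !mxE //= addr0 oppr0. Qed.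
Lemma in_l_E10 : in_l (Emx R 1 0).
Proof. by split; rewrite !mxE //= addr0 oppr0. Qed.

Lemma in_l_U0 : in_l (U0 R).
Proof.
apply: in_lZ; split; rewrite !mxE //=.
by rewrite mulr2n mulrDl mul1r.
Qed.
Lemma in_l_U3 : in_l (U3 R).
Proof. by apply: in_lZ; split; rewrite !mxE //= subrr oppr0. Qed.
Lemma in_l_U1 : in_l (U1 R).
Proof. apply: in_lZ; exact: in_lD in_l_E01 in_l_E10. Qed.
Lemma in_l_U2 : in_l (U2 R).
Proof. apply: in_lZ; exact: in_lD in_l_E01 (in_lN in_l_E10). Qed.

Lemma in_lP (U : 'M[C]_3) : U \in lC R -> in_l U.
Proof.
have lCE : lC R = <<[tuple U0 R; U1 R; U2 R; U3 R]>>%VS by [].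
rewrite lCE => /coord_span; rewrite big4 /= => ->; 
apply: in_lD; [apply: in_lD; [apply: in_lD|]|]; apply: in_lZ.
- exact: in_l_U0.
- exact: in_l_U1.
- exact: in_l_U2.
- exact: in_l_U3.
Qed.

Lemma raiseE : U1 R + 'i *: U2 R = 'i *: Emx R 0 1.
Proof.
rewrite /U1 /U2; have h : 'i * 2%:R^-1 + 'i * 2%:R^-1 = 'i :> C. by rewrite -splitr.
by rewrite !scalerDr !scalerN !scalerA addrACA subrr addr0 -scalerDl h.
Qed.

Lemma lowerE : U1 R - 'i *: U2 R = 'i *: Emx R 1 0.
Proof.
rewrite /U1 /U2; have h : 'i * 2%:R^-1 + 'i * 2%:R^-1 = 'i :> C. by rewrite -splitr.
by rewrite !scalerDr !scalerN !scalerA opprD opprK addrACA subrr add0r -scalerDl h.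
Qed.

End Identify.

(** * The sums of Wigner functions *)

Section Sums.
Variable R : realType.
Variable k : nat.
Local Notation C := R[i].
Local Notation PV := (mpoly 3 C).
Local Notation G := (SU21 R).
Local Notation P := (subvs_of (pC R)).

Lemma pcX (x : C) n : pc (x ^+ n) = pc x ^+ n.
Proof. by elim: n => [|n IH]; rewrite ?expr0 ?pc1 // !exprS pcM IH. Qed.

Lemma pc_monomial (c e a b x y : C) n J p q :
  pc (c * e * (a ^+ n * b ^+ J * (x ^+ p * y ^+ q))) =
  pc c * pc e * (pc a ^+ n * pc b ^+ J * (pc x ^+ p * pc y ^+ q)).
Proof. by rewrite 5!pcM !pcX. Qed.

(** The binomial theorem for the [k]-th power of [conj(v0) y - conj(v1) x],
the shifts [p0] and [q0] being common factors. *)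
Lemma wsum (J p0 q0 : nat) (c : C) (coef : nat -> R) (f : nat -> G -> C) :
  (forall l, (l <= k)%N ->
     f l = fun g => wcoef R (p0 + (k - l)) (q0 + l) * wfun k J (p0 + (k - l)) (q0 + l) g) ->
  (forall l, (l <= k)%N -> (coef l)%:C * wcoef R (p0 + (k - l)) (q0 + l) = c * 'C(k, l)%:R) ->
  \sum_(l < k.+1) (coef l)%:C *: tens (f l) (mon R k l) =
  fun g => (pc c * ((- vb 1 g) ^+ p0 * vb 0 g ^+ q0)) * Sk k J g.
Proof.
move=> fE cE; apply/funext => g; rewrite fct_sumE /Sk.
have -> : pL g = - vb 1 g * px R 0 + vb 0 g * px R 1 by rewrite /pL mulNr addrC.
rewrite exprDn !mulr_sumr; apply: eq_bigr => l _.
have lk : (l <= k)%N by rewrite -ltnS.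
have -> : ((coef l)%:C *: tens (f l) (mon R k l)) g = (coef l)%:C *: (f l g *: mon R k l) by [].
rewrite fE // scalerA mulrA cE // /wfun /mon -mul_mpolyC -/(pc _) pc_monomial !exprMn.
rewrite pcN -!/(ci g) -!/(cbi g) -!/(vb _ g) /px !(exprD _ p0, exprD _ q0).
have -> : pc ('C(k, l)%:R : C) = 'C(k, l)%:R :> PV by rewrite /pc mpolyC_nat.
rewrite -[X in _ = _ * (_ * X)]mulr_natl.
move: (pc c) ('C(k, l)%:R : PV) (ci g ^+ k.+3) (cbi g ^+ J) ((- vb 1 g) ^+ p0) (vb 0 g ^+ q0)
  ((- vb 1 g) ^+ (k - l)) (vb 0 g ^+ l) (mpolyX C (mnm1 0) ^+ (k - l)) (mpolyX C (mnm1 1) ^+ l).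
have alg (A : comRingType) (a b d e f1 h i j m n : A) :
  a * b * (d * e * (f1 * i * (h * j))) * (m * n) = a * (f1 * h) * (d * e * (b * (i * m * (j * n)))) by ring.
move=> *; exact: alg.
Qed.

(** From [(k+1-l) C(k+1, l) = (k+1) C(k, l)]. *)
Lemma gamma_coef l : (l <= k)%N -> (gamma R k l)%:C * wcoef R (1 + (k - l)) (0 + l) = 1 * 'C(k, l)%:R.
Proof.
move=> lk; rewrite /gamma /wcoef mul1r add0n.
have -> : (1 + (k - l) + l = k.+1)%N by rewrite -addnA subnK.
rewrite -rmorphM /= -!sqrtrM ?mulr_ge0 ?divr_ge0 //.
have -> : (k.+1 - l)%:R / k.+1%:R * 'C(k, l)%:R * 'C(k.+1, l)%:R = 'C(k, l)%:R ^+ 2 :> R.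
  have h : (k.+1 - l)%:R * 'C(k.+1, l)%:R = k.+1%:R * 'C(k, l)%:R :> R.
    by rewrite -!natrM -mul_bin_down.
  have alg (a b c d : R) : b != 0 -> a * d = b * c -> a / b * c * d = c ^+ 2.
    move=> b0 e; transitivity (a * d * (c / b)); first by field.
    by rewrite e; field.
  by apply: alg h; rewrite pnatr_eq0.
by rewrite sqrtr_sqr ger0_norm // rmorph_nat.
Qed.

Lemma beta_coef l : (l <= k)%N -> (beta R k l)%:C * wcoef R (0 + (k - l)) (0 + l) = 1 * 'C(k, l)%:R.
Proof.
move=> lk; rewrite /beta /wcoef mul1r !add0n subnK // -rmorphM /=.
by rewrite -expr2 sqr_sqrtr // rmorph_nat.
Qed.

(** From [(k+1-l) C(k+1, l) = (k+1) C(k, l)] and [(l+1) C(k+2, l+1) = (k+2)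
C(k+1, l)]. *)
Lemma alpha_coef l : (l <= k)%N ->
  (alpha R k l)%:C * wcoef R (1 + (k - l)) (1 + l) = (Num.sqrt k.+2%:R)%:C * 'C(k, l)%:R.
Proof.
move=> lk; rewrite /alpha /wcoef.
have -> : (1 + (k - l) + (1 + l) = k.+2)%N by rewrite addnACA subnK.
rewrite -[in RHS](rmorph_nat (real_complex R)) -!rmorphM /=; congr (_%:C).
set a := _ / _; have a0 : 0 <= a by rewrite divr_ge0.
rewrite -[a]ger0_norm // -sqrtr_sqr -!sqrtrM ?mulr_ge0 ?sqr_ge0 //.
have h1 : l.+1%:R * 'C(k.+2, l.+1)%:R = k.+2%:R * 'C(k.+1, l)%:R :> R.
  by rewrite -!natrM -mul_bin_diag.
have h2 : a * 'C(k.+1, l)%:R = 'C(k, l)%:R.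
  rewrite /a mulrAC addn1 -subSn // -natrM -(mul_bin_down k.+1 l) natrM /= mulrAC mulfV ?mul1r //.
have -> : a ^+ 2 * l.+1%:R * 'C(k.+1, l)%:R * 'C(k.+2, 1 + l)%:R = k.+2%:R * 'C(k, l)%:R ^+ 2.
  have alg (b x y z w d : R) : b * x = d -> y * z = w * x -> b ^+ 2 * y * x * z = w * d ^+ 2.
    move=> <- e; transitivity (b ^+ 2 * x * (y * z)); [by ring | by rewrite e; ring].
  exact: alg h2 h1.
by rewrite sqrtrM // sqrtr_sqr ger0_norm.
Qed.

Definition sk2 : C := (Num.sqrt k.+2%:R)%:C.

Lemma sk2_neq0 : sk2 != 0.
Proof. by rewrite /sk2 fmorph_eq0 sqrtr_eq0 -ltNge ltr0n. Qed.

Lemma chi3E : @chi3 R k = chiX k (X3 R).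
Proof.
rewrite /chi3 (@wsum 1 1 0 1); last exact: gamma_coef.
- apply/funext => g; rewrite /chiX /nf !mxE pc0 pc1 !mul0r mul1r sub0r expr0 expr1 mulr1 mul1r //.
- move=> l lk; have e : (1 + (k - l) + (0 + l) = k.+1)%N by rewrite addnACA subnK.
  have eB : (k - l)%:R = k%:R - l%:R :> R by rewrite natrB.
  have eS (n : nat) : n.+1%:R = 1 + n%:R :> R by rewrite -[n.+1]add1n natrD.
  have eD (m n : nat) : (m + n)%:R = m%:R + n%:R :> R by rewrite natrD.
  apply: wigner_wfun.
  + by rewrite e addnC.
  + by rewrite e /hf ?eS; field.
  + by rewrite /hf !eD eB; field.
  + by [].
  + by rewrite /hf !eS; field.
Qed.

Lemma psi0_X34 : \sum_(l < k.+1) (beta R k l)%:C *: tens (W0 k l) (mon R k l) = psi0X k (X3 R) (X4 R).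
Proof.
rewrite (@wsum 0 0 0 1); last exact: beta_coef.
- apply/funext => g; rewrite /psi0X !mxE /= !(pc0, pc1) !(mul0r, mul1r, mulr1, subr0) //.
- move=> l lk; have e : (0 + (k - l) + (0 + l) = k)%N by rewrite addnACA subnK.
  have eB : (k - l)%:R = k%:R - l%:R :> R by rewrite natrB.
  have eS (n : nat) : n.+1%:R = 1 + n%:R :> R by rewrite -[n.+1]add1n natrD.
  have eD (m n : nat) : (m + n)%:R = m%:R + n%:R :> R by rewrite natrD.
  apply: wigner_wfun.
  + by rewrite e addnC.
  + by rewrite e /hf ?eS; field.
  + by rewrite /hf !eD eB; field.
  + by [].
  + by rewrite /hf !eS; field.
Qed.

Lemma w13E : @w13 R k = fun g => sk2 *: psiX k (X1 R) (X3 R) g.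
Proof.
rewrite /w13 (@wsum 2 1 1 sk2); last exact: alpha_coef.
- apply/funext => g; rewrite /psiX /mf /nf !mxE /= pc0 pc1 !expr1 -mul_mpolyC -/(pc _).
  move: (pc sk2) (vb 1 g) (vb 0 g) (Sk k 2 g).
  have alg (A : comRingType) (a b c d : A) :
    a * (- b * c) * d = a * (((1 * c + 0 * b) * (0 * c - 1 * b) - (0 * c + 0 * b) * (0 * c - 0 * b)) * d) by ring.
  move=> *; exact: alg.
- move=> l lk; have e : (1 + (k - l) + (1 + l) = k.+2)%N by rewrite addnACA subnK.
  have eB : (k - l)%:R = k%:R - l%:R :> R by rewrite natrB.
  have eS (n : nat) : n.+1%:R = 1 + n%:R :> R by rewrite -[n.+1]add1n natrD.
  have eD (m n : nat) : (m + n)%:R = m%:R + n%:R :> R by rewrite natrD.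
  apply: wigner_wfun.
  + by rewrite e addnC.
  + by rewrite e /hf ?eS; field.
  + by rewrite /hf !eD eB; field.
  + by [].
  + by rewrite /hf !eS; field.
Qed.

End Sums.

(** * Linearity in the matrices *)

Section Structure.
Variable R : realType.
Variable k : nat.
Local Notation C := R[i].
Local Notation PV := (mpoly 3 C).
Local Notation G := (SU21 R).
Local Notation P := (subvs_of (pC R)).
Local Notation MF := (G -> PV).

Lemma fZE a (F : MF) g : (a *: F) g = a *: F g. Proof. by []. Qed.
Lemma fDE (F1 F2 : MF) g : (F1 + F2) g = F1 g + F2 g. Proof. by []. Qed.
Lemma fNE (F : MF) g : (- F) g = - F g. Proof. by []. Qed.

Lemma mod_l_val (A : 'M[C]_3) :
  vsval (mod_l A) = A 0 2 *: X1 R + A 1 2 *: X2 R + A 2 0 *: X3 R + A 2 1 *: X4 R.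
Proof.
rewrite vsprojK //; have XP (x : 'M[C]_3) a : x \in tval (Xs R) -> a *: x \in pC R.
  by move=> xX; apply: rpredZ; apply: memv_span.
apply: rpredD; [apply: rpredD; [apply: rpredD|]|]; apply: XP; by rewrite !inE eqxx ?orbT.
Qed.

Lemma mod_lE (A : 'M[C]_3) :
  [/\ vsval (mod_l A) 0 2 = A 0 2, vsval (mod_l A) 1 2 = A 1 2,
      vsval (mod_l A) 2 0 = A 2 0 & vsval (mod_l A) 2 1 = A 2 1].
Proof. by rewrite mod_l_val; case: (XsE (A 0 2) (A 1 2) (A 2 0) (A 2 1)). Qed.

(** A bracket of two elements of [p] is block diagonal. *)
Lemma mod_l0 (A B : 'M[C]_3) : in_p A -> in_p B -> mod_l (bracket A B) = 0.
Proof.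
move=> [a1 a2 a3 a4 a5] [b1 b2 b3 b4 b5]; apply: val_inj; rewrite /= mod_l_val.
have E i j : bracket A B i j = A i 0 * B 0 j + A i 1 * B 1 j + A i 2 * B 2 j
    - (B i 0 * A 0 j + B i 1 * A 1 j + B i 2 * A 2 j) by rewrite mxE [X in X + _]mxE big3 [X in _ + X]mxE mxE big3.
rewrite !E a1 a2 a3 a4 a5 b1 b2 b3 b4 b5 !(mul0r, mulr0, addr0, add0r, subr0, oppr0).
by rewrite !scale0r !addr0.
Qed.

(** The closed forms only see the four entries in [p], so they do not
distinguish a matrix from its projection [mod_l]. *)
Definition same_p (A B : 'M[C]_3) :=
  [/\ A 0 2 = B 0 2, A 1 2 = B 1 2, A 2 0 = B 2 0 & A 2 1 = B 2 1].

Lemma eq_chiX A B : same_p A B -> chiX k A = chiX k B.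
Proof. by case=> e1 e2 e3 e4; apply/funext => g; rewrite /chiX /nf e3 e4. Qed.
Lemma eq_psiX A B D E : same_p A B -> same_p D E -> psiX k A D = psiX k B E.
Proof. by case=> e1 e2 e3 e4 [f1 f2 f3 f4]; apply/funext => g; rewrite /psiX /mf /nf e1 e2 e3 e4 f1 f2 f3 f4. Qed.
Lemma eq_psi0X A B D E : same_p A B -> same_p D E -> psi0X k A D = psi0X k B E.
Proof. by case=> e1 e2 e3 e4 [f1 f2 f3 f4]; apply/funext => g; rewrite /psi0X e3 e4 f3 f4. Qed.

Lemma mxDZE (a : C) (A B : 'M[C]_3) i j : (a *: A + B) i j = a * A i j + B i j.
Proof. by rewrite !mxE. Qed.

Lemma chiX_lin a A B g : chiX k (a *: A + B) (g : G) = a *: chiX k A g + chiX k B g.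
Proof.
rewrite /chiX /nf !mxDZE !(pcD, pcM) -mul_mpolyC -/(pc a).
have alg (S : comRingType) (a' b c d e f g' h : S) :
  ((a' * b + c) * d - (a' * e + f) * g') * h = a' * ((b * d - e * g') * h) + (c * d - f * g') * h by ring.
exact: alg.
Qed.

Lemma chiX0 : chiX k 0 = 0 :> MF.
Proof.
apply/funext => g; rewrite /chiX /nf !mxE pc0.
have alg (A : comRingType) (a b e : A) : (0 * a - 0 * b) * e = 0 by ring.
exact: alg.
Qed.

Lemma chiX_Z a A (g : G) : chiX k (a *: A) g = a *: chiX k A g.
Proof. by rewrite -[a *: A]addr0 chiX_lin chiX0 addr0. Qed.

Lemma psiX_lin a A B D g : psiX k (a *: A + B) D (g : G) = a *: psiX k A D g + psiX k B D g.
Proof.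
rewrite /psiX /mf /nf !mxDZE !(pcD, pcM) -mul_mpolyC -/(pc a).
have alg (S : comRingType) (r x y a1 a2 a3 a4 b1 b2 b3 b4 m n h : S) :
  (((r * a1 + b1) * x + (r * a2 + b2) * y) * n - m * ((r * a4 + b4) * x - (r * a3 + b3) * y)) * h =
  r * (((a1 * x + a2 * y) * n - m * (a4 * x - a3 * y)) * h) +
  ((b1 * x + b2 * y) * n - m * (b4 * x - b3 * y)) * h by ring.
exact: alg.
Qed.

Lemma psi0X_lin a A B D g : psi0X k (a *: A + B) D (g : G) = a *: psi0X k A D g + psi0X k B D g.
Proof.
rewrite /psi0X !mxDZE !(pcD, pcM) -mul_mpolyC -/(pc a).
have alg (S : comRingType) (r a1 a2 b1 b2 d1 d2 h : S) :
  ((r * a1 + b1) * d2 - (r * a2 + b2) * d1) * h =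
  r * ((a1 * d2 - a2 * d1) * h) + (b1 * d2 - b2 * d1) * h by ring.
exact: alg.
Qed.

Lemma psiX_anti A B g : psiX k A B (g : G) = - psiX k B A g.
Proof.
have alg (S : comRingType) (x y s : S) : (x - y) * s = - ((y - x) * s) by ring.
exact: alg.
Qed.
Lemma psi0X_anti A B g : psi0X k A B (g : G) = - psi0X k B A g.
Proof.
have alg (S : comRingType) (a b c d s : S) : (a * b - c * d) * s = - ((d * c - b * a) * s) by ring.
exact: alg.
Qed.

Lemma psiX0 Z : psiX k 0 Z = 0 :> MF.
Proof.
apply/funext => g; rewrite /psiX /mf /nf !mxE pc0.
have alg (A : comRingType) (a b c d e : A) : ((0 * a + 0 * b) * c - d * (0 * a - 0 * b)) * e = 0 by ring.
exact: alg.
Qed.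

Lemma psiX_0 Z : psiX k Z 0 = 0 :> MF.
Proof. by apply/funext => g; rewrite psiX_anti psiX0 oppr0. Qed.

Lemma psiX_Z a A B (g : G) : psiX k (a *: A) B g = a *: psiX k A B g.
Proof. by rewrite -[a *: A]addr0 psiX_lin psiX0 addr0. Qed.

Lemma psiX_Zr a A B (g : G) : psiX k B (a *: A) g = a *: psiX k B A g.
Proof. by rewrite psiX_anti psiX_Z -scalerN (psiX_anti B). Qed.

Lemma brE01_1 : bracket ('i *: Emx R 0 1) (X1 R) = 0.
Proof. by rewrite /bracket /X1 /Emx -scalemxAl -scalemxAr !mul_delta_mx_cond /= !mulr0n !scaler0 subrr. Qed.
Lemma brE01_3 : bracket ('i *: Emx R 0 1) (X3 R) = - 'i *: X4 R.
Proof. by rewrite /bracket /X3 /X4 /Emx -scalemxAl -scalemxAr !mul_delta_mx_cond /= mulr0n mulr1n scaler0 sub0r scaleNr. Qed.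
Lemma brE10_1 : bracket ('i *: Emx R 1 0) (X1 R) = 'i *: X2 R.
Proof. by rewrite /bracket /X1 /X2 /Emx -scalemxAl -scalemxAr !mul_delta_mx_cond /= mulr0n mulr1n scaler0 subr0. Qed.
Lemma brE10_3 : bracket ('i *: Emx R 1 0) (X3 R) = 0.
Proof. by rewrite /bracket /X3 /Emx -scalemxAl -scalemxAr !mul_delta_mx_cond /= !mulr0n !scaler0 subrr. Qed.

Lemma in_p_X : [/\ in_p (X1 R), in_p (X2 R), in_p (X3 R) & in_p (X4 R)].
Proof. by split; split; rewrite !mxE. Qed.

Lemma ii : 'i * 'i = -1 :> C.
Proof. by rewrite -expr2 sqr_i. Qed.

Lemma chi4E : 'i *: actT k (U1 R + 'i *: U2 R) (chi3 k) = chiX k (X4 R).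
Proof.
have [p1 p2 p3 p4] := in_p_X.
rewrite chi3E raiseE chiX_equiv //; last by apply: in_lZ; exact: in_l_E01.
rewrite brE01_3; apply/funext => g; rewrite fZE chiX_Z.
by rewrite scalerA mulrN ii opprK scale1r.
Qed.

Lemma chiE Y : @chi R k Y = chiX k (vsval (Y 0)).
Proof.
rewrite /chi chi4E chi3E; have [[e1 e2 e3 e4] _] := pcoordE (Y 0).
apply/funext => g; rewrite fDE 2!fZE /chiX /nf e3 e4.
rewrite !mxE /= pc0 pc1 -!mul_mpolyC -!/(pc _).
have alg (S : comRingType) (a b x y s : S) :
  a * ((0 * x - 1 * y) * s) + b * ((1 * x - 0 * y) * s) = (b * x - a * y) * s by ring.
exact: alg.
Qed.

End Structure.

(** * Membership in the tensor product *)

Section Good.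
Variable R : realType.
Variable k : nat.
Local Notation C := R[i].
Local Notation PV := (mpoly 3 C).
Local Notation G := (SU21 R).
Local Notation P := (subvs_of (pC R)).
Local Notation MF := (G -> PV).

(** Sufficient conditions for an element of the tensor product on which the
action is complex linear: an explicit action, homogeneous values, nice
coefficients, and the right behaviour on isotropic vectors. *)
Definition good (F : MF) :=
  [/\ exists T, has_act F T, forall g, homog k (F g), nicep F &
      forall g h l, l != 0 -> (forall i, vc i h = l * vc i g) -> F h = wt k l *: F g].

Lemma good_IV F : good F -> IV k F.
Proof.
move=> [_ hF nF wF]; split=> // m; apply: nice_I_phi; first exact: nF.
by move=> g h l l0 hg; rewrite (wF _ _ _ l0 hg) mcoeffZ.
Qed.

Lemma act_scale c (F : MF) T : has_act F T -> has_act (c *: F) (fun X g => c *: T X g).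
Proof.
move=> aF; apply: (@eq_actF _ (fun g => (fun=> pc c) g * F g)) => [g|].
  by rewrite fZE /pc mul_mpolyC.
apply: eq_act (actM (act_pc c) aF) => X g.
by rewrite mul0r add0r /pc mul_mpolyC.
Qed.

Lemma actT_scale c F X : good F -> \tr X = 0 -> actT k X (c *: F) = c *: actT k X F.
Proof.
move=> [[T aF] hF _ _] tX; rewrite (actT_act aF) //.
by rewrite (actT_act (act_scale c aF)) // => g; rewrite fZE; apply: rpredZ; exact: hF.
Qed.

Lemma good_scale c F : good F -> good (c *: F).
Proof.
move=> [[T aF] hF nF wF]; split.
- by exists (fun X g => c *: T X g); apply: act_scale.
- by move=> g; rewrite fZE; apply: rpredZ; exact: hF.
- have -> : c *: F = fun g => (fun=> pc c) g * F g.
    by apply/funext => g; rewrite fZE /pc mul_mpolyC.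
  apply: nicepM => //; exact: nicep_cst.
- by move=> g h l l0 hg; rewrite !fZE (wF _ _ _ l0 hg) scalerA mulrC -scalerA.
Qed.

(** Each factor [conj v] in [q] compensates a factor [1 / conj v2] of [Sk]. *)
Lemma Sk_wt j (q : MF) g h l : l != 0 -> (forall i, vc i h = l * vc i g) ->
  q h = pc (l^*%R) ^+ j * q g -> q h * Sk k j h = wt k l *: (q g * Sk k j g).
Proof.
move=> l0 hg ->; have lJ0 : l^*%R != 0 by rewrite conjC_eq0.
have E1 : ci h = pc (l^-1) * ci g by rewrite /ci hg invfM pcM.
have E2 : cbi h = pc ((l^*%R)^-1) * cbi g by rewrite /cbi hg rmorphM /= invfM pcM.
have E3 i : vb i h = pc (l^*%R) * vb i g by rewrite /vb hg rmorphM /= pcM.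
have E4 : pc (wt k l) = pc (l^-1) ^+ k.+3 * pc (l^*%R) ^+ k by rewrite /wt pcM !pcX.
rewrite -mul_mpolyC -/(pc _) E4 /Sk /pL E1 E2 !E3.
have e : pc (l^*%R) * pc ((l^*%R)^-1) = 1 by rewrite -pcM mulfV // pc1.
have alg (A : comRingType) (lb lbi li c cb b0 b1 x y q' : A) n : lb * lbi = 1 ->
  lb ^+ j * q' * ((li * c) ^+ n * (lbi * cb) ^+ j * (lb * b0 * y - lb * b1 * x) ^+ k) =
  li ^+ n * lb ^+ k * (q' * (c ^+ n * cb ^+ j * (b0 * y - b1 * x) ^+ k)).
  move=> e1; have -> : lb * b0 * y - lb * b1 * x = lb * (b0 * y - b1 * x) by ring.
  rewrite !exprMn; have e2 : lb ^+ j * lbi ^+ j = 1 by rewrite -exprMn e1 expr1n.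
  transitivity ((lb ^+ j * lbi ^+ j) * (li ^+ n * lb ^+ k * (q' * (c ^+ n * cb ^+ j * (b0 * y - b1 * x) ^+ k)))).
    by ring.
  by rewrite e2 mul1r.
exact: alg e.
Qed.

Lemma nf_wt Y (g h : G) l : (forall i, vc i h = l * vc i g) -> nf Y h = pc (l^*%R) * nf Y g.
Proof.
move=> hg; rewrite /nf /vb !hg !rmorphM /= !pcM.
have alg (A : comRingType) (a b c d e : A) : a * (b * c) - d * (b * e) = b * (a * c - d * e) by ring.
exact: alg.
Qed.

Lemma mf_wt Y (g h : G) l : (forall i, vc i h = l * vc i g) -> mf Y h = pc (l^*%R) * mf Y g.
Proof.
move=> hg; rewrite /mf /vb !hg !rmorphM /= !pcM.
have alg (A : comRingType) (a b c d e : A) : a * (b * c) + d * (b * e) = b * (a * c + d * e) by ring.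
exact: alg.
Qed.

Lemma nicep_vb i : nicep (fun g : G => vb i g).
Proof. by apply: nicepC; apply: niceJ; apply: nice_vc. Qed.

Lemma nicep_nf Y : nicep (fun g : G => nf Y g).
Proof.
apply: nicepD; last apply: nicepN; apply: nicepM; try exact: nicep_cst; exact: nicep_vb.
Qed.

Lemma nicep_mf Y : nicep (fun g : G => mf Y g).
Proof.
apply: nicepD; apply: nicepM; try exact: nicep_cst; exact: nicep_vb.
Qed.

Lemma good_chiX Y : good (@chiX R k Y).
Proof.
split.
- have a := actM (act_nf Y) (act_Sk R k 1); by eexists; exact: a.
- by move=> g; apply: (homogM (nf_homog _ _) (Sk_homog _ _ _)).
- by apply: nicepM; [exact: nicep_nf | exact: nicep_Sk].
- move=> g h l l0 hg; apply: (Sk_wt (q := nf Y) l0 hg).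
  by rewrite expr1 (nf_wt Y hg).
Qed.

Lemma good_psiX Y Z : good (@psiX R k Y Z).
Proof.
have a := actD (actM (act_mf Y) (act_nf Z)) (actN (actM (act_mf Z) (act_nf Y))).
split.
- by eexists; exact: (actM a (act_Sk R k 2)).
- move=> g; apply: (@homogM _ 0 k); [|exact: Sk_homog|by []].
  by apply: rpredB; apply: (homogM (mf_homog _ _) (nf_homog _ _)).
- apply: nicepM; last exact: nicep_Sk.
  have nM A B : nicep (fun g : G => mf A g * nf B g).
    by apply: nicepM; [exact: nicep_mf | exact: nicep_nf].
  exact: nicepD (nM Y Z) (nicepN (nM Z Y)).
- move=> g h l l0 hg; apply: (Sk_wt (q := fun g => mf Y g * nf Z g - mf Z g * nf Y g) l0 hg).
  rewrite (nf_wt Y hg) (nf_wt Z hg) (mf_wt Y hg) (mf_wt Z hg) expr2.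
  have alg (A : comRingType) (a' b c d e : A) : a' * b * (a' * c) - a' * d * (a' * e) = a' * a' * (b * c - d * e) by ring.
  exact: alg.
Qed.

Lemma good_psi0X Y Z : good (@psi0X R k Y Z).
Proof.
have a := actD (actM (act_pc (Y 2 0)) (act_pc (Z 2 1))) (actN (actM (act_pc (Y 2 1)) (act_pc (Z 2 0)))).
split.
- by eexists; exact: (actM a (act_Sk R k 0)).
- move=> g; apply: (@homogM _ 0 k); [|exact: Sk_homog|by []].
  by apply: rpredB; apply: (homogM (pc_homog _) (pc_homog _)).
- apply: nicepM; last exact: nicep_Sk.
  exact: nicep_cst.
- move=> g h l l0 hg; apply: (Sk_wt (q := fun=> _) l0 hg).
  by rewrite expr0 mul1r.
Qed.

End Good.

(** * The cochains and their differentials *)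

Section Cochain.
Variable R : realType.
Variable k : nat.
Local Notation C := R[i].
Local Notation PV := (mpoly 3 C).
Local Notation G := (SU21 R).
Local Notation P := (subvs_of (pC R)).
Local Notation MF := (G -> PV).
Local Notation s := (sk2 R k).

Lemma big_pairs4 (V : nmodType) (F : 'I_4 -> 'I_4 -> V) :
  \sum_(i < 4) \sum_(j < 4 | (i < j)%N) F i j = F 0 1 + F 0 2 + F 0 3 + F 1 2 + F 1 3 + F 2 3.
Proof.
have E (i : 'I_4) : \sum_(j < 4 | (i < j)%N) F i j =
    (if (i < (0%R : 'I_4))%N then F i 0 else 0) + (if (i < (1%R : 'I_4))%N then F i 1 else 0) +
    (if (i < (2%R : 'I_4))%N then F i 2 else 0) + (if (i < (3%R : 'I_4))%N then F i 3 else 0).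
  by rewrite big_mkcond big4.
by rewrite big4 !E /= !(add0r, addr0) !addrA.
Qed.

Lemma w13X : @w13 R k = s *: psiX k (X1 R) (X3 R). Proof. exact: w13E. Qed.

Lemma w14X : @w14 R k = s *: psiX k (X1 R) (X4 R).
Proof.
have [p1 p2 p3 p4] := in_p_X R; have lE := in_lZ 'i (in_l_E01 R).
rewrite /w14 w13X raiseE actT_scale; [|exact: good_psiX|exact: in_l_tr].
rewrite (psiX_equiv k lE p1 p3) brE01_1 brE01_3 psiX0 add0r.
have -> : psiX k (X1 R) (- 'i *: X4 R) = - 'i *: psiX k (X1 R) (X4 R).
  by apply/funext => g; exact: psiX_Zr.
move: (psiX k (X1 R) (X4 R)) => F.
by rewrite !scalerA mulrN mulrAC ii mulN1r opprK.
Qed.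

Lemma w23X : @w23 R k = s *: psiX k (X2 R) (X3 R).
Proof.
have [p1 p2 p3 p4] := in_p_X R; have lE := in_lZ 'i (in_l_E10 R).
rewrite /w23 w13X lowerE actT_scale; [|exact: good_psiX|exact: in_l_tr].
rewrite (psiX_equiv k lE p1 p3) brE10_1 brE10_3 psiX_0 addr0.
have -> : psiX k ('i *: X2 R) (X3 R) = 'i *: psiX k (X2 R) (X3 R).
  by apply/funext => g; exact: psiX_Z.
move: (psiX k (X2 R) (X3 R)) => F.
by rewrite !scalerA mulrAC mulNr ii opprK mul1r.
Qed.

Lemma psiXe (A B : 'M[C]_3) a0 a1 a2 a3 b0 b1 b2 b3 (g : G) :
  [/\ A 0 2 = a0, A 1 2 = a1, A 2 0 = a2 & A 2 1 = a3] ->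
  [/\ B 0 2 = b0, B 1 2 = b1, B 2 0 = b2 & B 2 1 = b3] ->
  psiX k A B g = ((pc a0 * vb 0 g + pc a1 * vb 1 g) * (pc b3 * vb 0 g - pc b2 * vb 1 g) -
    (pc b0 * vb 0 g + pc b1 * vb 1 g) * (pc a3 * vb 0 g - pc a2 * vb 1 g)) * Sk k 2 g.
Proof. by case=> <- <- <- <- [<- <- <- <-]. Qed.

Lemma X_entries :
  [/\ [/\ X1 R 0 2 = 1, X1 R 1 2 = 0, X1 R 2 0 = 0 & X1 R 2 1 = 0],
      [/\ X2 R 0 2 = 0, X2 R 1 2 = 1, X2 R 2 0 = 0 & X2 R 2 1 = 0],
      [/\ X3 R 0 2 = 0, X3 R 1 2 = 0, X3 R 2 0 = 1 & X3 R 2 1 = 0] &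
      [/\ X4 R 0 2 = 0, X4 R 1 2 = 0, X4 R 2 0 = 0 & X4 R 2 1 = 1]].
Proof. by split; split; rewrite mxE. Qed.

Lemma psiX_basis (g : G) :
  [/\ psiX k (X1 R) (X3 R) g = - (vb 0 g * vb 1 g * Sk k 2 g),
      psiX k (X1 R) (X4 R) g = vb 0 g * vb 0 g * Sk k 2 g &
      psiX k (X2 R) (X3 R) g = - (vb 1 g * vb 1 g * Sk k 2 g)].
Proof.
have [x1 x2 x3 x4] := X_entries.
have alg (A : comRingType) (x y S : A) a0 a1 b2 b3 :
  ((a0 * x + a1 * y) * (b3 * x - b2 * y) - (0 * x + 0 * y) * (0 * x - 0 * y)) * S =
  (a0 * x + a1 * y) * (b3 * x - b2 * y) * S by ring.
have alg2 (A : comRingType) (x y S : A) :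
  [/\ (1 * x + 0 * y) * (0 * x - 1 * y) * S = - (x * y * S),
      (1 * x + 0 * y) * (1 * x - 0 * y) * S = x * x * S &
      (0 * x + 1 * y) * (0 * x - 1 * y) * S = - (y * y * S)] by split; ring.
have [r1 r2 r3] := alg2 _ (vb 0 g) (vb 1 g) (Sk k 2 g).
split.
- by rewrite (psiXe g x1 x3) pc0 pc1 -r1; exact: alg.
- by rewrite (psiXe g x1 x4) pc0 pc1 -r2; exact: alg.
- by rewrite (psiXe g x2 x3) pc0 pc1 -r3; exact: alg.
Qed.

Lemma psi_comb (c1 c2 c3 c4 t : C) (F1 F2 F3 : MF) g (p1 p2 p3 : PV) :
  F1 g = p1 -> F2 g = p2 -> F3 g = p3 ->
  (c1 *: (t *: F1) + c2 *: (t *: F2) + c3 *: (t *: F3) + c4 *: - (t *: F1)) g =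
  pc t * (pc c1 * p1 + pc c2 * p2 + pc c3 * p3 - pc c4 * p1).
Proof.
move=> <- <- <-; rewrite !fDE !fZE fNE fZE -!mul_mpolyC -!/(pc _).
move: (pc t) (pc c1) (pc c2) (pc c3) (pc c4) (F1 g) (F2 g) (F3 g).
have alg (A : comRingType) (u a b c d x y z : A) :
  a * (u * x) + b * (u * y) + c * (u * z) + d * - (u * x) = u * (a * x + b * y + c * z - d * x) by ring.
move=> *; exact: alg.
Qed.

Lemma pcB (x y : C) : pc (x - y) = pc x - pc y. Proof. by rewrite pcD pcN. Qed.

(** The bilinear form of [psiX] expanded on the basis of [p]. *)
Lemma psi_alg (A : comRingType) (a0 a1 a2 a3 b0 b1 b2 b3 x y t S : A) :
  t * ((a0 * b2 - a2 * b0) * - (x * y * S) + (a0 * b3 - a3 * b0) * (x * x * S) +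
       (a1 * b2 - a2 * b1) * - (y * y * S) - (a1 * b3 - a3 * b1) * - (x * y * S)) =
  t * (((a0 * x + a1 * y) * (b3 * x - b2 * y) - (b0 * x + b1 * y) * (a3 * x - a2 * y)) * S).
Proof. ring. Qed.

Lemma psiE Y : @psi R k Y = s *: psiX k (vsval (Y 0)) (vsval (Y 1)).
Proof.
rewrite /psi /alt2 big_pairs4 /= /w24 w13X w14X w23X !scaler0 add0r addr0.
have [e _] := pcoordE (Y 0); have [f _] := pcoordE (Y 1).
apply/funext => g; rewrite [RHS]fZE (psiXe g e f).
have [v13 v14 v23] := psiX_basis g.
by rewrite (psi_comb _ _ _ _ _ v13 v14 v23) -[s *: _]mul_mpolyC -/(pc s) !pcB !pcM; exact: psi_alg.
Qed.

Lemma psi0E Y : @psi0 R k Y = psi0X k (vsval (Y 0)) (vsval (Y 1)).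
Proof.
rewrite /psi0 /alt2 big_pairs4 /= psi0_X34 !scaler0 !add0r.
have [[e1 e2 e3 e4] _] := pcoordE (Y 0); have [[f1 f2 f3 f4] _] := pcoordE (Y 1).
apply/funext => g; have [_ _ [_ _ x1 x2] [_ _ x3 x4]] := X_entries.
rewrite !fZE /psi0X e3 e4 f3 f4 x1 x2 x3 x4 pc0 pc1.
rewrite -!mul_mpolyC -!/(pc _) !pcD !pcN !pcM.
have alg (A : comRingType) (a2 a3 b2 b3 S : A) :
  (a2 * b3 - a3 * b2) * ((1 * 1 - 0 * 0) * S) = (a2 * b3 - a3 * b2) * S by ring.
exact: alg.
Qed.

Lemma same_p_mod (A : 'M[C]_3) : same_p (vsval (mod_l A)) A.
Proof. by have [e1 e2 e3 e4] := mod_lE A; split. Qed.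

Lemma same_p_refl (A : 'M[C]_3) : same_p A A. Proof. by split. Qed.

Lemma scale_lin_comm (a b : C) (x y : PV) : a *: (b *: x + y) = b *: (a *: x) + a *: y.
Proof. by rewrite scalerDr !scalerA [a * b]mulrC. Qed.

Lemma cochain_chi a : cochain k (a *: @chi R k).
Proof.
have E Y : (a *: @chi R k) Y = a *: chiX k (vsval (Y 0)) by rewrite -chiE.
split.
- by move=> Y; rewrite E; apply: good_IV; apply: good_scale; exact: good_chiX.
- split=> [Y i b y z|Y i j]; last by rewrite !ord1 eqxx.
  rewrite !E ord1 /upd eqxx linearP /=; apply/funext => g.
  by rewrite fDE 4!fZE chiX_lin; exact: scale_lin_comm.
- move=> U /in_lP Ul Y; rewrite E actT_scale; [|exact: good_chiX|exact: in_l_tr].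
  rewrite big_ord1 E /upd eqxx (eq_chiX k (same_p_mod _)) chiX_equiv //.
  exact: pcoord_in_p.
Qed.

(** What makes the alternating map of [F] a cochain of degree two. It is
isolated so that it applies to all combinations of [psi] and [psi0] at once.
*)
Definition bilin (F : 'M[C]_3 -> 'M[C]_3 -> MF) :=
  [/\ forall A B, good k (F A B),
      forall a A B D g, F (a *: A + B) D g = a *: F A D g + F B D g,
      forall A B g, F A B g = - F B A g,
      forall A B D E, same_p A B -> same_p D E -> F A D = F B E &
      forall U Y Z, in_l U -> in_p Y -> in_p Z ->
        actT k U (F Y Z) = F (bracket U Y) Z + F Y (bracket U Z)].

Definition cochain2 (F : 'M[C]_3 -> 'M[C]_3 -> MF) (Y : 'I_2 -> P) : MF :=
  F (vsval (Y 0)) (vsval (Y 1)).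

Lemma ord2P (Q : 'I_2 -> Prop) : Q 0 -> Q 1 -> forall i, Q i.
Proof. by move=> Q0 Q1 [[|[|//]] p]; [move: Q0|move: Q1]; congr Q; apply: val_inj. Qed.

Lemma cochain_bilin a F : bilin F -> cochain k (a *: cochain2 F).
Proof.
move=> [gF lF aF sF eF].
have E Y : (a *: cochain2 F) Y = a *: F (vsval (Y 0)) (vsval (Y 1)) by [].
have lFr b A B D g : F D (b *: A + B) g = b *: F D A g + F D B g.
  by rewrite aF lF opprD -scalerN -!aF.
have ne01 : (0 == 1 :> 'I_2) = false by [].
have ne10 : (1 == 0 :> 'I_2) = false by [].
split.
- by move=> Y; rewrite E; apply: good_IV; apply: good_scale; exact: gF.
- split=> [Y i b y z|Y i j ij Yij].
    rewrite !E; move: i; apply: ord2P; rewrite /upd ?eqxx ?ne01 ?ne10 linearP /=; apply/funext => g.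
      by rewrite fDE 4!fZE lF; exact: scale_lin_comm.
    by rewrite fDE 4!fZE lFr; exact: scale_lin_comm.
  have -> : (a *: cochain2 F) Y = a *: F (vsval (Y 0)) (vsval (Y 0)).
    rewrite E; congr (_ *: F _ (vsval _)); move: i j ij Yij.
    by apply: ord2P; apply: ord2P.
  apply/funext => g; rewrite fZE; have h := aF (vsval (Y 0)) (vsval (Y 0)) g.
  have -> : F (vsval (Y 0)) (vsval (Y 0)) g = 0; last by rewrite scaler0.
  move: h; move: (F _ _ g) => x /eqP; rewrite -addr_eq0 -mulr2n -scaler_nat scaler_eq0 pnatr_eq0 /= => /eqP.
  by [].
- move=> U /in_lP Ul Y; rewrite E actT_scale; [|exact: gF|exact: in_l_tr].
  have e0 : (a *: cochain2 F) (upd Y 0 (mod_l (bracket U (vsval (Y 0))))) =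
      a *: F (bracket U (vsval (Y 0))) (vsval (Y 1)).
    by congr (a *: _); apply: sF; [exact: same_p_mod | exact: same_p_refl].
  have e1 : (a *: cochain2 F) (upd Y 1 (mod_l (bracket U (vsval (Y 1))))) =
      a *: F (vsval (Y 0)) (bracket U (vsval (Y 1))).
    by congr (a *: _); apply: sF; [exact: same_p_refl | exact: same_p_mod].
  rewrite big2; apply: etrans (congr2 +%R (esym e0) (esym e1)).
  by rewrite (eF _ _ _ Ul (pcoord_in_p _) (pcoord_in_p _)) scalerDr.
Qed.

Lemma psi_cochain2 : @psi R k = s *: cochain2 (@psiX R k).
Proof. by apply/funext => Y; rewrite psiE. Qed.
Lemma psi0_cochain2 : @psi0 R k = cochain2 (@psi0X R k).
Proof. by apply/funext => Y; rewrite psi0E. Qed.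

(** Brackets of elements of [p] lie in [l], so the second sum of the
differential has a zero argument throughout. *)
Lemma dCE_p q (w : ('I_q.+1 -> P) -> MF) Y : (forall Z, Z 0 = 0 -> w Z = 0) ->
  dCE k w Y = \sum_(i < q.+2) (-1) ^+ i *: actT k (vsval (Y i)) (w (fun j => Y (lift i j))).
Proof.
move=> w0; rewrite /dCE [X in _ + X]big1 ?addr0 // => i _; rewrite big1 // => j _.
by rewrite w0 ?scaler0 //= mod_l0 //; exact: pcoord_in_p.
Qed.

Lemma sign2 (x y : MF) : (-1 : C) ^+ (0%R : 'I_2) *: x + (-1) ^+ (1%R : 'I_2) *: y = x - y.
Proof. by rewrite expr0 expr1 scale1r scaleN1r. Qed.

Lemma sign3 (x y z : MF) :
  (-1 : C) ^+ (0%R : 'I_3) *: x + (-1) ^+ (1%R : 'I_3) *: y + (-1) ^+ (2%R : 'I_3) *: z = x - y + z.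
Proof. by rewrite expr0 expr1 sqrrN expr1n !scale1r scaleN1r. Qed.

Lemma dCE_chi a : dCE k (a *: @chi R k) = (a / s) *: @psi R k + a *: @psi0 R k.
Proof.
apply/funext => Y; rewrite dCE_p; last first.
  by move=> Z Z0; rewrite -[LHS]/(a *: _) chiE Z0 chiX0 scaler0.
have E Z : (a *: @chi R k) Z = a *: chiX k (vsval (Z 0)) by rewrite -chiE.
rewrite big2 !E.
have -> : lift (0 : 'I_2) (0 : 'I_1) = 1 by apply: val_inj.
have -> : lift (1 : 'I_2) (0 : 'I_1) = 0 by apply: val_inj.
rewrite sign2.
have pY i := pcoord_in_p (Y i).
have S U A : in_p U -> actT k U (a *: chiX k A) = a *: actT k U (chiX k A).
  by move=> h; apply: actT_scale; [exact: good_chiX | exact: in_p_tr].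
rewrite (S _ _ (pY 0)) (S _ _ (pY 1)) -scalerBr (dchiX k (pY 0) (pY 1)) scalerDr -[RHS]/(_ *: _ + _ *: _) psiE psi0E scalerA.
by rewrite divfK // sk2_neq0.
Qed.

Lemma dCE_bilin a F : bilin F ->
  (forall X Y Z, in_p X -> in_p Y -> in_p Z ->
    actT k X (F Y Z) - actT k Y (F X Z) + actT k Z (F X Y) = 0) ->
  dCE k (a *: cochain2 F) = 0.
Proof.
move=> [gF lF aF sF eF] dF; apply/funext => Y; rewrite dCE_p; last first.
  move=> Z Z0; rewrite -[LHS]/(a *: F _ _) Z0; apply/funext => g; rewrite fZE.
  have := lF 0 0 0 (vsval (Z 1)) g; rewrite scaler0 scale0r addr0 add0r.
  have -> : F 0 (vsval (Z 1)) g = 0 by have := lF (-1) 0 0 (vsval (Z 1)) g; rewrite scaler0 add0r scaleN1r addNr.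
  by rewrite scaler0.
have E Z : (a *: cochain2 F) Z = a *: F (vsval (Z 0)) (vsval (Z 1)) by [].
rewrite big3 !E.
have -> : lift (0 : 'I_3) (0 : 'I_2) = 1 by apply: val_inj.
have -> : lift (0 : 'I_3) (1 : 'I_2) = 2 by apply: val_inj.
have -> : lift (1 : 'I_3) (0 : 'I_2) = 0 by apply: val_inj.
have -> : lift (1 : 'I_3) (1 : 'I_2) = 2 by apply: val_inj.
have -> : lift (2 : 'I_3) (0 : 'I_2) = 0 by apply: val_inj.
have -> : lift (2 : 'I_3) (1 : 'I_2) = 1 by apply: val_inj.
have pY i := pcoord_in_p (Y i).
have S U A B : in_p U -> actT k U (a *: F A B) = a *: actT k U (F A B).
  by move=> h; apply: actT_scale; [exact: gF | exact: in_p_tr].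
rewrite sign3 (S _ _ _ (pY 0)) (S _ _ _ (pY 1)) (S _ _ _ (pY 2)).
by rewrite -scalerBr -scalerDr (dF _ _ _ (pY 0) (pY 1) (pY 2)) scaler0.
Qed.

End Cochain.

(** * Linear differential systems *)

Section Gronwall.
Variable R : realType.
Local Notation C := R[i].
Local Notation Re := (@complex.Re R).
Local Notation Im := (@complex.Im R).

Lemma derive_le0_mono (F dF : R -> R) : (forall t, is_derive t (1 : R) F (dF t)) ->
  (forall t, dF t <= 0) -> forall x y, x <= y -> F y <= F x.
Proof.
move=> hF d0 x y xy.
have [|c _ e] := @MVT_segment _ F dF x y xy (fun x _ => hF x).
  apply: continuous_subspaceT => z; have [dz _] := hF z.
  by apply: differentiable_continuous; apply/derivable1_diffP.
by rewrite -subr_le0 e mulr_le0_ge0 // subr_ge0.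
Qed.

Lemma is_derive_exp_lin (a t : R) : is_derive t (1 : R) (fun s => expR (a * s)) (a * expR (a * t)).
Proof.
have h : is_derive t (1 : R) (fun s : R => a *: s) (a *: (1 : R)) by apply: is_deriveZ.
have := @is_derive1_comp _ expR (fun s => a *: s) t _ _ (is_derive_expR _) h.
move=> X; apply: (is_derive_eq X) => /=; rewrite mulrC -[a%:A]/(a * 1) mulr1 //.
Qed.

(** [exp (- K t) E t] decreases and [exp (K t) E t] increases, so a
nonnegative [E] vanishing at 0 vanishes on both sides. *)
Lemma gronwall0 (E dE : R -> R) (K : R) : (forall t, is_derive t (1 : R) E (dE t)) ->
  (forall t, 0 <= E t) -> (forall t, `|dE t| <= K * E t) -> E 0 = 0 -> forall t, E t = 0.
Proof.
move=> hE E0 bE Ez t; apply/eqP; rewrite eq_le E0 andbT.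
have [t0|t0] := leP 0 t.
  have d s : is_derive s (1 : R) (fun s => expR (- K * s) * E s)
      (expR (- K * s) * (dE s - K * E s)).
    have X := is_deriveM (is_derive_exp_lin (- K) s) (hE s).
    apply: (is_derive_eq X) => /=.
    move: (expR _) (dE s) (E s) => a b c; rewrite -[LHS]/(a * b + c * (- K * a)); ring.
  have := @derive_le0_mono _ _ d _ 0 t t0.
  rewrite Ez mulr0 pmulr_rle0 ?expR_gt0 //; apply=> s.
  by rewrite pmulr_rle0 ?expR_gt0 // subr_le0; apply: le_trans (bE s); exact: ler_norm.
have d s : is_derive s (1 : R) (fun s => - (expR (K * s) * E s))
    (- (expR (K * s) * (dE s + K * E s))).
  have X := is_deriveN (is_deriveM (is_derive_exp_lin K s) (hE s)).
  apply: (is_derive_eq X) => /=.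
  move: (expR _) (dE s) (E s) => a b c; rewrite -[LHS]/(- (a * b + c * (K * a))); ring.
have := @derive_le0_mono _ _ d _ t 0 (ltW t0).
rewrite Ez mulr0 oppr0 oppr_ge0 pmulr_rle0 ?expR_gt0 //; apply=> s.
rewrite oppr_le0 mulr_ge0 ?expR_ge0 //.
by have := bE s; rewrite ler_norml => /andP[h _]; move: h; rewrite -subr_ge0 opprK.
Qed.

Lemma quad_bound (a b c : C) :
  `|2%:R * (Re a * Re (b * c) + Im a * Im (b * c))| <=
  (`|Re b| + `|Im b|) * ((Re a ^+ 2 + Im a ^+ 2) + (Re c ^+ 2 + Im c ^+ 2)).
Proof.
rewrite ReM ImM; case: a b c => [a1 a2] [b1 b2] [c1 c2] /=.
have -> : 2%:R * (a1 * (b1 * c1 - b2 * c2) + a2 * (b1 * c2 + b2 * c1)) =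
  b1 * (2%:R * (a1 * c1 + a2 * c2)) + b2 * (2%:R * (a2 * c1 - a1 * c2)) by ring.
have B x y : `|x| <= y -> forall b : R, `|b * x| <= `|b| * y by move=> xy b; rewrite normrM ler_wpM2l.
apply: le_trans (ler_normD _ _) _; rewrite [leRHS]mulrDl; apply: lerD; apply: B; rewrite ler_norml.
  have := sqr_ge0 (a1 - c1); have := sqr_ge0 (a2 - c2).
  have := sqr_ge0 (a1 + c1); have := sqr_ge0 (a2 + c2).
  by rewrite !expr2 => h1 h2 h3 h4; apply/andP; split; lra.
have := sqr_ge0 (a1 - c2); have := sqr_ge0 (a2 - c1).
have := sqr_ge0 (a1 + c2); have := sqr_ge0 (a2 + c1).
by rewrite !expr2 => h1 h2 h3 h4; apply/andP; split; lra.
Qed.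

(** The energy, the sum of the squared moduli, has derivative at most a
constant times itself, by [quad_bound]. *)
Lemma linear_ode0 (I : finType) (u : I -> R -> C) (A : I -> I -> C) :
  (forall i t, cderiv (u i) t (\sum_j A i j * u j t)) ->
  (forall i, u i 0 = 0) -> forall i t, u i t = 0.
Proof.
move=> du u0.
pose e j t := Re (u j t) ^+ 2 + Im (u j t) ^+ 2.
pose E t := \sum_j e j t.
pose d i t := \sum_j (2%:R * (Re (u i t) * Re (A i j * u j t) + Im (u i t) * Im (A i j * u j t))).
(* Both energies in [quad_bound] are at most [E t]; hence the factor 2. *)
pose K := 2%:R * (\sum_i \sum_j (`|Re (A i j)| + `|Im (A i j)|)).
have e0 j t : 0 <= e j t by rewrite addr_ge0 ?sqr_ge0.
have eE j t : e j t <= E t by rewrite /E (bigD1 j) //= lerDl sumr_ge0.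
have Ez : forall t, E t = 0.
  apply: (@gronwall0 E (fun t => \sum_i d i t) K) => [t|t|t|]; last 1 first.
  - by rewrite /E big1 // => j _; rewrite /e u0 /= expr0n addr0.
  - have h i : is_derive t (1 : R) (e i) (d i t).
      have [dr di] := du i t.
      have X := is_deriveD (is_deriveM dr dr) (is_deriveM di di).
      have -> : e i = (fun s => Re (u i s)) * (fun s => Re (u i s)) + (fun s => Im (u i s)) * (fun s => Im (u i s)).
        by apply/funext => s; rewrite /e !expr2.
      apply: (is_derive_eq X) => /=; rewrite /d -mulr_sumr.
      rewrite big_split /= -!mulr_sumr (big_morph Re (@ReD R) (erefl _)) (big_morph Im (@ImD R) (erefl _)).
      have alg (a b c d' : R) : a * b + a * b + (c * d' + c * d') = 2%:R * (a * b + c * d') by ring.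
      exact: alg.
    rewrite /E; elim: (index_enum I) => [|j r IH].
      rewrite big_nil (_ : (fun s => _) = cst 0); last by apply/funext => s; rewrite big_nil.
      exact: is_derive_cst.
    rewrite big_cons (_ : (fun s => _) = e j + (fun s => \sum_(i <- r) e i s)).
      exact: is_deriveD.
    by apply/funext => s; rewrite big_cons.
  - by rewrite sumr_ge0.
  - have -> : K * E t = \sum_i \sum_j (`|Re (A i j)| + `|Im (A i j)|) * (2%:R * E t).
      rewrite [K]mulrC -mulrA mulr_suml; apply: eq_bigr => i _; by rewrite mulr_suml.
    apply: le_trans (ler_norm_sum _ _ _) _; apply: ler_sum => i _.
    apply: le_trans (ler_norm_sum _ _ _) _; apply: ler_sum => j _.
    apply: le_trans (quad_bound _ _ _) _; rewrite ler_wpM2l ?addr_ge0 //.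
    by have := eE i t; have := eE j t; rewrite /e; lra.
move=> i t; have := eE i t; rewrite Ez => h; apply: complexP => /=; apply/eqP; rewrite -sqrf_eq0 eq_le sqr_ge0 andbT.
  by apply: le_trans h; rewrite lerDl sqr_ge0.
by apply: le_trans h; rewrite lerDr sqr_ge0.
Qed.

End Gronwall.

(** * Transport of cochains along compact directions *)

Section Flow.
Variable R : realType.
Variable k : nat.
Local Notation C := R[i].
Local Notation PV := (mpoly 3 C).
Local Notation G := (SU21 R).
Local Notation P := (subvs_of (pC R)).
Local Notation MF := (G -> PV).

Lemma su21_re_id (U : 'M[C]_3) : su21 U -> J R *m U ^t* *m J R = - U.
Proof.
move=> [h _]; have e : U ^t* *m J R = - (J R *m U) by apply/eqP; rewrite -addr_eq0 h.
by rewrite -mulmxA e mulmxN mulmxA J_sqr mul1mx.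
Qed.

(** The imaginary part of an element of the real Lie algebra is 0, and the
action of 0 differentiates a constant curve. *)
Lemma actIC_su21 (U : 'M[C]_3) f (g : G) : su21 U -> actIC U f g = actI U f g.
Proof.
move=> sU; rewrite /actIC /su21_re /su21_im su21_re_id // subrr scaler0 opprK.
have -> : 2%:R^-1 *: (U + U) = U.
  by apply/matrixP => i j; rewrite !mxE; field.
have -> : actI 0 f g = 0; last by rewrite mulr0 addr0.
apply: cderivE; apply: eq_cderiv (cderiv_cst (f (expG 0 * g)%g) 0) => s.
by rewrite scaler0.
Qed.

(** Turns a linear functional given by a formula into the coefficients that
[linear_ode0] expects. *)
Lemma lin_repr (I : finType) (L : (I -> C) -> C) :
  (forall a x y, L (fun i => a * x i + y i) = a * L x + L y) ->
  forall x, L x = \sum_j L (fun i => (i == j)%:R) * x j.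
Proof.
move=> Ll x.
have L0 : L (fun=> 0) = 0.
  have e : (fun _ : I => -1 * (0 : C) + 0) = fun=> 0 by apply/funext => i; rewrite mulr0 addr0.
  by have := Ll (-1) (fun=> 0) (fun=> 0); rewrite e mulN1r addNr.
have Ls (r : seq I) : L (fun i => \sum_(j <- r) x j * (i == j)%:R) = \sum_(j <- r) L (fun i => (i == j)%:R) * x j.
  elim: r => [|j r IH].
    by rewrite big_nil -[RHS]L0; apply: (congr1 L); apply/funext => i; rewrite big_nil.
  rewrite big_cons -IH mulrC -Ll; apply: (congr1 L); apply/funext => i; by rewrite big_cons.
rewrite -Ls; apply: (congr1 L); apply/funext => i.
rewrite (bigD1 i) //= eqxx mulr1 big1 ?addr0 // => j ji.
by rewrite eq_sym (negPf ji) mulr0.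
Qed.

Definition bX (a : 'I_4) : P := mod_l (tnth (Xs R) a).

Lemma bX_val a : vsval (bX a) = tnth (Xs R) a.
Proof.
rewrite /bX.
have [[x11 x12 x13 x14] [x21 x22 x23 x24] [x31 x32 x33 x34] [x41 x42 x43 x44]] := X_entries R.
rewrite mod_l_val; case: a => [[|[|[|[|//]]]] p] /=.
- by rewrite x11 x12 x13 x14 !scale0r scale1r !addr0.
- by rewrite x21 x22 x23 x24 !scale0r scale1r !addr0 add0r.
- by rewrite x31 x32 x33 x34 !scale0r scale1r !addr0 add0r.
- by rewrite x41 x42 x43 x44 !scale0r scale1r !add0r.
Qed.

Lemma pcoord_sum (y : P) : y = \sum_a pcoord y a *: bX a.
Proof.
rewrite big4; apply: subvs_inj.
have /coord_span := subvsP y; rewrite big4 => {1}->.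
have V c1 c2 c3 c4 (y1 y2 y3 y4 : P) : vsval (c1 *: y1 + c2 *: y2 + c3 *: y3 + c4 *: y4) =
    c1 *: vsval y1 + c2 *: vsval y2 + c3 *: vsval y3 + c4 *: vsval y4.
  by rewrite !linearD !linearZ.
by rewrite V !bX_val.
Qed.

Section Multilinear.
Variables (q : nat) (w : ('I_q -> P) -> MF).
Hypothesis wlin : forall (Y : 'I_q -> P) (i : 'I_q) (a : C) (y z : P),
  w (upd Y i (a *: y + z)) = a *: w (upd Y i y) + w (upd Y i z).

Lemma upd0 Y i : w (upd Y i 0) = 0.
Proof. by have := wlin Y i (-1) 0 0; rewrite scaler0 add0r scaleN1r addNr. Qed.

Lemma upd_sum Y i (I : finType) (c : I -> C) (y : I -> P) :
  w (upd Y i (\sum_a c a *: y a)) = \sum_a c a *: w (upd Y i (y a)).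
Proof.
elim: (index_enum I) => [|a r IH]; first by rewrite !big_nil upd0.
by rewrite !big_cons wlin IH.
Qed.

Lemma upd_id (Y : 'I_q -> P) i : upd Y i (Y i) = Y.
Proof. by apply/funext => j; rewrite /upd; case: eqP => [->|]. Qed.

End Multilinear.

(** Induction on the number of arguments that are not basis vectors, expanding
one argument at a time. *)
Lemma multilin_eq q (w1 w2 : ('I_q -> P) -> MF) (h : G) :
  alternating w1 -> alternating w2 ->
  (forall s : {ffun 'I_q -> 'I_4}, w1 (fun i => bX (s i)) h = w2 (fun i => bX (s i)) h) ->
  forall Y, w1 Y h = w2 Y h.
Proof.
move=> [l1 _] [l2 _] eb Y.
suff H n : forall Y, (forall i : 'I_q, (n <= i)%N -> exists a, Y i = bX a) -> w1 Y h = w2 Y h.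
  by apply: (H q) => i; rewrite leqNgt ltn_ord.
elim: n => [|n IH] {}Y hY.
  have /choice [s sE] : forall i, exists a, Y i = bX a by move=> i; exact: hY.
  have -> : Y = fun i => bX ([ffun i => s i] i) by apply/funext => i; rewrite ffunE.
  exact: eb.
have [nq|nq] := ltnP n q; last first.
  by apply: IH => i ni; move: (ltn_ord i); rewrite ltnNge (leq_trans nq ni).
pose i := Ordinal nq.
rewrite -(upd_id Y i) (pcoord_sum (Y i)) (upd_sum l1) (upd_sum l2) !fct_sumE.
apply: eq_bigr => a _; rewrite !fZE IH // => j nj.
rewrite /upd; case: eqP => [_|ji]; first by exists a.
by apply: hY; rewrite ltn_neqAle nj andbT; apply/eqP => e; apply: ji; apply: val_inj.
Qed.

Lemma mcoeff_monomials (A : bmultinom 3 k.+1 -> C) (m : bmultinom 3 k.+1) :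
  \sum_(m' : bmultinom 3 k.+1) mcoeff m (A m' *: mpolyX C m') = A m.
Proof.
rewrite (bigD1 m) //= mcoeffZ mcoeffX eqxx mulr1 big1 ?addr0 // => m' mm.
rewrite mcoeffZ mcoeffX (_ : (_ == _) = false) ?mulr0 //.
by apply/negbTE; apply: contra mm => /eqP e; apply/eqP; apply: val_inj.
Qed.

(** For an element of the real Lie algebra the coefficients of the action
split into a derivative and a constant matrix. *)
Lemma mcoeff_actT (U : 'M[C]_3) F (g : G) (m : bmultinom 3 k.+1) : su21 U -> \tr U = 0 ->
  mcoeff m (actT k U F g) = actI U (fun g => mcoeff m (F g)) g +
    \sum_(m' : bmultinom 3 k.+1) mcoeff m' (F g) * mcoeff m (polyD U (mpolyX C m')).
Proof.
move=> sU tU.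
have -> : actT k U F g = \sum_(m' : bmultinom 3 k.+1)
    (actIC U (fun g => mcoeff m' (F g)) g *: mpolyX C m' + mcoeff m' (F g) *: actVC k U (mpolyX C m')).
  by rewrite /actT fct_sumE.
rewrite big_split /= mcoeffD !(raddf_sum (mcoeff m)) /=; congr (_ + _); last first.
  by apply: eq_bigr => m' _; rewrite mcoeffZ actVC_monE.
by rewrite mcoeff_monomials actIC_su21.
Qed.

Lemma homog_eq (p1 p2 : PV) : homog k p1 -> homog k p2 ->
  (forall m : bmultinom 3 k.+1, mcoeff m p1 = mcoeff m p2) -> p1 = p2.
Proof.
move=> h1 h2 e; apply/mpolyP => m; have [mk|mk] := eqVneq (mdeg m) k.
  have lt : (mdeg m < k.+1)%N by rewrite mk.
  exact: (e (BMultinom lt)).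
by move/homogP: h1 => ->; move/homogP: h2 => // ->.
Qed.

Definition updf q (s : {ffun 'I_q -> 'I_4}) i a := [ffun j => if j == i then a else s j].

(** Equivariance under [U] expresses the derivatives of the coefficients of [w
(b_s1, .., b_sq)] along [c] through these coefficients themselves, with
constants depending only on [U]. The difference of two cochains solves this
system with initial value 0. *)
Lemma cochain_flow q (w1 w2 : ('I_q -> P) -> MF) (U : 'M[C]_3) (c : R -> G) :
  cochain k w1 -> cochain k w2 -> su21 U -> U \in lC R ->
  (forall t, mxderiv (fun s => c s : 'M[C]_3) t (- U *m c t)) ->
  (forall Y, w1 Y (c 0) = w2 Y (c 0)) -> forall t Y, w1 Y (c t) = w2 Y (c t).
Proof.
move=> c1 c2 sU lU dc e0.
have tU : \tr U = 0 by apply: in_l_tr; apply: in_lP.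
pose b (s : {ffun 'I_q -> 'I_4}) : 'I_q -> P := fun i => bX (s i).
pose f (w : ('I_q -> P) -> MF) (i : {ffun 'I_q -> 'I_4} * bmultinom 3 k.+1) : G -> C :=
  fun g => mcoeff i.2 (w (b i.1) g).
pose co s (i : 'I_q) a := pcoord (mod_l (bracket U (vsval (b s i)))) a.
(* [co] comes from the brackets of [U] with the arguments; the second sum is the action of [U] on the values. *)
pose L (sm : {ffun 'I_q -> 'I_4} * bmultinom 3 k.+1)
    (x : {ffun 'I_q -> 'I_4} * bmultinom 3 k.+1 -> C) : C :=
  \sum_i \sum_a co sm.1 i a * x (updf sm.1 i a, sm.2) -
  \sum_(m' : bmultinom 3 k.+1) x (sm.1, m') * mcoeff sm.2 (polyD U (mpolyX C m')).
have Ll sm a x y : L sm (fun i => a * x i + y i) = a * L sm x + L sm y.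
  have e1 : \sum_i \sum_b0 co sm.1 i b0 * (a * x (updf sm.1 i b0, sm.2) + y (updf sm.1 i b0, sm.2)) =
      a * (\sum_i \sum_b0 co sm.1 i b0 * x (updf sm.1 i b0, sm.2)) +
      \sum_i \sum_b0 co sm.1 i b0 * y (updf sm.1 i b0, sm.2).
    rewrite mulr_sumr -big_split; apply: eq_bigr => i _ /=.
    by rewrite mulr_sumr -big_split; apply: eq_bigr => b0 _ /=; rewrite mulrDr mulrCA.
  have e2 : \sum_(m' : bmultinom 3 k.+1) (a * x (sm.1, m') + y (sm.1, m')) * mcoeff sm.2 (polyD U (mpolyX C m')) =
      a * (\sum_(m' : bmultinom 3 k.+1) x (sm.1, m') * mcoeff sm.2 (polyD U (mpolyX C m'))) +
      \sum_(m' : bmultinom 3 k.+1) y (sm.1, m') * mcoeff sm.2 (polyD U (mpolyX C m')).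
    by rewrite mulr_sumr -big_split; apply: eq_bigr => m' _ /=; rewrite mulrDl mulrA.
  have alg (u v u' v' : C) : a * u + v - (a * u' + v') = a * (u - u') + (v - v') by ring.
  by rewrite /L e1 e2; exact: alg.
have dw w i t : cochain k w -> cderiv (fun t => f w i (c t)) t (L i (fun j => f w j (c t))).
  move=> [wI [wl _] we]; case: i => s m.
  have sm : smooth (f w (s, m)) by have [_ /(_ m) []] := wI (b s).
  apply: cderiv_eq (smooth_curve sm sU (dc t)).
  have := congr1 (fun F : MF => mcoeff m (F (c t))) (we U lU (b s)).
  rewrite (mcoeff_actT _ _ _ sU tU) => /(canRL (addrK _)) ->.
  rewrite /L /=; congr (_ - _).
  rewrite fct_sumE (raddf_sum (mcoeff m)) /=; apply: eq_bigr => i _.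
  rewrite {1}(pcoord_sum (mod_l _)) (upd_sum wl) fct_sumE (raddf_sum (mcoeff m)) /=; apply: eq_bigr => a _.
  rewrite fZE mcoeffZ /f /=; congr (_ * mcoeff _ (w _ _)).
  by apply/funext => j; rewrite /upd /b /updf ffunE; case: ifP.
move=> t; apply: multilin_eq; [by case: c1|by case: c2|move=> s].
have [[h1 _] [h2 _]] : IV k (w1 (b s)) /\ IV k (w2 (b s)) by case: c1 => [? _ _]; case: c2.
apply: homog_eq (h1 _) (h2 _) _ => m.
apply/eqP; rewrite -subr_eq0; apply/eqP.
apply: (@linear_ode0 _ _ (fun i t => f w1 i (c t) - f w2 i (c t)) (fun i j => L i (fun i => (i == j)%:R)) _ _ (s, m)) => [i u|i].
  apply: cderiv_eq (cderivD (dw w1 i u c1) (cderivN (dw w2 i u c2))).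
  rewrite -(lin_repr (Ll i)) addrC -mulN1r -Ll; apply: (congr1 (L i)).
  by apply/funext => j; rewrite mulN1r addrC.
by rewrite /f e0 subrr.
Qed.

End Flow.

(** * Cochains are determined at the identity *)

Section Uniqueness.
Variable R : realType.
Variable k : nat.
Local Notation C := R[i].
Local Notation PV := (mpoly 3 C).
Local Notation G := (SU21 R).
Local Notation P := (subvs_of (pC R)).
Local Notation MF := (G -> PV).

Lemma su21_entries (X : 'M[C]_3) :
  (forall i j, (X j i)^*%R * eps R j + eps R i * X i j = 0) -> \tr X = 0 -> su21 X.
Proof.
move=> h t; split=> //; apply/matrixP => i j; rewrite -[RHS](_ : 0 = _); last by rewrite mxE.
rewrite -(h i j) mxE; congr (_ + _).
  rewrite mxE (bigD1 j) //= big1 ?addr0 => [|p pj]; first by rewrite JE eqxx adjE mulr1.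
  by rewrite JE (negPf pj) !mulr0.
rewrite mxE (bigD1 i) //= big1 ?addr0 => [|p pi]; first by rewrite JE eqxx mulr1.
by rewrite JE [_ == p]eq_sym (negPf pi) mulr0 mul0r.
Qed.

Lemma su21_dg (d : 'I_3 -> C) : (forall i, (d i)^*%R = - d i) -> \sum_i d i = 0 -> su21 (dg d).
Proof.
move=> dJ d0; apply: su21_entries => [i j|]; last first.
  by rewrite -d0 /mxtrace; apply: eq_bigr => i _; rewrite dgE eqxx mul1r.
rewrite !dgE eq_sym; case: eqP => [->|_]; last by rewrite !mul0r conjC0 mul0r mulr0 addr0.
by rewrite !mul1r dJ mulNr mulrC addNr.
Qed.

Lemma memv_span4 (V : vectType C) (v1 v2 v3 v4 : V) a b c d :
  a *: v1 + b *: v2 + c *: v3 + d *: v4 \in <<[:: v1; v2; v3; v4]>>%VS.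
Proof.
apply: rpredD; [apply: rpredD; [apply: rpredD|]|]; apply: rpredZ; apply: memv_span;
  by rewrite !inE eqxx ?orbT.
Qed.

Lemma lC_basis (a b c d : C) : a *: U0 R + b *: U1 R + c *: U2 R + d *: U3 R \in lC R.
Proof. exact: memv_span4. Qed.

Lemma iE : 'i%C = 'i%R :> C. Proof. by []. Qed.
Lemma iJ : ('i : C)^*%R = - 'i. Proof. by apply: complexP; rewrite /= ?oppr0. Qed.
(** The diagonal matrices of trace 0 are spanned by [U0] and [U3]. *)
Lemma lC_dg (a d : C) : dg (fun i => if i == 0 then a else if i == 1 then d else - (a + d)) \in lC R.
Proof.
have -> : dg (fun i => if i == 0 then a else if i == 1 then d else - (a + d)) =
    ((a + d) / 'i) *: U0 R + 0 *: U1 R + 0 *: U2 R + ((a - d) / 'i) *: U3 R; last exact: lC_basis.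
have i0 : 'i%R != 0 :> C by rewrite eq_complex /= oner_eq0 andbF.
have E (x y z t : C) (A B D F : 'M[C]_3) i j : (x *: A + y *: B + z *: D + t *: F) i j =
    x * A i j + y * B i j + z * D i j + t * F i j by rewrite !mxE.
apply/matrixP => i j; rewrite E !mul0r !addr0 dgE; move: i j.
have U0E i' j' : U0 R i' j' = (i' == j')%:R * (if i' == 2 then - 'i else 'i / 2%:R).
  by rewrite !mxE iE; move: ('i%R : C) i' j' => x; apply: ord3P; apply: ord3P => /=; field.
have U3E i' j' : U3 R i' j' = (i' == j')%:R * (if i' == 0 then 'i / 2%:R else if i' == 1 then - ('i / 2%:R) else 0).
  by rewrite !mxE iE; move: ('i%R : C) i' j' => x; apply: ord3P; apply: ord3P => /=; field.
move=> i j; rewrite U0E U3E; case: eqP => _; last by rewrite !(mul0r, mulr0, addr0).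
rewrite !mul1r; move: i; apply: ord3P => /=; field.
all: exact: i0.
Qed.

Lemma torus_lC (a b : R) : dg (torus_wt a b) \in lC R.
Proof.
have -> : dg (torus_wt a b) = dg (fun i => if i == 0 then torus_wt a b 0 else
    if i == 1 then torus_wt a b 1 else - (torus_wt a b 0 + torus_wt a b 1)); last exact: lC_dg.
apply/matrixP => i j; rewrite !dgE; congr (_ * _); move: i; apply: ord3P => //=.
rewrite /torus_wt /= -mulrDr -mulrN -rmorphD -rmorphN; congr (_ * _%:C); by field.
Qed.

Lemma torus_su21 (a b : R) : su21 (dg (torus_wt a b)).
Proof.
apply: su21_dg => [i|]; first by rewrite /torus_wt rmorphM /= realCJ iJ mulNr.
rewrite big3 /torus_wt /= -!mulrDr -!rmorphD (_ : _ + _ = 0) ?mulr0 //; by field.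
Qed.

Lemma su21_Xth : su21 (- Xth R) /\ - Xth R \in lC R.
Proof.
have E : - Xth R = U2 R by rewrite /Xth /U2 -scalerN opprB.
rewrite E; split; last first.
  have := lC_basis 0 0 1 0; by rewrite !scale0r scale1r addr0 !add0r.
have UE i j : U2 R i j = 2%:R^-1 * (((i == 0) && (j == 1))%:R - ((i == 1) && (j == 0))%:R) by rewrite !mxE.
apply: su21_entries; last by rewrite /mxtrace big3 !UE /= subrr mulr0 !addr0.
apply: ord3P; apply: ord3P; rewrite !UE /= ?subrr ?mulr0 ?conjC0 ?mul0r ?addr0 //.
all: rewrite rmorphM /= fmorphV /= rmorph_nat rmorphB /= conjC0 conjC1 !epsE; ring.
Qed.

(** From the identity, turn on the three Euler angles one after the other;
[I_phi_eq] extends the equality to the group. *)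
Lemma cochain_eq q (w1 w2 : ('I_q -> P) -> MF) : cochain k w1 -> cochain k w2 ->
  (forall Y, w1 Y 1%g = w2 Y 1%g) -> w1 = w2.
Proof.
move=> c1 c2 e.
have [sth lth] := su21_Xth.
have N (U A : 'M[C]_3) : - - U *m A = U *m A by rewrite opprK.
have e1 th Y : w1 Y (kap 0 th 0) = w2 Y (kap 0 th 0).
  apply: (cochain_flow (c := fun t => kap 0 t 0) c1 c2 sth lth) => [t|{}Y]; last by rewrite kap0.
  by rewrite N; exact: kap_th.
have tor z0 a p0 b th : (forall Y, w1 Y (kap z0 th p0) = w2 Y (kap z0 th p0)) ->
    forall t Y, w1 Y (kap (z0 + a * t) th (p0 + b * t)) = w2 Y (kap (z0 + a * t) th (p0 + b * t)).
  move=> e0; apply: (cochain_flow (c := fun t => kap (z0 + a * t) th (p0 + b * t)) c1 c2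
    (su21N (torus_su21 a b))) => [|t|Y].
  - by rewrite rpredN; exact: torus_lC.
  - by rewrite N; exact: kap_torus.
  - by rewrite !mulr0 !addr0.
have e2 th ps Y : w1 Y (kap 0 th ps) = w2 Y (kap 0 th ps).
  by have := tor 0 0 0 1 th (e1 th) ps Y; rewrite mul0r mul1r !add0r.
have e3 z th ps Y : w1 Y (kap z th ps) = w2 Y (kap z th ps).
  by have := tor 0 1 ps 0 th (e2 th ps) z Y; rewrite mul0r mul1r add0r addr0.
apply/funext => Y; apply/funext => g; apply/mpolyP => m.
have [/(_ Y) [_ /(_ m) i1] _ _] := c1; have [/(_ Y) [_ /(_ m) i2] _ _] := c2.
have := I_phi_eq i1 i2 (fun z th ps _ _ => congr1 (mcoeff m) (e3 z th ps Y)).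
by move/(congr1 (fun f => f g)).
Qed.

End Uniqueness.

(** * The torus weight at the identity *)

Section Weight.
Variable R : realType.
Variable k : nat.
Local Notation C := R[i].
Local Notation PV := (mpoly 3 C).
Local Notation G := (SU21 R).
Local Notation P := (subvs_of (pC R)).
Local Notation MF := (G -> PV).
Local Notation ic := ('i%R : C).

Definition wtgen_diag (i : 'I_3) : C := - torus_wt (-1) 3%:R i.
(** [diag (i, -2i, i)], in [l] and in the Lie algebra of the stabiliser of the
line of (1, 0, 1). *)
Definition wtgen : 'M[C]_3 := dg wtgen_diag.

Lemma wtgen_torus : - wtgen = dg (torus_wt (-1) 3%:R).
Proof. by apply/matrixP => i j; rewrite mxE !dgE mulrN opprK. Qed.

Lemma wtgen_diagE : [/\ wtgen_diag 0 = ic, wtgen_diag 1 = - (2%:R * ic) & wtgen_diag 2 = ic].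
Proof.
have e0 : (- -1 - 3%:R) / 2%:R = -1 :> R by field.
have e1 : (- -1 + 3%:R) / 2%:R = 2%:R :> R by field.
rewrite /wtgen_diag /torus_wt /= e0 e1 !rmorphN !rmorph1 rmorph_nat; split; ring.
Qed.

Lemma wtgen_lC : wtgen \in lC R.
Proof. by rewrite -rpredN wtgen_torus; exact: torus_lC. Qed.

Lemma wtgen_su21 : su21 wtgen.
Proof. by rewrite -[wtgen]opprK; apply: su21N; rewrite wtgen_torus; exact: torus_su21. Qed.

Local Opaque kap.

Lemma vc_kap_weight t i : vc i (kap (0 + (-1) * t) 0 (0 + 3%:R * t) : G) = expi (- t) * vc i (1%g : G).
Proof.
have [[k02 k12 k20 k21 k22] [k00 k01 k10 k11]] := kapE (0 + (-1) * t : R) 0 (0 + 3%:R * t).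
have I j l : ((1%g : G) : 'M[C]_3) j l = (j == l)%:R by rewrite /= mxE.
rewrite !vcE !I; move: i; apply: ord3P => /=.
- by rewrite k00 k02 mul0r cos0 mulr1 addr0 addr0 mulr1; congr expi; field.
- by rewrite k10 k12 mul0r sin0 mulr0 !addr0 mulr0.
- by rewrite k20 k22 !add0r mulr1 mulN1r.
Qed.

(** At the identity the curve [kap (- t) 0 (3 t)] scales (1, 0, 1) by [e^(- i
t)], so homogeneity makes its action on any function in the representation a
fixed scalar. *)
Lemma actI_wtgen f : I_phi k f -> actI wtgen f 1%g = (2 * k + 3)%:R * ic * f 1%g.
Proof.
move=> If; have [sf _ _] := If; have hf := I_phi_homogeneous If.
pose c (t : R) : G := kap (0 + (-1) * t) 0 (0 + 3%:R * t).
have c0 : c 0 = 1%g by rewrite /c !mulr0 addr0 kap0.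
have d1 : cderiv (fun t => f (c t)) 0 (actI wtgen f (c 0)).
  apply: smooth_curve => //; [exact: wtgen_su21 | rewrite wtgen_torus; exact: kap_torus].
have fE t : f (c t) = expi (t *+ (2 * k + 3)) * f 1%g.
  rewrite (hf 1%g (c t) (expi (- t))) ?expi_neq0 //; last by move=> i; exact: vc_kap_weight.
  rewrite -[expi (- t)]mul1r -[1]/((1 : R)%:C) wt_phi ?oner_eq0 // /phi_inf expr1n mul1r.
  by rewrite expiN exprVn invrK expiMn.
have d2 : cderiv (fun t => f (c t)) 0 ((2 * k + 3)%:R * ic * f 1%g).
  have di : is_derive (0 : R) (1 : R) (fun s : R => s *+ (2 * k + 3)) ((2 * k + 3)%:R).
    have X : is_derive (0 : R) (1 : R) (fun s : R => (2 * k + 3)%:R *: s) ((2 * k + 3)%:R *: (1 : R)).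
      exact: is_deriveZ.
    have -> : (fun s : R => s *+ (2 * k + 3)) = (fun s : R => (2 * k + 3)%:R *: s).
      by apply/funext => s; rewrite -[RHS]/(_ * s) mulr_natl.
    by apply: (is_derive_eq X); rewrite -[LHS]/(_ * 1) mulr1.
  have := cderivM (cderiv_expi di) (cderiv_cst (f 1%g) 0).
  rewrite mulr0 addr0 mul0rn expi0 mulr1 rmorph_nat [_ * (2 * k + 3)%:R]mulrC.
  by apply: eq_cderiv => s; rewrite fE.
by rewrite -{1}c0 -(cderivE d1) (cderivE d2).
Qed.

Lemma polyD_wtgen (m : multinom 3) : polyD wtgen (mpolyX C m) =
  (ic * ((m 0)%:R - 2%:R * (m 1)%:R + (m 2)%:R)) *: mpolyX C m.
Proof.
have [h0 h1 h2] := wtgen_diagE.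
have E i : lform (fun j => wtgen j i) * mderiv i (mpolyX C m) = (wtgen_diag i * (m i)%:R) *: mpolyX C m.
  have -> : lform (fun j => wtgen j i) = wtgen_diag i *: mpolyX C (mnm1 i).
    rewrite /lform (bigD1 i) //= big1 ?addr0 => [|j ji]; last by rewrite dgE (negPf ji) mul0r scale0r.
    by rewrite dgE eqxx mul1r.
  rewrite mderivX -!scalerAl -scalerAr scalerA -mpolyXD.
  have [m0|m0] := eqVneq (m i) 0%N; first by rewrite m0 mulr0 !scale0r.
  congr (_ *: mpolyX _ _); rewrite addmC submK //.
  by apply/mnm_lepP => j; rewrite mnm1E; case: eqP => // <-; rewrite lt0n.
rewrite /polyD big3 !E h0 h1 h2 -!scalerDl; congr (_ *: _); ring.
Qed.

(** The weights of [wtgen] on [X1, .., X4], in units of [3 i]. *)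
Definition p_weight (a : 'I_4) : int := if a == 1 then -1 else if a == 3 then 1 else 0.

Lemma mod_l_wtgen a : mod_l (bracket wtgen (vsval (bX R a))) = (3%:R * ic * (p_weight a)%:~R) *: bX R a.
Proof.
have [h0 h1 h2] := wtgen_diagE.
have B (X : 'M[C]_3) i j : bracket wtgen X i j = (wtgen_diag i - wtgen_diag j) * X i j.
  have -> : bracket wtgen X i j = (wtgen *m X) i j - (X *m wtgen) i j by rewrite !mxE.
  rewrite mul_dgE mxE (bigD1 j) //= big1 ?addr0 => [|l lj]; last by rewrite dgE (negPf lj) mul0r mulr0.
  by rewrite dgE eqxx mul1r mulrBl [X i j * _]mulrC.
have [[a1 a2 a3 a4] [b1 b2 b3 b4] [c1 c2 c3 c4] [d1 d2 d3 d4]] := X_entries R.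
apply: subvs_inj.
have V c : vsval (c *: bX R a) = c *: tnth (Xs R) a by rewrite linearZ -bX_val.
rewrite V mod_l_val !B h0 h1 h2 bX_val; case: a {V} => [[|[|[|[|//]]]] p].
- have -> : p_weight (Ordinal p) = 0 by [].
  rewrite mulr0 scale0r [tnth _ _]/(X1 R) a1 a2 a3 a4.
  by rewrite subrr mul0r !mulr0 !scale0r !addr0.
- have -> : p_weight (Ordinal p) = -1 by [].
  rewrite [tnth _ _]/(X2 R) b1 b2 b3 b4 !mulr0 !scale0r !addr0 add0r.
  by congr (_ *: _); rewrite mulrN1z; ring.
- have -> : p_weight (Ordinal p) = 0 by [].
  rewrite mulr0 scale0r [tnth _ _]/(X3 R) c1 c2 c3 c4.
  by rewrite subrr !mul0r !mulr0 !scale0r !addr0.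
- have -> : p_weight (Ordinal p) = 1 by [].
  rewrite [tnth _ _]/(X4 R) d1 d2 d3 d4 !mulr0 !scale0r !add0r.
  by congr (_ *: _); ring.
Qed.

(** Equivariance under [wtgen] at the identity equates [2k+3], from the
function, plus [m0 - 2 m1 + m2], from the monomial, with three times the
weights of the arguments, whenever the coefficient is nonzero; and [m0 + m1 +
m2 = k]. *)
Lemma weight_vanish q (w : ('I_q -> P) -> MF) (s : {ffun 'I_q -> 'I_4}) (m : bmultinom 3 k.+1) :
  cochain k w -> mdeg m = k -> mcoeff m (w (fun i => bX R (s i)) 1%g) != 0 ->
  k.+1%:Z = ((m : multinom 3) 1%R)%:Z + \sum_i p_weight (s i).
Proof.
move=> [wI [wl _] we] mk; set x := mcoeff m _ => x0.
have tH : \tr wtgen = 0 by case: wtgen_su21.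
have := congr1 (fun F : MF => mcoeff m (F 1%g)) (we _ wtgen_lC (fun i => bX R (s i))).
rewrite (mcoeff_actT _ _ _ wtgen_su21 tH) actI_wtgen; last by case: (wI (fun i => bX R (s i))).
have -> : \sum_(m' : bmultinom 3 k.+1) mcoeff m' (w (fun i => bX R (s i)) 1%g) * mcoeff m (polyD wtgen (mpolyX C m')) =
    x * (ic * (((m : multinom 3) 0%R)%:R - 2%:R * ((m : multinom 3) 1%R)%:R + ((m : multinom 3) 2%R)%:R)).
  rewrite -[RHS](@mcoeff_monomials _ _ (fun m' => mcoeff m' (w (fun i => bX R (s i)) 1%g) *
    (ic * (((m' : multinom 3) 0%R)%:R - 2%:R * ((m' : multinom 3) 1%R)%:R + ((m' : multinom 3) 2%R)%:R))) m).
  by apply: eq_bigr => m' _; rewrite polyD_wtgen !mcoeffZ mulrA.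
rewrite fct_sumE (raddf_sum (mcoeff m)) /=.
have -> : \sum_(i < q) mcoeff m (w (upd (fun i => bX R (s i)) i (mod_l (bracket wtgen (vsval (bX R (s i)))))) 1%g) =
    3%:R * ic * (\sum_i p_weight (s i))%:~R * x.
  rewrite rmorph_sum /= mulr_sumr mulr_suml; apply: eq_bigr => i _.
  rewrite mod_l_wtgen -[_ *: bX R (s i)]addr0 wl (upd0 wl) addr0 fZE mcoeffZ.
  by rewrite -[in upd _ i _]/((fun i => bX R (s i)) i) upd_id.
rewrite -/x => e; have i0 : ic != 0 by rewrite eq_complex /= oner_eq0 andbF.
have mE : k%:R = ((m : multinom 3) 0%R)%:R + ((m : multinom 3) 1%R)%:R + ((m : multinom 3) 2%R)%:R :> C.
  by rewrite -{1}mk mdegE big3 !natrD.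
have k1 : (2 * k + 3)%:R = 2%:R * k%:R + 3%:R :> C by rewrite natrD natrM.
have : (k.+1%:Z - ((m : multinom 3) 1%R)%:Z - \sum_i p_weight (s i))%:~R = 0 :> C.
  have c0 : 3%:R * ic * x != 0 by rewrite !mulf_neq0 ?pnatr_eq0.
  apply/eqP; rewrite -(mulrI_eq0 _ (mulfI c0)); apply/eqP.
  (* The sum of the two contributions is [3 (k + 1 - m1)]. *)
  have alg (K K1 a b c S I y : C) : K = a + b + c -> K1 = K + 1 ->
      (2%:R * K + 3%:R) * I * y + y * (I * (a - 2%:R * b + c)) = 3%:R * I * S * y ->
      3%:R * I * y * (K1 - b - S) = 0.
    move=> -> -> e'; transitivity ((2%:R * (a + b + c) + 3%:R) * I * y + y * (I * (a - 2%:R * b + c)) - 3%:R * I * S * y).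
      by ring.
    by rewrite e' subrr.
  rewrite !rmorphB /=; apply: alg mE _ _; last by rewrite -k1; exact: e.
  by rewrite -[LHS]/((k.+1)%:R) -addn1 natrD.
move/eqP; rewrite intr_eq0 -addrA -opprD subr_eq0 => /eqP ->.
by [].
Qed.

End Weight.

(** * All cochains of degrees one and two *)

Section Cohomology.
Variable R : realType.
Variable k : nat.
Local Notation C := R[i].
Local Notation PV := (mpoly 3 C).
Local Notation G := (SU21 R).
Local Notation P := (subvs_of (pC R)).
Local Notation MF := (G -> PV).
Local Notation s := (sk2 R k).

Definition ymon : multinom 3 := mnm_muln (mnm1 1) k.

Lemma Sk_1 j : Sk k j (1%g : G) = mpolyX C ymon.
Proof.
have I a b : ((1%g : G) : 'M[C]_3) a b = (a == b)%:R by rewrite /= mxE.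
have [v0 v1 v2] : [/\ vc 0 (1%g : G) = 1, vc 1 (1%g : G) = 0 & vc 2 (1%g : G) = 1].
  by rewrite !vcE !I /= !(addr0, add0r).
rewrite /Sk /pL /ci /cbi /vb v0 v1 v2 !conjC1 !conjC0 invr1 pc1 pc0.
by rewrite !expr1n !mul1r mul0r subr0 /px mpolyXn.
Qed.

Lemma vb_1 : vb 0 (1%g : G) = 1 /\ vb 1 (1%g : G) = 0.
Proof.
have I a b : ((1%g : G) : 'M[C]_3) a b = (a == b)%:R by rewrite /= mxE.
by rewrite /vb !vcE !I /= !addr0 conjC1 conjC0 pc1 pc0.
Qed.

Lemma chi_1 : chiX k (X4 R) (1%g : G) = mpolyX C ymon.
Proof.
have [_ _ _ [_ _ x3 x4]] := X_entries R; have [b0 b1] := vb_1.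
by rewrite /chiX /nf x3 x4 Sk_1 b0 b1 pc1 mulr0 subr0 !mul1r.
Qed.

Lemma psi14_1 : psiX k (X1 R) (X4 R) (1%g : G) = mpolyX C ymon.
Proof. by have [_ -> _] := psiX_basis k (1%g : G); have [-> _] := vb_1; rewrite Sk_1 !mul1r. Qed.

Lemma psi34 (g : G) : psiX k (X3 R) (X4 R) g = 0.
Proof.
have [_ _ x3 x4] := X_entries R; rewrite (psiXe k g x3 x4) pc0.
have alg (A : comRingType) (a b c d x : A) : ((0 * a + 0 * b) * c - (0 * a + 0 * b) * d) * x = 0 by ring.
exact: alg.
Qed.

Lemma psi0_14 (g : G) : psi0X k (X1 R) (X4 R) g = 0.
Proof.
have [[_ _ x3 x4] _ _ _] := X_entries R; rewrite /psi0X x3 x4 pc0.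
by rewrite !mul0r subrr mul0r.
Qed.

Lemma psi0_34_1 : psi0X k (X3 R) (X4 R) (1%g : G) = mpolyX C ymon.
Proof.
have [_ _ [_ _ x3 x4] [_ _ y3 y4]] := X_entries R; rewrite /psi0X x3 x4 y3 y4 Sk_1 pc0 pc1.
by rewrite mul0r subr0 !mul1r.
Qed.

(** [m1] is at most [k], so the weight equation with right hand side weight at
most 1 leaves no room. *)
Lemma top_monomial (m : multinom 3) (t : int) : mdeg m = k -> (t <= 1)%R ->
  k.+1%:Z = (m 1%R)%:Z + t -> m = ymon.
Proof.
rewrite mdegE big3 => mk t1 e.
have m1 : m 1%R = k by move: e mk t1; move: (m 0%R) (m 1%R) (m 2%R) => a b c; lia.
apply/mnmP => i; rewrite mulmnE mnm1E; move: i; apply: ord3P => /=; lia.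
Qed.

Lemma cochain_det q (w1 w2 : ('I_q -> P) -> MF) : cochain k w1 -> cochain k w2 ->
  (forall (s : {ffun 'I_q -> 'I_4}) (m : multinom 3), mdeg m = k ->
     k.+1%:Z = (m 1%R)%:Z + \sum_i p_weight (s i) ->
     mcoeff m (w1 (fun i => bX R (s i)) 1%g) = mcoeff m (w2 (fun i => bX R (s i)) 1%g)) ->
  w1 = w2.
Proof.
move=> c1 c2 e; apply: (cochain_eq c1 c2); apply: multilin_eq.
- by case: c1.
- by case: c2.
move=> t; have [h1 h2] : homog k (w1 (fun i => bX R (t i)) 1%g) /\ homog k (w2 (fun i => bX R (t i)) 1%g).
  have [/(_ (fun i => bX R (t i))) [h1 _] _ _] := c1.
  by have [/(_ (fun i => bX R (t i))) [h2 _] _ _] := c2.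
apply: (homog_eq h1 h2) => m; have [mk|mk] := eqVneq (mdeg m) k; last first.
  by move/homogP: h1 => ->; move/homogP: h2 => // ->.
have [E|E] := eqVneq (k.+1%:Z) (((m : multinom 3) 1%R)%:Z + \sum_i p_weight (t i)).
  exact: e.
have Z w : cochain k w -> mcoeff m (w (fun i => bX R (t i)) 1%g) = 0.
  move=> cw; apply/eqP/negP => /negP n0; move/eqP: E; apply.
  exact: weight_vanish cw mk n0.
by rewrite !Z.
Qed.

Lemma p_weight1 : p_weight 1 = -1. Proof. by []. Qed.
Lemma p_weight3 : p_weight 3 = 1. Proof. by []. Qed.

Lemma p_weight_le1 a : p_weight a <= 1.
Proof. by rewrite /p_weight; case: ifP => // _; case: ifP. Qed.

Lemma p_weight_gt0 a : 0 < p_weight a -> a = 3.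
Proof. by rewrite /p_weight; case: ifP => // _; case: eqP. Qed.

Lemma mdeg_le (m : multinom 3) i : (m i <= mdeg m)%N.
Proof. by rewrite mdegE (bigD1 i) //= leq_addr. Qed.

(** The weight at the identity singles out [X4] and [y^k], where [chi] has the
value 1. *)
Lemma cochain1_chi (w : ('I_1 -> P) -> MF) : cochain k w -> exists c, w = c *: @chi R k.
Proof.
move=> cw; exists (mcoeff ymon (w (fun=> bX R 3) 1%g)).
apply: (cochain_det cw (cochain_chi _ _)) => t m mk; rewrite big_ord1 => e.
rewrite (top_monomial mk (p_weight_le1 (t 0)) e).
have t3 : t 0 = 3 by apply: p_weight_gt0; move: e (mdeg_le m 1%R); rewrite mk; move: (p_weight _) (m _) => a b; lia.
have -> : (fun i => bX R (t i)) = fun=> bX R 3 by apply/funext => i; rewrite ord1 t3.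
rewrite -[RHS]/(mcoeff ymon (_ *: @chi R k (fun=> bX R 3) 1%g)) mcoeffZ chiE bX_val [tnth _ _]/(X4 R).
by rewrite chi_1 mcoeffX eqxx mulr1.
Qed.

Definition args2 (y z : P) : 'I_2 -> P := fun i => if i == 0 then y else z.

(** Polarisation of the vanishing on the diagonal. *)
Lemma alt_anti (w : ('I_2 -> P) -> MF) y z : alternating w -> w (args2 y z) = - w (args2 z y).
Proof.
move=> [wl w0].
have u0 a b c : upd (args2 a b) 0 c = args2 c b by apply/funext; apply: ord2P.
have u1 a b c : upd (args2 a b) 1 c = args2 a c by apply/funext; apply: ord2P.
have z0 a : w (args2 a a) = 0 by apply: (w0 _ 0 1).
have l0 a b c : w (args2 (a + b) c) = w (args2 a c) + w (args2 b c).
  by have := wl (args2 0 c) 0 1 a b; rewrite !u0 !scale1r.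
have l1 a b c : w (args2 c (a + b)) = w (args2 c a) + w (args2 c b).
  by have := wl (args2 c 0) 1 1 a b; rewrite !u1 !scale1r.
have := z0 (y + z); rewrite l0 !l1 !z0 addr0 add0r => /eqP.
by rewrite addr_eq0 => /eqP.
Qed.

Lemma good_comb (c1 c2 : C) (F1 F2 : MF) : good k F1 -> good k F2 -> good k (c1 *: F1 + c2 *: F2) /\
  forall X, \tr X = 0 -> actT k X (c1 *: F1 + c2 *: F2) = c1 *: actT k X F1 + c2 *: actT k X F2.
Proof.
move=> g1 g2; have [[T1 a1] h1 n1 w1] := good_scale c1 g1; have [[T2 a2] h2 n2 w2] := good_scale c2 g2.
have hh g : homog k ((c1 *: F1 + c2 *: F2) g) by apply: rpredD; [exact: h1 | exact: h2].
split.
  split=> //.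
  - by exists (fun X g => T1 X g + T2 X g); exact: actD a1 a2.
  - exact: nicepD n1 n2.
  - by move=> g h l l0 hg; rewrite !fDE (w1 _ _ _ l0 hg) (w2 _ _ _ l0 hg) scalerDr.
move=> X tX; rewrite (actT_act (actD a1 a2)) //.
by rewrite -!actT_scale // (actT_act a1) // (actT_act a2).
Qed.

Definition comb c1 c2 (A B : 'M[C]_3) : MF := c1 *: psiX k A B + c2 *: psi0X k A B.

Lemma combE c1 c2 A B g : comb c1 c2 A B g = c1 *: psiX k A B g + c2 *: psi0X k A B g.
Proof. by []. Qed.

Lemma bilin_comb c1 c2 : bilin k (comb c1 c2).
Proof.
split.
- by move=> A B; case: (good_comb c1 c2 (good_psiX k A B) (good_psi0X k A B)).
- move=> a A B D g; rewrite combE (psiX_lin k a A B D g) (psi0X_lin k a A B D g) !combE.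
  have alg (x y z t : PV) : c1 *: (a *: x + y) + c2 *: (a *: z + t) =
    a *: (c1 *: x + c2 *: z) + (c1 *: y + c2 *: t).
    by rewrite (scale_lin_comm c1) (scale_lin_comm c2) addrACA -scalerDr.
  exact: alg.
- move=> A B g; rewrite !combE (psiX_anti k A B g) (psi0X_anti k A B g).
  by rewrite !scalerN opprD.
- by move=> A B D E e1 e2; rewrite /comb (eq_psiX k e1 e2) (eq_psi0X k e1 e2).
- move=> U Y Z Ul Yp Zp.
  have [_ ->] := good_comb c1 c2 (good_psiX k Y Z) (good_psi0X k Y Z); last exact: in_l_tr.
  rewrite (psiX_equiv k Ul Yp Zp) (psi0X_equiv k Ul Yp Zp).
  have alg (x y x' y' : MF) : c1 *: (x + y) + c2 *: (x' + y') = (c1 *: x + c2 *: x') + (c1 *: y + c2 *: y').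
    by rewrite !scalerDr addrACA.
  exact: alg.
Qed.

Lemma dcomb c1 c2 X Y Z : in_p X -> in_p Y -> in_p Z ->
  actT k X (comb c1 c2 Y Z) - actT k Y (comb c1 c2 X Z) + actT k Z (comb c1 c2 X Y) = 0.
Proof.
move=> Xp Yp Zp; have S U A B : in_p U -> actT k U (comb c1 c2 A B) =
    c1 *: actT k U (psiX k A B) + c2 *: actT k U (psi0X k A B).
  by move=> Up; have [_ ->] := good_comb c1 c2 (good_psiX k A B) (good_psi0X k A B); last exact: in_p_tr.
rewrite (S _ _ _ Xp) (S _ _ _ Yp) (S _ _ _ Zp).
have alg (x y z x' y' z' : MF) : c1 *: x + c2 *: x' - (c1 *: y + c2 *: y') + (c1 *: z + c2 *: z') =
  c1 *: (x - y + z) + c2 *: (x' - y' + z').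
  by rewrite !scalerDr !scalerN opprD (addrACA (c1 *: x)) (addrACA (c1 *: x - _)).
apply: etrans (alg _ _ _ _ _ _) _.
apply: etrans (congr2 (fun u v : MF => c1 *: u + c2 *: v) (dpsiX k Xp Yp Zp) (dpsi0X k Xp Yp Zp)) _.
by rewrite !scaler0 addr0.
Qed.

Definition psi_span c1 c2 : ('I_2 -> P) -> MF := c1 *: @psi R k + c2 *: @psi0 R k.

Lemma psi_span_comb c1 c2 : psi_span c1 c2 = 1 *: cochain2 (comb (c1 * s) c2).
Proof.
rewrite scale1r /psi_span psi_cochain2 psi0_cochain2 scalerA; apply/funext => Y.
by [].
Qed.

Lemma psi_span_cocycle c1 c2 : cocycle k (psi_span c1 c2).
Proof.
rewrite psi_span_comb; split; first by apply: cochain_bilin; exact: bilin_comb.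
by apply: dCE_bilin; [exact: bilin_comb | exact: dcomb].
Qed.

(** The two evaluations that separate [psi] from [psi0]. *)
Lemma psi_span_at c1 c2 : mcoeff ymon (psi_span c1 c2 (args2 (bX R 0) (bX R 3)) 1%g) = c1 * s /\
  mcoeff ymon (psi_span c1 c2 (args2 (bX R 2) (bX R 3)) 1%g) = c2.
Proof.
rewrite psi_span_comb !scale1r /cochain2 /args2 eqxx (_ : (1 == 0 :> 'I_2) = false) // !bX_val.
rewrite [tnth _ 0]/(X1 R) [tnth _ 2]/(X3 R) [tnth _ 3]/(X4 R) !combE.
rewrite psi14_1 psi0_14 psi34 psi0_34_1 !scaler0 addr0 add0r !mcoeffZ mcoeffX eqxx !mulr1.
by [].
Qed.

Lemma psi_span_inj c1 c2 d1 d2 : psi_span c1 c2 = psi_span d1 d2 -> c1 = d1 /\ c2 = d2.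
Proof.
move=> e; have [a1 a2] := psi_span_at c1 c2; have [b1 b2] := psi_span_at d1 d2.
split; last by rewrite -a2 e.
by apply: (mulIf (sk2_neq0 R k)); rewrite -a1 e.
Qed.

(** The weight at the identity leaves the pairs [X1, X4] and [X3, X4] with
[y^k]; [psi] is nonzero on the first only and [psi0] on the second only. *)
Lemma cochain2_psi_span (w : ('I_2 -> P) -> MF) : cochain k w -> exists c1 c2, w = psi_span c1 c2.
Proof.
move=> cw; exists (mcoeff ymon (w (args2 (bX R 0) (bX R 3)) 1%g) / s), (mcoeff ymon (w (args2 (bX R 2) (bX R 3)) 1%g)).
set c1 := _ / s; set c2 := mcoeff _ _.
have cV : cochain k (psi_span c1 c2) by case: (psi_span_cocycle c1 c2).
have [v1 v2] := psi_span_at c1 c2; rewrite divfK ?sk2_neq0 // in v1.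
apply: (cochain_det cw cV) => t m mk; rewrite big2 => e.
have alw : alternating w by case: cw.
have alV : alternating (psi_span c1 c2) by case: cV.
have -> : (fun i => bX R (t i)) = args2 (bX R (t 0)) (bX R (t 1)) by apply/funext; apply: ord2P.
have z (w' : ('I_2 -> P) -> MF) a : alternating w' -> w' (args2 (bX R a) (bX R a)) = 0.
  by move=> [_ w0]; apply: (w0 _ 0 1).
have [e01|ne01] := eqVneq (t 0) (t 1); first by rewrite e01 !z.
have key (a : 'I_4) : a != 3 -> k.+1%:Z = (m 1%R)%:Z + p_weight a + 1 ->
    mcoeff m (w (args2 (bX R a) (bX R 3)) 1%g) = mcoeff m (psi_span c1 c2 (args2 (bX R a) (bX R 3)) 1%g).
  move=> a3 ea.
  have a1 : a != 1.
    by apply/eqP => a1; move: ea (mdeg_le m 1%R); rewrite mk a1 p_weight1; move: (m _) => b; lia.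
  have epa : p_weight a = 0 by rewrite /p_weight (negPf a1) (negPf a3).
  rewrite (top_monomial (t := 1) mk _ _) //; last by rewrite ea epa addr0.
  have [->|->] : a = 0 \/ a = 2.
    case: a a1 a3 {ea epa} => [[|[|[|[|//]]]] p] // _ _; [left|right]; exact: val_inj.
  - by rewrite v1.
  - by rewrite v2.
have [t0|t0] := eqVneq (t 0) 3.
  rewrite t0 (alt_anti _ _ alw) (alt_anti _ _ alV) !fNE !mcoeffN key //; first by rewrite -t0 eq_sym.
  by rewrite e t0 p_weight3 [1 + _]addrC addrA.
have [t1|t1] := eqVneq (t 1) 3.
  by rewrite t1 key // e t1 p_weight3 addrA.
exfalso; move: e (mdeg_le m 1%R); rewrite mk.
have n a : a != 3 -> p_weight a <= 0 by move=> a3; rewrite leNgt; apply/negP => /p_weight_gt0 /eqP; exact/negP.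
have := n _ t0; have := n _ t1; move: (p_weight _) (p_weight _) (m _) => a b c; lia.
Qed.

End Cohomology.

(** * The cohomology in degree two *)

Section Classes.
Variable R : realType.
Variable k : nat.
Local Notation C := R[i].
Local Notation P := (subvs_of (pC R)).
Local Notation MF := (SU21 R -> mpoly 3 C).
Local Notation s := (sk2 R k).
Local Notation psi_span := (@psi_span R k).

(** By [cochain1_chi] the coboundaries are the multiples of the differential
of [chi]. *)
Lemma coboundaryP (z : ('I_2 -> P) -> MF) : coboundary k z <-> exists c, z = psi_span (c / s) c.
Proof.
split=> [[b /cochain1_chi [c ->] ->]|[c ->]]; first by exists c; rewrite dCE_chi.
by exists (c *: @chi R k); [exact: cochain_chi | rewrite dCE_chi].
Qed.

Lemma psi_spanB a b c d : psi_span a b - psi_span c d = psi_span (a - c) (b - d).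
Proof. by rewrite /psi_span opprD addrACA -!scalerBl. Qed.

(** The class of [x psi + y psi0] is read off from [y - s x], a linear form
that vanishes on the coboundaries. *)
Definition class_of (t : C) : set (('I_2 -> P) -> MF) := [set z | exists x y, z = psi_span x y /\ y - s * x = t].

Lemma coh_class_psi_span a b : coh_class k (psi_span a b) = class_of (b - s * a).
Proof.
have s0 := sk2_neq0 R k; apply/seteqP; split => z.
  move=> [[/cochain2_psi_span [x [y ->]] _]]; rewrite psi_spanB => /coboundaryP [c /psi_span_inj [e1 e2]].
  exists x, y; split => //; have ex : x = c / s + a by rewrite -e1 subrK.
  have ey : y = c + b by rewrite -e2 subrK.
  by rewrite ex ey; field.
move=> [x [y [-> e]]]; split; first exact: psi_span_cocycle.
apply/coboundaryP; exists (y - b); rewrite psi_spanB; congr psi_span.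
have ey : y = b - s * a + s * x by rewrite -e subrK.
by rewrite ey; field.
Qed.

Lemma class_of_inj t u : class_of t = class_of u -> t = u.
Proof.
move=> e; have : class_of u (psi_span 0 t) by rewrite -e; exists 0, t; rewrite mulr0 subr0.
by move=> [x [y [/psi_span_inj [<- <-]]]]; rewrite mulr0 subr0.
Qed.

Lemma cohomologyE : @cohomology R k 2 = [set class_of t | t in [set: C]].
Proof.
apply/seteqP; split => [S [z [cz _] <-]|S [t _ <-]].
  have [a [b ->]] := cochain2_psi_span cz; rewrite coh_class_psi_span.
  by exists (b - s * a).
exists (psi_span 0 t); first exact: psi_span_cocycle.
by rewrite coh_class_psi_span mulr0 subr0.
Qed.

Lemma psi_psi_span a : a *: @psi R k = psi_span a 0. Proof. by rewrite /psi_span scale0r addr0. Qed.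
Lemma psi0_psi_span a : a *: @psi0 R k = psi_span 0 a. Proof. by rewrite /psi_span scale0r add0r. Qed.

Lemma generator_psi : coh_generator k (@psi R k).
Proof.
have s0 := sk2_neq0 R k.
split; first by rewrite -[psi k]scale1r psi_psi_span; exact: psi_span_cocycle.
rewrite cohomologyE; apply/seteqP; split => S [t _ <-].
  exists (- (t / s)) => //; rewrite psi_psi_span coh_class_psi_span; congr class_of; by field.
by exists (0 - s * t) => //; rewrite psi_psi_span coh_class_psi_span.
Qed.

Lemma generator_psi0 : coh_generator k (@psi0 R k).
Proof.
split; first by rewrite -[psi0 k]scale1r psi0_psi_span; exact: psi_span_cocycle.
rewrite cohomologyE; apply/seteqP; split => S [t _ <-]; exists t => //;
  by rewrite psi0_psi_span coh_class_psi_span mulr0 subr0.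
Qed.

Lemma dim_one : coh_dim_one R k 2.
Proof.
have E a : coh_class k (a *: @psi0 R k) = class_of a by rewrite psi0_psi_span coh_class_psi_span mulr0 subr0.
exists (@psi0 R k); first by case: generator_psi0.
split.
- by move=> a _; rewrite cohomologyE E; exists a.
- by move=> a b _ _; rewrite !E => /class_of_inj.
- by move=> S; rewrite cohomologyE => -[t _ <-]; exists t.
Qed.

Lemma psi_not_coboundary : ~ coboundary k (@psi R k).
Proof.
rewrite -[psi k]scale1r psi_psi_span => /coboundaryP [c /psi_span_inj [e1 e2]].
by move/eqP: e1; rewrite -e2 mul0r oner_eq0.
Qed.

Lemma psi0_not_coboundary : ~ coboundary k (@psi0 R k).
Proof.
rewrite -[psi0 k]scale1r psi0_psi_span => /coboundaryP [c /psi_span_inj [e1 e2]].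
by move/eqP: e1; rewrite -e2 mul1r eq_sym invr_eq0 (negPf (sk2_neq0 R k)).
Qed.

Lemma pplus_entries (A : 'M[C]_3) : A \in pplus R -> A 2 0 = 0 /\ A 2 1 = 0.
Proof.
have [[_ _ a1 a2] [_ _ b1 b2] _ _] := X_entries R.
have pE : pplus R = <<[tuple X1 R; X2 R]>>%VS by [].
rewrite pE => /coord_span; rewrite big2 /= => ->.
by rewrite !mxDZE !mxE /= !mulr0 !addr0.
Qed.

Lemma pminus_entries (A : 'M[C]_3) : A \in pminus R -> A 0 2 = 0 /\ A 1 2 = 0.
Proof.
have pE : pminus R = <<[tuple X3 R; X4 R]>>%VS by [].
rewrite pE => /coord_span; rewrite big2 /= => ->.
by rewrite !mxDZE !mxE /= !mulr0 !addr0.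
Qed.

Lemma supported_psi : supported_on 1 (@psi R k).
Proof.
move=> a a2 a1 Y YE; rewrite psiE; have [e|e] : a = 0%N \/ a = 2%N.
- by move: a a2 a1 {YE} => [|[|[|//]]]; [left | | right].
- have [e1 e2] : vsval (Y 0) 0 2 = 0 /\ vsval (Y 0) 1 2 = 0 by apply: pminus_entries; have := YE 0; rewrite e.
  have [f1 f2] : vsval (Y 1) 0 2 = 0 /\ vsval (Y 1) 1 2 = 0 by apply: pminus_entries; have := YE 1; rewrite e.
  apply/funext => g; rewrite fZE /psiX /mf e1 e2 f1 f2 pc0.
  have alg (A : comRingType) (x y n n' S : A) : ((0 * x + 0 * y) * n - (0 * x + 0 * y) * n') * S = 0 by ring.
  by rewrite alg scaler0.
- have [e1 e2] : vsval (Y 0) 2 0 = 0 /\ vsval (Y 0) 2 1 = 0 by apply: pplus_entries; have := YE 0; rewrite e.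
  have [f1 f2] : vsval (Y 1) 2 0 = 0 /\ vsval (Y 1) 2 1 = 0 by apply: pplus_entries; have := YE 1; rewrite e.
  apply/funext => g; rewrite fZE /psiX /nf e1 e2 f1 f2 pc0.
  have alg (A : comRingType) (x y n n' S : A) : (n * (0 * x - 0 * y) - n' * (0 * x - 0 * y)) * S = 0 by ring.
  by rewrite alg scaler0.
Qed.

Lemma supported_psi0 : supported_on 0 (@psi0 R k).
Proof.
move=> a a2 a0 Y YE; rewrite psi0E.
have [e1 e2] : vsval (Y 0) 2 0 = 0 /\ vsval (Y 0) 2 1 = 0.
  by apply: pplus_entries; have := YE 0; rewrite lt0n a0.
apply/funext => g; rewrite /psi0X e1 e2 pc0.
have alg (A : comRingType) (x y S : A) : (0 * x - 0 * y) * S = 0 by ring.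
exact: alg.
Qed.

End Classes.

Theorem theorem4p16 (R : realType) (k : nat) :
  [/\ (* (i) *)
      cochain k (@chi R k) /\
      dCE k (@chi R k) =
        ((Num.sqrt k.+2%:R)^-1)%:C *: @psi R k + @psi0 R k,
      (* (ii) *)
      dCE k (@psi0 R k) = 0 /\ dCE k (@psi R k) = 0,
      (* (iii) *)
      ~ coboundary k (@psi R k) /\ ~ coboundary k (@psi0 R k) &
      (* (iv) *)
      [/\ coh_dim_one R k 2,
          coh_generator k (@psi R k),
          coh_generator k (@psi0 R k),
          supported_on 1 (@psi R k) &
          supported_on 0 (@psi0 R k)]].
Proof.
split.
- rewrite -[chi k]scale1r; split; first exact: cochain_chi.
  by rewrite dCE_chi scale1r div1r /sk2 -fmorphV.
- by case: (generator_psi R k) => -[_ ->] _; case: (generator_psi0 R k) => -[_ ->] _.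
- by split; [exact: psi_not_coboundary | exact: psi0_not_coboundary].
- split.
  + exact: dim_one.
  + exact: generator_psi.
  + exact: generator_psi0.
  + exact: supported_psi.
  + exact: supported_psi0.
Qed.
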